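(* Let $M$ be a compact orientable $2$-dimensional smooth manifold endowed with a $2$-dimensional almost-Riemannian structure $(E,\mathfrak f,\langle\cdot,\cdot\rangle)$, with associated submodule $\mathcal D=\mathfrak f_*(\Gamma(E))\subseteq\mathrm{Vec}(M)$ and singular set $\mathcal Z$. Assume that (HA) $\mathcal Z$ is an embedded one-dimensional submanifold of $M$, and (HB) $\mathcal D(q)+[\mathcal D,\mathcal D](q)=T_qM$ for every $q\in M$. Let $d\omega$ be the corresponding Riemannian area on $M\setminus\mathcal Z$ and let $\Delta$ denote the unique self-adjoint extension on $L^2(M,d\omega)$ of the Laplace-Beltrami operator with domain $C_0^\infty(M\setminus\mathcal Z)$. Let $\Omega$ be a connected component of $M\setminus\mathcal Z$, let $u_0\in L^2(M,d\omega)$ be supported in $\Omega$, and let $u$ be the unique solution of the Schrödinger equation $$i\partial_t u+\Delta u=0,\qquad u(0)=u_0 .$$ Then $u(t)$ is supported in $\Omega$ for every $t\ge 0$. The same holds for the solution of the heat equation $\partial_tu=\Delta u$, $u(0)=u_0$, and for the solution of the wave equation $\partial_t^2u=\Delta u$, $u(0)=u_0$, $\partial_tu(0)=u_1$, with initial data $u_0,u_1\in L^2(M,d\omega)$ supported in $\Omega$.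
   Context: Manifolds are smooth and without boundary; $\mathrm{Vec}(M)$ is the set of smooth vector fields on $M$; $C_0^\infty$ denotes smooth compactly supported functions. A $2$-dimensional almost-Riemannian structure (2-ARS) on a smooth surface $M$ is a triple $(E,\mathfrak f,\langle\cdot,\cdot\rangle)$ where $E$ is a rank-$2$ vector bundle over $M$, $\langle\cdot,\cdot\rangle$ is a Euclidean structure on $E$ (a scalar product on $E_q$ depending smoothly on $q$), and $\mathfrak f:E\to TM$ is a morphism of vector bundles over the identity of $M$ (linear on fibers), such that the submodule $\mathcal D=\mathfrak f_*(\Gamma(E))=\{\mathfrak f\circ\sigma:\sigma\in\Gamma(E)\}$ of $\mathrm{Vec}(M)$ is bracket generating, i.e. the evaluations at $q$ of elements of the Lie algebra generated by $\mathcal D$ span $T_qM$, for every $q\in M$. Set $\mathcal D(q)=\{V(q):V\in\mathcal D\}=\mathfrak f(E_q)$, and $[\mathcal D,\mathcal D](q)$ is the span of $\{[V,W](q):V,W\in\mathcal D\}$. The singular set is $\mathcal Z=\{q\in M:\dim\mathcal D(q)<2\}$. On $M\setminus\mathcal Z$, $g$ denotes the Riemannian metric obtained by transporting $\langle\cdot,\cdot\rangle$ via the isomorphisms $\mathfrak f|_{E_q}$; $d\omega$ is its Riemannian area; $L^2(M,d\omega)$ means $L^2(M\setminus\mathcal Z,d\omega)$; the Laplace-Beltrami operator is $\Delta\phi=\mathrm{div}(\nabla\phi)$ with $\nabla$ the gradient of $g$ and $\mathrm{div}$ the divergence with respect to $d\omega$. Under (HA) and (HB) this operator with domain $C_0^\infty(M\setminus\mathcal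 Z)$ is essentially self-adjoint on $L^2(M,d\omega)$, and $-\Delta\ge0$. Solutions are those given by the functional calculus of the self-adjoint operator $\Delta$: $e^{it\Delta}u_0$ for Schrödinger, $e^{t\Delta}u_0$ for heat, and $\cos(t\sqrt{-\Delta})u_0+\frac{\sin(t\sqrt{-\Delta})}{\sqrt{-\Delta}}u_1$ for wave. ''Supported in $\Omega$'' means vanishing almost everywhere outside $\Omega$. *)

(* Defs.v *)
From HB Require Import structures.
From mathcomp Require Import all_boot all_order all_algebra.
From mathcomp Require Import all_classical all_reals all_analysis.
From mathcomp Require Import complex.
Set Implicit Arguments.
Unset Strict Implicit.
Unset Printing Implicit Defensive.
Import Order.TTheory GRing.Theory Num.Theory numFieldNormedType.Exports.
Local Open Scope classical_set_scope.
Local Open Scope ring_scope.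

Section LinearAlgebra.
Context (R : realType) (V : lmodType R).

Definition lin_span (A : set V) : set V :=
  [set v | exists (n : nat) (a : 'I_n -> R) (w : 'I_n -> V),
     (forall i, A (w i)) /\ v = \sum_(i < n) a i *: w i].

(* [dim W < n]: any n vectors of W are linearly dependent. *)
Definition dim_lt (W : set V) (n : nat) : Prop :=
  forall w : 'I_n -> V, (forall i, W (w i)) ->
    exists a : 'I_n -> R, (exists i, a i != 0) /\ \sum_(i < n) a i *: w i = 0.

Definition set_sum (A B : set V) : set V := [set v + w | v in A & w in B].

End LinearAlgebra.

Section PlaneCalculus.
Context (R : realType).

(* Coordinates of the plane are indexed by bool: false is the first one. *)
Definition axis (b : bool) : R * R := if b then (0, 1) else (1, 0).
Definition coordinate (b : bool) (y : R * R) : R := if b then y.2 else y.1.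

Definition partial (b : bool) (f : R * R -> R) : R * R -> R :=
  fun y => 'D_(axis b) f y.

Definition iter_partial (s : seq bool) (f : R * R -> R) : R * R -> R :=
  foldr partial f s.

(* C^oo on an open set U: all iterated partial derivatives exist and are
   continuous. *)
Definition smooth_plane (U : set (R * R)) (f : R * R -> R) : Prop :=
  forall (s : seq bool) (y : R * R), U y ->
    {for y, continuous (iter_partial s f)} /\
    forall b, derivable (iter_partial s f) y (axis b).

End PlaneCalculus.

(* The inverse [cof] is only meaningful on [cimg], and [cto] on [cdom]. *)
Record chart (R : realType) (M : topologicalType) := Chart {
  cdom : set M;
  cimg : set (R * R);
  cto : M -> R * R;
  cof : R * R -> M;
  cdom_open : open cdom;
  cimg_open : open cimg;
  cto_img : forall q, cdom q -> cimg (cto q);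
  cof_dom : forall y, cimg y -> cdom (cof y);
  cto_K : forall q, cdom q -> cof (cto q) = q;
  cof_K : forall y, cimg y -> cto (cof y) = y;
  cto_cts : forall q, cdom q -> {for q, continuous cto};
  cof_cts : forall y, cimg y -> {for y, continuous cof}
}.

Section Charts.
Context (R : realType) (M : topologicalType).
Implicit Types c d : chart R M.

Definition overlap c d : set (R * R) := cimg c `&` cof c @^-1` cdom d.
Definition transition c d : R * R -> R * R := cto d \o cof c.

Definition smooth_transition c d : Prop :=
  forall b, smooth_plane (overlap c d) (coordinate b \o transition c d).

Definition jacobian c d (y : R * R) : R :=
  let D i j := partial j (coordinate i \o transition c d) y in
  D false false * D true true - D false true * D true false.

End Charts.

(* Second countability is not required: surfaces are only used here under the
   assumption that they are compact, which implies it. *)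
Record smooth_surface (R : realType) (M : topologicalType) := SmoothSurface {
  atlas : set (chart R M);
  atlas_cover : forall q, exists c, atlas c /\ cdom c q;
  atlas_smooth : forall c d, atlas c -> atlas d -> smooth_transition c d;
  surface_hausdorff : hausdorff_space M
}.

Section Surfaces.
Context (R : realType) (M : topologicalType) (S : smooth_surface R M).

Definition chart_at (q : M) : chart R M := projT1 (cid (atlas_cover S q)).

(* Charts of the maximal atlas. *)
Definition smooth_chart (c : chart R M) : Prop :=
  forall d, atlas S d -> smooth_transition c d /\ smooth_transition d c.

Definition orientable : Prop :=
  exists B : set (chart R M),
    [/\ forall c, B c -> smooth_chart c,
        forall q, exists c, B c /\ cdom c q &
        forall c d, B c -> B d -> forall y, overlap c d y -> 0 < jacobian c d y].

Definition embedded_curve (Z : set M) : Prop :=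
  forall q, Z q -> exists c, [/\ smooth_chart c, cdom c q &
    forall p, cdom c p -> (Z p <-> (cto c p).2 = 0)].

(* W is meant to be open. *)
Definition smooth_on (W : set M) (phi : M -> R) : Prop :=
  forall c, atlas S c ->
    smooth_plane (cimg c `&` cof c @^-1` W) (phi \o cof c).

Definition smooth (phi : M -> R) : Prop := smooth_on setT phi.

(* Tangent vectors at q are the point derivations of C^oo(M), extended by 0
   to non-smooth functions so that two of them are equal as functions as soon
   as they agree on C^oo(M).  Vector fields are families of such. *)
Definition functional := (M -> R) -> R.

Definition tangent (q : M) : set functional :=
  [set v : functional | [/\ forall a phi psi, smooth phi -> smooth psi ->
               v (fun p => a * phi p + psi p) = a * v phi + v psi,
           forall phi psi, smooth phi -> smooth psi ->
               v (fun p => phi p * psi p) = phi q * v psi + psi q * v phi &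
           forall phi, ~ smooth phi -> v phi = 0]].

Definition vfield := M -> functional.

Definition bracket (X Y : vfield) : vfield := fun q phi =>
  X q (fun p => Y p phi) - Y q (fun p => X p phi).

Definition generated_lie_algebra (D : set vfield) : set vfield :=
  [set X | forall L : set vfield, D `<=` L -> L 0 ->
     (forall a X1 X2, L X1 -> L X2 -> L (a *: X1 + X2)) ->
     (forall X1 X2, L X1 -> L X2 -> L (bracket X1 X2)) -> L X].

Definition eval_at (D : set vfield) (q : M) : set functional :=
  [set X q | X in D].

Definition bracket_generating (D : set vfield) : Prop :=
  forall q, lin_span (eval_at (generated_lie_algebra D) q) = tangent q.

Definition coord_vector (c : chart R M) (b : bool) (q : M) : functional :=
  fun phi => if `[< smooth phi >] then partial b (phi \o cof c) (cto c q) else 0.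

(* Components of a tangent vector at a point q of the domain of c. *)
Definition components (c : chart R M) (q : M) (v : functional) : R * R :=
  xget 0 [set a | v = a.1 *: coord_vector c false q + a.2 *: coord_vector c true q].

End Surfaces.

(* A smooth rank-2 real vector bundle, given by its fibres and its local
   trivializations [triv i q : fib q ~ R^2] over the open sets [tdom i]; the
   topology and the smooth structure of the total space are determined by the
   smoothness of the transition maps. *)
Record bundle2 (R : realType) (M : topologicalType) (S : smooth_surface R M) :=
 Bundle2 {
  fib : M -> lmodType R;
  tindex : Type;
  tdom : tindex -> set M;
  triv : forall (i : tindex) (q : M), {linear fib q -> (R * R)%type};
  trivV : forall (i : tindex) (q : M), R * R -> fib q;
  tdom_open : forall i, open (tdom i);
  tdom_cover : forall q, exists i, tdom i q;
  trivK : forall i q, tdom i q -> cancel (triv i q) (trivV i q);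
  trivVK : forall i q, tdom i q -> cancel (trivV i q) (triv i q);
  triv_smooth : forall i j (y : R * R) b,
    smooth_on S (tdom i `&` tdom j)
      (fun q => coordinate b (triv j q (trivV i q y)))
}.

Definition smooth_section (R : realType) (M : topologicalType)
    (S : smooth_surface R M) (E : bundle2 S) (sigma : forall q, fib E q) : Prop :=
  forall (i : tindex E) b,
    smooth_on S (tdom i) (fun q => coordinate b (triv i q (sigma q))).

Definition submodule_of (R : realType) (M : topologicalType)
    (S : smooth_surface R M) (E : bundle2 S)
    (f : forall q, fib E q -> functional R M) : set (vfield R M) :=
  [set X | exists2 sigma, smooth_section sigma & X = fun q => f q (sigma q)].

Record ars (R : realType) (M : topologicalType) (S : smooth_surface R M) := Ars {
  abundle : bundle2 S;
  anchor : forall q, {linear fib abundle q -> functional R M};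
  scal : forall q, fib abundle q -> fib abundle q -> R;
  scal_lin : forall q a (e1 e2 e : fib abundle q),
    scal (a *: e1 + e2) e = a * scal e1 e + scal e2 e;
  scal_sym : forall q (e1 e2 : fib abundle q), scal e1 e2 = scal e2 e1;
  scal_pos : forall q (e : fib abundle q), e != 0 -> 0 < scal e e;
  scal_smooth : forall (i : tindex abundle) (y z : R * R), smooth_on S (tdom i)
    (fun q => scal (trivV i q y) (trivV i q z));
  anchor_tangent : forall q (e : fib abundle q), tangent S q (anchor q e);
  anchor_smooth : forall (i : tindex abundle) (y : R * R) phi, smooth S phi ->
    smooth_on S (tdom i) (fun q => anchor q (trivV i q y) phi);
  ars_generating : bracket_generating S (submodule_of (fun q => anchor q))
}.

Section AlmostRiemannian.
Context (R : realType) (M : topologicalType) (S : smooth_surface R M).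
Context (A : ars S).

Definition horizontal_fields : set (vfield R M) := submodule_of (fun q => anchor A q).

Definition brackets : set (vfield R M) :=
  [set bracket V W | V in horizontal_fields & W in horizontal_fields].

Definition singular_set : set M :=
  [set q | dim_lt (eval_at horizontal_fields q) 2].

Definition step_two : Prop := forall q,
  set_sum (eval_at horizontal_fields q) (lin_span (eval_at brackets q)) = tangent S q.

(* The notions below are meant off the singular set, where the anchor is an
   isomorphism from the fibre onto the tangent space. *)
Definition metric (q : M) (v w : functional R M) : R :=
  let lift v := xget 0 [set e | anchor A q e = v] in scal (lift v) (lift w).

Definition area_density (c : chart R M) (q : M) : R :=
  let G i j := metric q (coord_vector S c i q) (coord_vector S c j q) in
  Num.sqrt (G false false * G true true - G false true * G true false).

Definition gradient (phi : M -> R) : vfield R M := fun q =>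
  xget 0 [set v | tangent S q v /\ forall w, tangent S q w -> metric q v w = w phi].

Definition divergence (X : vfield R M) (q : M) : R :=
  let c := chart_at S q in
  (area_density c q)^-1 *
  \sum_(b : bool) partial b (fun y => area_density c (cof c y) *
     coordinate b (components S c (cof c y) (X (cof c y)))) (cto c q).

Definition real_laplacian (phi : M -> R) (q : M) : R := divergence (gradient phi) q.

Definition laplacian (phi : M -> complex R) (q : M) : complex R :=
  if `[< singular_set q >] then 0 else
  Complex (real_laplacian (@complex.Re R \o phi) q)
          (real_laplacian (@complex.Im R \o phi) q).

(* C_0^oo(M \ Z; C), extended by 0 to M. *)
Definition test_function (phi : M -> complex R) : Prop :=
  let supp := closure [set q | phi q != 0] in
  [/\ smooth S (@complex.Re R \o phi), smooth S (@complex.Im R \o phi),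
      compact supp & supp `<=` ~` singular_set].

Definition laplace_beltrami : set ((M -> complex R) * (M -> complex R)) :=
  [set p | test_function p.1 /\ p.2 = laplacian p.1].

End AlmostRiemannian.

Notation borel M := (g_sigma_algebraType (@open M)).

(* The area of M \ Z, extended by 0 to Z, so that L^2(M \ Z) is L^2(M) for it. *)
Definition riemannian_area (R : realType) (M : ptopologicalType)
    (S : smooth_surface R M) (A : ars S)
    (omega : {measure set (borel M) -> \bar R}) : Prop :=
  omega (singular_set A) = 0%E /\
  forall c (B : set (borel M)), atlas S c -> measurable B ->
    B `<=` cdom c `\` singular_set A ->
    omega B = (\int[(@lebesgue_measure R \x @lebesgue_measure R)%E]_(y in cimg c `&` cof c @^-1` B)
                 (area_density A c (cof c y))%:E)%E.

Definition normsq (R : realType) (z : complex R) : R :=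
  @complex.Re R z ^+ 2 + @complex.Im R z ^+ 2.

(* Elements of L^2 are represented by functions, and an operator by its graph,
   a set of pairs of such functions; equality in L^2 is equality a.e. *)
Section L2.
Context (R : realType) (d : measure_display) (T : measurableType d).
Context (mu : {measure set T -> \bar R}).
Local Notation F := (T -> complex R).
Implicit Types (f g : F) (A : set (F * F)).

Definition l2normsq f : \bar R := (\int[mu]_x (normsq (f x))%:E)%E.

Definition L2 f : Prop :=
  [/\ measurable_fun setT (@complex.Re R \o f),
      measurable_fun setT (@complex.Im R \o f) & (l2normsq f < +oo)%E].

Definition ae_equal f g : Prop := {ae mu, forall x, f x = g x}.

Definition inner f g : complex R :=
  let h x := f x * conjc (g x) in
  Complex (Rintegral mu setT (@complex.Re R \o h)) (Rintegral mu setT (@complex.Im R \o h)).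

Definition adjoint A : set (F * F) :=
  [set p | [/\ L2 p.1, L2 p.2 &
     forall f g, A (f, g) -> inner g p.1 = inner f p.2]].

Definition densely_defined A : Prop :=
  forall f (e : R), L2 f -> 0 < e ->
    exists h k, A (h, k) /\ (l2normsq (f \- h)%R < e%:E)%E.

Definition self_adjoint A : Prop := densely_defined A /\ adjoint A = A.

Definition self_adjoint_extension A0 A : Prop := A0 `<=` A /\ self_adjoint A.

(* A projection-valued Borel measure on the line, together with its scalar
   measures B |-> <E(B) f, f> = |E(B) f|^2. *)
Record pvm := Pvm {
  pvm_proj : set R -> F -> F;
  pvm_meas : F -> {measure set (measurableTypeR R) -> \bar R};
  pvm_L2 : forall (B : set (measurableTypeR R)) f, measurable B ->
    L2 f -> L2 (pvm_proj B f);
  pvm_sym : forall (B : set (measurableTypeR R)) f g, measurable B ->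
    L2 f -> L2 g -> inner (pvm_proj B f) g = inner f (pvm_proj B g);
  pvm_mul : forall (B C : set (measurableTypeR R)) f,
    measurable B -> measurable C -> L2 f ->
    ae_equal (pvm_proj (B `&` C) f) (pvm_proj B (pvm_proj C f));
  pvm_full : forall f, L2 f -> ae_equal (pvm_proj setT f) f;
  pvm_measE : forall (B : set (measurableTypeR R)) f, measurable B -> L2 f ->
    pvm_meas f B = l2normsq (pvm_proj B f)
}.

(* Simple Borel functions on the line, as lists of (value, set). *)
Definition simple_fun (s : seq (complex R * set (measurableTypeR R))) (x : R) :
    complex R :=
  \sum_(p <- s) (if `[< p.2 x >] then p.1 else 0).

Definition simple_calculus (E : pvm)
    (s : seq (complex R * set (measurableTypeR R))) (u : F) : F :=
  fun x => \sum_(p <- s) p.1 * pvm_proj E p.2 u x.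

(* v = (\int h dE) u, defined as the limit of (\int s dE) u as the simple
   functions s tend to h in L^2 for the scalar measure of u. *)
Definition pvm_calculus (E : pvm) (h : R -> complex R) (u v : F) : Prop :=
  [/\ L2 u, L2 v &
   forall e : R, 0 < e ->
     exists s : seq (complex R * set (measurableTypeR R)),
     [/\ forall p, p \in s -> measurable p.2,
         (\int[pvm_meas E u]_x (normsq (h x - simple_fun s x)%R)%:E < e%:E)%E &
         (l2normsq (v \- simple_calculus E s u)%R < e%:E)%E]].

Definition spectral_measure A (E : pvm) : Prop :=
  A = [set p | pvm_calculus E (fun x => Complex x 0) p.1 p.2].

(* v = h(A) u for a self-adjoint operator A and a Borel function h. *)
Definition functional_calculus A (h : R -> complex R) (u v : F) : Prop :=
  exists2 E, spectral_measure A E & pvm_calculus E h u v.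

Definition schrodinger_solution A (u0 : F) (u : R -> F) : Prop :=
  forall t, 0 <= t ->
    functional_calculus A (fun x => Complex (cos (t * x)) (sin (t * x))) u0 (u t).

Definition heat_solution A (u0 : F) (u : R -> F) : Prop :=
  forall t, 0 <= t ->
    functional_calculus A (fun x => Complex (expR (t * x)) 0) u0 (u t).

(* Since the spectrum lies in x <= 0, the values for x > 0 (where Num.sqrt (- x)
   is 0) are irrelevant; sin (t s) / s is t at s = 0. *)
Definition wave_solution A (u0 u1 : F) (u : R -> F) : Prop :=
  forall t, 0 <= t -> exists v w : F,
    [/\ functional_calculus A (fun x => Complex (cos (t * Num.sqrt (- x))) 0) u0 v,
        functional_calculus A
          (fun x => let s := Num.sqrt (- x) in
             Complex (if s == 0 then t else sin (t * s) / s) 0) u1 w,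
        L2 (u t) & ae_equal (u t) (fun x => v x + w x)].

Definition supported_in (W : set T) f : Prop :=
  {ae mu, forall x, ~ W x -> f x = 0}.

End L2.

(* Main.v *)
(* Let U be the multiplication by -1 on Omega and by 1 elsewhere. The regular
   set is open and Omega is one of its components, so U is locally constant there
   and maps test functions to test functions; since the Laplacian is local,
   U Delta U is again a self-adjoint extension of the Laplace-Beltrami operator,
   and uniqueness gives U Delta U = Delta.

   A spectral measure E of Delta then commutes with U. If I is the interval of
   centre c and radius r, and J lies at distance at least r' > r from c, then
   X = E(J) U E(I) satisfies |X| <= (r / r') |X|, hence X = 0; so U preserves the
   range of E(I), and commutes with E(I) as both are symmetric. For u, w with
   U u = - u and U w = w, the finite measures |E(.)(u + w)|^2 and
   |E(.) u|^2 + |E(.) w|^2 thus agree on compact intervals, hence on all Borel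
   sets, and the vectors E(B) u are supported in Omega. So are the limits of
   their linear combinations, in particular the three solutions.

   Locality of the Laplacian rests on the fact that the tangent space at q, made
   of the derivations of C^oo(M), is spanned by the two coordinate vectors, which
   follows from bump functions and Hadamard's lemma. *)
Require Import Defs.
From HB Require Import structures.
From mathcomp Require Import all_boot all_order all_algebra.
From mathcomp Require Import all_classical all_reals all_analysis.
From mathcomp Require Import measurable_realfun complex.
From mathcomp Require Import ring lra.
Set Implicit Arguments.
Unset Strict Implicit.
Unset Printing Implicit Defensive.
Import Order.TTheory GRing.Theory Num.Theory numFieldNormedType.Exports.
Local Open Scope classical_set_scope.
Local Open Scope ring_scope.

(** * The space L^2 *)

(** The solutions are given through an arbitrary spectral measure [E] of [Delta]. The short route,
    in which [U E U] is a second spectral measure of [U Delta U = Delta] and therefore equals [E],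
    rests on the uniqueness part of the spectral theorem. The estimate on [X] takes its place: it
    needs only the isometry between $h(\Delta)u$ and $h$ in $L^2$ of the scalar measure of [u],
    applied to $h(x) = x - c$. Such an estimate involves a centre and a radius, hence yields
    commutation for intervals only. The passage to Borel sets goes through numbers: $B \mapsto
    \mathrm{Re}\langle E(B)u, w\rangle$ is a signed set function, and replacing [u] by [u + w] turns
    its vanishing into the equality of two finite positive measures. On the geometric side,
    gradients and components of vectors are picked by a choice operator with default value 0, and
    partial derivatives are limits with default value 0. Locality and oddness of the Laplacian are
    therefore checked in the default cases as well. *)

Section ComplexParts.
Context (R : realType).
Implicit Types (x y z : complex R) (a : R).
Local Notation Re := (@complex.Re R).
Local Notation Im := (@complex.Im R).

Lemma complex_ext x y : Re x = Re y -> Im x = Im y -> x = y.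
Proof. by case: x => a b; case: y => c d /= -> ->. Qed.

Lemma ReD x y : Re (x + y) = Re x + Re y. Proof. by case: x; case: y. Qed.
Lemma ImD x y : Im (x + y) = Im x + Im y. Proof. by case: x; case: y. Qed.
Lemma ReN x : Re (- x) = - Re x. Proof. by case: x. Qed.
Lemma ImN x : Im (- x) = - Im x. Proof. by case: x. Qed.
Lemma ReM x y : Re (x * y) = Re x * Re y - Im x * Im y.
Proof. by case: x; case: y. Qed.
Lemma ImM x y : Im (x * y) = Re x * Im y + Im x * Re y.
Proof. by case: x => a b; case: y => c d /=. Qed.
Lemma ReJ x : Re (conjc x) = Re x. Proof. by case: x. Qed.
Lemma ImJ x : Im (conjc x) = - Im x. Proof. by case: x. Qed.
Definition ReImE := (ReD, ImD, ReN, ImN, ReM, ImM, ReJ, ImJ).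

Lemma conjcD x y : conjc (x + y) = conjc x + conjc y.
Proof. by apply: complex_ext; rewrite !ReImE ?opprD. Qed.
Lemma conjcM x y : conjc (x * y) = conjc x * conjc y.
Proof. by apply: complex_ext; rewrite !ReImE; ring. Qed.

Lemma normsq_ge0 x : 0 <= normsq x.
Proof. by rewrite /normsq addr_ge0 ?sqr_ge0. Qed.
Lemma normsqM x y : normsq (x * y) = normsq x * normsq y.
Proof. rewrite /normsq !ReImE; ring. Qed.
Lemma normsqN x : normsq (- x) = normsq x.
Proof. by rewrite /normsq !ReImE !sqrrN. Qed.
Lemma normsqD_le x y : normsq (x + y) <= 2 * (normsq x + normsq y).
Proof.
rewrite /normsq !ReImE -subr_ge0.
rewrite (_ : _ - _ = (Re x - Re y) ^+ 2 + (Im x - Im y) ^+ 2); last ring.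
by rewrite addr_ge0 ?sqr_ge0.
Qed.
Lemma normsq_eq0 x : normsq x = 0 -> x = 0.
Proof.
move=> /eqP; rewrite paddr_eq0 ?sqr_ge0// !sqrf_eq0 => /andP[/eqP h /eqP k].
exact: complex_ext.
Qed.
End ComplexParts.

Section SquareIntegrable.
Context (R : realType) (d : measure_display) (T : measurableType d).
Context (mu : {measure set T -> \bar R}).
Local Notation F := (T -> complex R).
Local Notation Re := (@complex.Re R).
Local Notation Im := (@complex.Im R).
Local Notation L2 := (L2 mu).
Local Notation inner := (inner mu).
Local Notation "f =ae g" := (ae_equal mu f g) (at level 70).
Implicit Types (f g h : F) (c : complex R).

Definition re_meas f := measurable_fun setT (Re \o f).
Definition im_meas f := measurable_fun setT (Im \o f).

Lemma measurable_normsq f : re_meas f -> im_meas f ->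
  measurable_fun setT (fun x => normsq (f x)).
Proof.
move=> mr mi; apply: measurable_funD; exact: measurable_funX.
Qed.

Lemma L2_integrable_normsq f : L2 f ->
  mu.-integrable setT (EFin \o (fun x => normsq (f x))).
Proof.
move=> [mr mi fi]; apply/integrableP; split.
  by apply/measurable_EFinP; exact: measurable_normsq.
under eq_integral => x _ do rewrite /= ger0_norm ?normsq_ge0//.
exact: fi.
Qed.

Lemma L2_dom f (k : T -> R) : mu.-integrable setT (EFin \o k) ->
  re_meas f -> im_meas f -> (forall x, normsq (f x) <= k x) -> L2 f.
Proof.
move=> ik mr mi le; split=> //.
have mk : measurable_fun setT k by apply/measurable_EFinP; case/integrableP: ik.
have/integrableP[_ klt] := ik.
apply: le_lt_trans klt; apply: ge0_le_integral => //.
- by move=> x _; rewrite lee_fin normsq_ge0.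
- by apply/measurable_EFinP; exact: measurable_normsq.
- by apply: measurableT_comp => //; exact/measurable_EFinP.
- by move=> x _ /=; rewrite lee_fin (le_trans (le x))// ler_norm.
Qed.

Lemma L2D f g : L2 f -> L2 g -> L2 (fun x => f x + g x).
Proof.
move=> Lf Lg.
have iF := L2_integrable_normsq Lf; have iG := L2_integrable_normsq Lg.
case: (Lf) => fr fi _; case: (Lg) => gr gi _.
apply: (@L2_dom _ (fun x => 2 * (normsq (f x) + normsq (g x)))).
- rewrite (_ : _ \o _ = (fun x => 2%:E * ((EFin \o (fun x => normsq (f x))) x +
      (EFin \o (fun x => normsq (g x))) x))%E) //.
  by apply: integrableZl => //; exact: integrableD.
- rewrite /re_meas (_ : _ \o _ = (fun x => Re (f x) + Re (g x))).
    exact: measurable_funD.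
  by apply/funext => x /=; rewrite ReImE.
- rewrite /im_meas (_ : _ \o _ = (fun x => Im (f x) + Im (g x))).
    exact: measurable_funD.
  by apply/funext => x /=; rewrite ReImE.
- by move=> x; exact: normsqD_le.
Qed.

Lemma L2Z c f : L2 f -> L2 (fun x => c * f x).
Proof.
move=> Lf; have iF := L2_integrable_normsq Lf; case: (Lf) => fr fi _.
apply: (@L2_dom _ (fun x => normsq c * normsq (f x))).
- rewrite (_ : _ \o _ = (fun x => (normsq c)%:E * ((EFin \o (fun x => normsq (f x))) x))%E) //.
  exact: integrableZl.
- rewrite /re_meas (_ : _ \o _ = (fun x => Re c * Re (f x) - Im c * Im (f x))); last first.
    by apply/funext => x; exact: ReM.
  by apply: measurable_funB; apply: measurable_funM.
- rewrite /im_meas (_ : _ \o _ = (fun x => Re c * Im (f x) + Im c * Re (f x))); last first.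
    by apply/funext => x; exact: ImM.
  by apply: measurable_funD; apply: measurable_funM.
- by move=> x; rewrite normsqM.
Qed.

Lemma L20 : L2 (fun=> 0).
Proof.
split; [exact: measurable_cst..|].
by rewrite /l2normsq integral0_eq // => x _; rewrite /normsq /= expr0n /= addr0.
Qed.

Lemma L2N f : L2 f -> L2 (fun x => - f x).
Proof.
move=> Lf; rewrite (_ : (fun x => - f x) = fun x => (-1) * f x); first exact: L2Z.
by apply/funext => x; rewrite mulN1r.
Qed.

Lemma L2B f g : L2 f -> L2 g -> L2 (fun x => f x - g x).
Proof. by move=> Lf Lg; apply: L2D => //; exact: L2N. Qed.

Lemma L2_sum (I : eqType) (s : seq I) (a : I -> F) :
  (forall i, i \in s -> L2 (a i)) -> L2 (fun x => \sum_(i <- s) a i x).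
Proof.
elim: s => [|i s ih] H.
  by rewrite (_ : (fun x => _) = fun=> 0); [exact: L20|apply/funext => x; rewrite big_nil].
rewrite (_ : (fun x => _) = fun x => a i x + \sum_(j <- s) a j x).
  apply: L2D; first by apply: H; rewrite mem_head.
  by apply: ih => j js; apply: H; rewrite inE js orbT.
by apply/funext => x; rewrite big_cons.
Qed.

Lemma re_inner_integrable f g : L2 f -> L2 g ->
  mu.-integrable setT (EFin \o (fun x => Re (f x * conjc (g x)))).
Proof.
move=> Lf Lg.
have iF := L2_integrable_normsq Lf; have iG := L2_integrable_normsq Lg.
case: (Lf) => fr fi _; case: (Lg) => gr gi _.
apply: (le_integrable measurableT _ _ (integrableD measurableT iF iG)).
  apply/measurable_EFinP.
  rewrite (_ : (fun x => _) = (fun x => Re (f x) * Re (g x) + Im (f x) * Im (g x))).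
    by apply: measurable_funD; apply: measurable_funM.
  by apply/funext => x; rewrite !ReImE mulrN opprK.
move=> x _.
have le : `|Re (f x * conjc (g x))| <= normsq (f x) + normsq (g x).
  have sq (a b : R) : - (a ^+ 2 + b ^+ 2) <= 2 * (a * b) <= a ^+ 2 + b ^+ 2.
    have := sqr_ge0 (a + b); have := sqr_ge0 (a - b); rewrite sqrrB sqrrD => h k.
    by apply/andP; split; lra.
  have /andP[h1 h2] := sq (Re (f x)) (Re (g x)).
  have /andP[h3 h4] := sq (Im (f x)) (Im (g x)).
  have := normsq_ge0 (f x); have := normsq_ge0 (g x).
  by rewrite !ReImE /normsq ler_norml => *; apply/andP; split; lra.
by move: le; rewrite -lee_fin => /le_trans; apply; rewrite lee_fin ler_norm.
Qed.

(** Since $\mathrm{Im}\, z = \mathrm{Re}(-iz)$, this is the previous lemma for $-i f$ and $g$. *)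
Lemma im_inner_integrable f g : L2 f -> L2 g ->
  mu.-integrable setT (EFin \o (fun x => Im (f x * conjc (g x)))).
Proof.
move=> Lf Lg; have := re_inner_integrable (L2Z (Complex 0 (-1)) Lf) Lg.
congr (mu.-integrable _ _); apply/funext => x /=; congr EFin.
by rewrite !ReImE /=; ring.
Qed.

Lemma innerDl f g h : L2 f -> L2 g -> L2 h ->
  inner (fun x => f x + g x) h = inner f h + inner g h.
Proof.
move=> Lf Lg Lh; apply: complex_ext; rewrite ReImE /=.
  rewrite -RintegralD //; [|exact: re_inner_integrable..].
  by congr Rintegral; apply/funext => x /=; rewrite mulrDl ReD.
rewrite -RintegralD //; [|exact: im_inner_integrable..].
by congr Rintegral; apply/funext => x /=; rewrite mulrDl ImD.
Qed.

Lemma innerZl c f h : L2 f -> L2 h -> inner (fun x => c * f x) h = c * inner f h.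
Proof.
move=> Lf Lh; have ir := re_inner_integrable Lf Lh; have ii := im_inner_integrable Lf Lh.
have iZ a (k : T -> R) : mu.-integrable setT (EFin \o k) ->
    mu.-integrable setT (EFin \o (fun x => a * k x)).
  by move=> ik; exact: (integrableZl measurableT a ik).
apply: complex_ext; rewrite ReImE /=.
  rewrite -!RintegralZl // -RintegralB //; [|exact: iZ..].
  by congr Rintegral; apply/funext => x; rewrite /comp -mulrA ReM.
rewrite -!RintegralZl // -RintegralD //; [|exact: iZ..].
by congr Rintegral; apply/funext => x /=; rewrite -mulrA ImM.
Qed.

Lemma innerC f g : L2 f -> L2 g -> inner g f = conjc (inner f g).
Proof.
move=> Lf Lg; apply: complex_ext; rewrite !ReImE /=.
  by congr Rintegral; apply/funext => x /=; rewrite !ReImE; ring.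
rewrite -[RHS]mulN1r -RintegralZl //; last exact: im_inner_integrable.
by congr Rintegral; apply/funext => x /=; rewrite !ReImE; ring.
Qed.

Lemma innerDr f g h : L2 f -> L2 g -> L2 h ->
  inner h (fun x => f x + g x) = inner h f + inner h g.
Proof.
move=> Lf Lg Lh; rewrite (innerC (L2D Lf Lg)) // innerDl //.
by rewrite conjcD -!innerC.
Qed.

Lemma innerZr c f h : L2 f -> L2 h ->
  inner h (fun x => c * f x) = conjc c * inner h f.
Proof.
move=> Lf Lh; rewrite (innerC (L2Z c Lf)) // innerZl // conjcM.
by rewrite -innerC.
Qed.

Lemma ae_sym f g : f =ae g -> g =ae f.
Proof. by apply: filterS => x ->. Qed.

Lemma ae_trans f g h : f =ae g -> g =ae h -> f =ae h.
Proof. by apply: filterS2 => x -> ->. Qed.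

Lemma ae_refl f : f =ae f.
Proof. by apply: aeW. Qed.

Lemma aeB f f' g g' : f =ae f' -> g =ae g' ->
  (fun x => f x - g x) =ae (fun x => f' x - g' x).
Proof. by apply: filterS2 => x -> ->. Qed.

Lemma aeD f f' g g' : f =ae f' -> g =ae g' ->
  (fun x => f x + g x) =ae (fun x => f' x + g' x).
Proof. by apply: filterS2 => x -> ->. Qed.

Lemma ae_inner f f' g g' : L2 f -> L2 f' -> L2 g -> L2 g' ->
  f =ae f' -> g =ae g' -> inner f g = inner f' g'.
Proof.
move=> Lf Lf' Lg Lg' ff gg; apply: complex_ext; rewrite /= /Rintegral; congr fine.
  apply: ae_eq_integral => //.
  - by have/integrableP[] := re_inner_integrable Lf Lg.
  - by have/integrableP[] := re_inner_integrable Lf' Lg'.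
  by apply: filterS2 ff gg => x /= -> ->.
apply: ae_eq_integral => //.
- by have/integrableP[] := im_inner_integrable Lf Lg.
- by have/integrableP[] := im_inner_integrable Lf' Lg'.
by apply: filterS2 ff gg => x /= -> ->.
Qed.

Definition l2nsq f : R := fine (l2normsq mu f).
Local Notation nsq := l2nsq.

Lemma l2normsq_fin f : L2 f -> l2normsq mu f = (nsq f)%:E.
Proof.
move=> [_ _ lt]; rewrite /l2nsq fineK // ge0_fin_numE //.
by apply: integral_ge0 => x _; rewrite lee_fin normsq_ge0.
Qed.

Lemma nsq_ge0 f : 0 <= nsq f.
Proof. by rewrite fine_ge0 // integral_ge0 // => x _; rewrite lee_fin normsq_ge0. Qed.

Lemma inner_self f : inner f f = Complex (nsq f) 0.
Proof.
apply: complex_ext => /=.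
  rewrite /Rintegral /l2nsq; congr fine; apply: eq_integral => x _ /=.
  by rewrite !ReImE /normsq; congr EFin; ring.
rewrite (_ : _ \o _ = fun=> 0); last by apply/funext => x /=; rewrite !ReImE; ring.
by rewrite Rintegral_cst // mul0r.
Qed.

Lemma ae_nsq f g : L2 f -> L2 g -> f =ae g -> nsq f = nsq g.
Proof.
move=> Lf Lg fg; have := ae_inner Lf Lg Lf Lg fg fg.
by rewrite !inner_self => -[].
Qed.

Lemma nsq_eq0 f : L2 f -> nsq f = 0 -> f =ae (fun=> 0).
Proof.
move=> Lf f0.
have mf : measurable_fun setT (EFin \o (fun x => normsq (f x))).
  by have/integrableP[] := L2_integrable_normsq Lf.
have : (\int[mu]_(x in setT) `|(EFin \o (fun x => normsq (f x))) x| = 0)%E.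
  transitivity (l2normsq mu f); last by rewrite l2normsq_fin // f0.
  by apply: eq_integral => x _ /=; rewrite ger0_norm ?normsq_ge0.
move/(ae_eq_integral_abs mu measurableT mf).1.
by apply: filterS => x /= /(_ I) -[]/normsq_eq0.
Qed.

Definition l2ip f g : R := Re (inner f g).
Local Notation ip := l2ip.

Lemma ipC f g : L2 f -> L2 g -> ip f g = ip g f.
Proof. by move=> Lf Lg; rewrite /l2ip innerC // ReJ. Qed.

Lemma ipDl f g h : L2 f -> L2 g -> L2 h -> ip (fun x => f x + g x) h = ip f h + ip g h.
Proof. by move=> *; rewrite /l2ip innerDl // ReD. Qed.

Lemma ipDr f g h : L2 f -> L2 g -> L2 h -> ip h (fun x => f x + g x) = ip h f + ip h g.
Proof. by move=> *; rewrite /l2ip innerDr // ReD. Qed.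

Lemma ipZr a f h : L2 f -> L2 h -> ip h (fun x => (Complex a 0) * f x) = a * ip h f.
Proof. by move=> *; rewrite /l2ip innerZr // ReM /= oppr0 mul0r subr0. Qed.

Lemma ip_self f : ip f f = nsq f.
Proof. by rewrite /l2ip inner_self. Qed.

Lemma nsqD f g : L2 f -> L2 g ->
  nsq (fun x => f x + g x) = nsq f + nsq g + 2 * ip f g.
Proof.
move=> Lf Lg; have Ls := L2D Lf Lg.
rewrite -!ip_self ipDl // !ipDr // (ipC Lg Lf); ring.
Qed.

Lemma nsqZ c f : L2 f -> nsq (fun x => c * f x) = normsq c * nsq f.
Proof.
move=> Lf; rewrite -!ip_self /l2ip innerZl //; last exact: L2Z.
rewrite innerZr // inner_self !ReImE /= /normsq; ring.
Qed.

Lemma nsqN f : nsq (fun x => - f x) = nsq f.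
Proof. by congr fine; apply: eq_integral => x _; rewrite normsqN. Qed.

(** Testing against $h = f - g$ gives $|f - g|^2 = 0$. Identities between operators are proved below
    by this test, which lets symmetry move an operator to the other side. *)
Lemma inner_ae_ext f g : L2 f -> L2 g ->
  (forall h, L2 h -> inner f h = inner g h) -> f =ae g.
Proof.
move=> Lf Lg H; have Ld := L2B Lf Lg.
have /(nsq_eq0 Ld) : nsq (fun x => f x - g x) = 0.
  rewrite -ip_self /l2ip innerDl //; last exact: L2N.
  rewrite (_ : (fun x => - g x) = fun x => (-1) * g x); last first.
    by apply/funext => x; rewrite mulN1r.
  by rewrite innerZl // H // mulN1r subrr.
by apply: filterS => x /eqP; rewrite subr_eq0 => /eqP.
Qed.

Definition l2nrm f : R := Num.sqrt (nsq f).
Local Notation nrm := l2nrm.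

Lemma nrm_ge0 f : 0 <= nrm f. Proof. exact: sqrtr_ge0. Qed.

Lemma nrmsq f : nrm f ^+ 2 = nsq f.
Proof. by rewrite sqr_sqrtr // nsq_ge0. Qed.

(** Cauchy-Schwarz from $|f - tg|^2 \ge 0$. With $a = |f|$ and $b = |g|$ both positive, $t = a/b$
    gives $2(a/b)(ab - \langle f,g\rangle) \ge 0$. If one norm vanishes and $\langle f,g\rangle >
    0$, another $t$ makes the quadratic negative: its value is $-1$ for the one chosen when $b = 0$,
    and $t = \langle f,g\rangle/b^2$ is its minimiser when $a = 0$. *)
Lemma ip_le f g : L2 f -> L2 g -> ip f g <= nrm f * nrm g.
Proof.
move=> Lf Lg.
have key (t : R) : 0 <= nsq f + t ^+ 2 * nsq g - 2 * t * ip f g.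
  have := nsq_ge0 (fun x => f x + Complex (- t) 0 * g x).
  rewrite nsqD //; last exact: L2Z.
  rewrite nsqZ // ipZr // /normsq /= => h; lra.
have := nrm_ge0 f; have := nrm_ge0 g; have := nrmsq f; have := nrmsq g.
set a := nrm f; set b := nrm g => hb ha.
rewrite le_eqVlt => /predU1P[b0|b0] a0.
  have b2 : nsq g = 0 by rewrite -hb -b0 expr0n.
  rewrite -b0 mulr0 leNgt; apply/negP => i0.
  have := key ((nsq f + 1) / (2 * ip f g)).
  rewrite b2 mulr0 addr0 (_ : 2 * _ * _ = nsq f + 1); last by field; rewrite gt_eqF.
  lra.
have := key (a / b); rewrite -ha -hb.
rewrite (_ : _ - _ = 2 * (a / b) * (a * b - ip f g)); last by field; rewrite gt_eqF.
move: a0; rewrite le_eqVlt => /predU1P[a0|a0].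
  move=> _; rewrite -a0 mul0r.
  have : nsq f = 0 by rewrite -ha -a0 expr0n.
  move=> f0; rewrite leNgt; apply/negP => i0.
  have := key (ip f g / nsq g); rewrite f0 -hb.
  rewrite (_ : _ - _ = - (ip f g ^+ 2 / b ^+ 2)); last by field; rewrite gt_eqF.
  by rewrite oppr_ge0 leNgt divr_gt0 ?exprn_gt0.
by rewrite pmulr_rge0 ?subr_ge0// mulr_gt0 ?divr_gt0.
Qed.

Lemma nrmD f g : L2 f -> L2 g -> nrm (fun x => f x + g x) <= nrm f + nrm g.
Proof.
move=> Lf Lg; rewrite -(@ler_pXn2r _ 2%N) ?nnegrE ?addr_ge0 ?nrm_ge0//.
rewrite nrmsq nsqD // sqrrD !nrmsq; have := ip_le Lf Lg; lra.
Qed.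

Lemma nrmB_sym f g :
  nrm (fun x => f x - g x) = nrm (fun x => g x - f x).
Proof.
rewrite /l2nrm -nsqN.
by congr (Num.sqrt (nsq _)); apply/funext => x; rewrite opprB.
Qed.

Lemma nrm_le_dist f g : L2 f -> L2 g -> nrm f <= nrm g + nrm (fun x => f x - g x).
Proof.
move=> Lf Lg; have := nrmD Lg (L2B Lf Lg).
by rewrite (_ : (fun x => g x + _) = f) //; apply/funext => x; rewrite addrC subrK.
Qed.

Lemma ae_nrm f g : L2 f -> L2 g -> f =ae g -> nrm f = nrm g.
Proof. by move=> Lf Lg fg; rewrite /l2nrm (ae_nsq Lf Lg fg). Qed.

Lemma l2normsq_lt f e : L2 f -> 0 < e -> (l2normsq mu f < (e ^+ 2)%:E)%E <-> nrm f < e.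
Proof.
move=> Lf e0; rewrite l2normsq_fin // lte_fin -nrmsq.
by rewrite ltr_pXn2r ?nnegrE ?nrm_ge0 // ltW.
Qed.

End SquareIntegrable.

(** * Projection-valued measures *)

Section InnerSums.
Context (R : realType) (d : measure_display) (T : measurableType d).
Context (mu : {measure set T -> \bar R}).
Local Notation F := (T -> complex R).
Local Notation L2 := (L2 mu).
Local Notation inner := (inner mu).
Implicit Types (f g h u v w : F) (c : complex R).

Lemma inner_suml (I : eqType) (s : seq (complex R * I)) (a : I -> F) g :
  (forall p, p \in s -> L2 (a p.2)) -> L2 g ->
  inner (fun x => \sum_(p <- s) p.1 * a p.2 x) g =
  \sum_(p <- s) p.1 * inner (a p.2) g.
Proof.
move=> H Lg; elim: s H => [|p s ih] H.
  rewrite big_nil (_ : (fun x => _) = fun x => 0 * g x); last first.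
    by apply/funext => x; rewrite big_nil mul0r.
  by rewrite innerZl // mul0r.
have Hs q : q \in s -> L2 (a q.2) by move=> qs; apply: H; rewrite inE qs orbT.
have Hp : L2 (a p.2) by apply: H; rewrite mem_head.
rewrite big_cons -ih // -innerZl // -innerDl //; last 2 first.
- exact: L2Z.
- by apply: L2_sum => q qs; apply: L2Z; exact: Hs.
by congr inner; apply/funext => x; rewrite big_cons.
Qed.

Lemma inner_sumr (I : eqType) (s : seq (complex R * I)) (a : I -> F) g :
  (forall p, p \in s -> L2 (a p.2)) -> L2 g ->
  inner g (fun x => \sum_(p <- s) p.1 * a p.2 x) =
  \sum_(p <- s) conjc p.1 * inner g (a p.2).
Proof.
move=> H Lg.
have Ls : L2 (fun x => \sum_(p <- s) p.1 * a p.2 x).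
  by apply: L2_sum => q qs; apply: L2Z; exact: H.
rewrite (innerC Ls) // inner_suml //.
rewrite (big_morph (fun z : complex R => conjc z) (id1 := 0) (op1 := +%R)).
- rewrite big_seq [RHS]big_seq; apply: eq_bigr => q qs.
  by rewrite conjcM -innerC //; exact: H.
- exact: conjcD.
- by apply: complex_ext; rewrite ?ReJ ?ImJ //= oppr0.
Qed.

End InnerSums.

Section SpectralMeasure.
Context (R : realType) (d : measure_display) (T : measurableType d).
Context (mu : {measure set T -> \bar R}).
Local Notation F := (T -> complex R).
Local Notation Re := (@complex.Re R).
Local Notation L2 := (L2 mu).
Local Notation inner := (inner mu).
Local Notation nsq := (l2nsq mu).
Local Notation nrm := (l2nrm mu).
Local Notation ip := (l2ip mu).
Local Notation "f =ae g" := (ae_equal mu f g) (at level 70).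
Implicit Types (f g h u v w : F) (c : complex R).

Variable E : pvm mu.
Local Notation proj := (pvm_proj E).
Local Notation m := (pvm_meas E).
Local Notation RR := (measurableTypeR R).
Implicit Types (B C : set RR).

Lemma pvm_measE_nsq B u : measurable B -> L2 u -> m u B = (nsq (proj B u))%:E.
Proof.
by move=> mB Lu; rewrite pvm_measE // l2normsq_fin //; exact: pvm_L2.
Qed.

Lemma pvm_meas_lty B u : measurable B -> L2 u -> (m u B < +oo)%E.
Proof. by move=> mB Lu; rewrite pvm_measE_nsq // ltry. Qed.

Lemma proj_ip_self B u : measurable B -> L2 u -> ip u (proj B u) = nsq (proj B u).
Proof.
move=> mB Lu; have Lp := pvm_L2 E mB Lu; have Lpp := pvm_L2 E mB Lp.
have /(_ u u) := pvm_sym E mB; rewrite -ip_self => /(_ Lu Lu) h.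
rewrite /l2ip -h.
have := pvm_sym E mB Lu Lp; move=> /(congr1 Re) => ->; rewrite h.
congr Re; apply: ae_inner => //; first exact: ae_refl.
by have := pvm_mul E mB mB Lu; rewrite setIid.
Qed.

Lemma proj_inner B C u : measurable B -> measurable C -> L2 u ->
  inner (proj B u) (proj C u) = Complex (nsq (proj (B `&` C) u)) 0.
Proof.
move=> mB mC Lu; have mBC := measurableI _ _ mB mC.
have LB := pvm_L2 E mB Lu; have LC := pvm_L2 E mC Lu; have LBC := pvm_L2 E mBC Lu.
have step D D' : measurable D -> measurable D' -> 
    inner (proj D u) (proj D' u) = inner u (proj (D `&` D') u).
  move=> mD mD'; have mDD := measurableI _ _ mD mD'.
  rewrite (pvm_sym E) //; last exact: pvm_L2.
  apply: ae_inner => //; [by do ?apply: pvm_L2..|exact: ae_refl|].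
  by apply: ae_sym; exact: pvm_mul.
by rewrite step // -inner_self step // setIid.
Qed.

(** Compatibility with a.e. equality, and the linearity proved next, are consequences of the
    symmetry of the projections. *)
Lemma proj_ae B f g : measurable B -> L2 f -> L2 g -> f =ae g -> proj B f =ae proj B g.
Proof.
move=> mB Lf Lg fg; apply: inner_ae_ext; [exact: pvm_L2..|].
move=> h Lh; rewrite !(pvm_sym E) //; apply: ae_inner => //; [exact: pvm_L2..|exact: ae_refl].
Qed.

Lemma projD B f g : measurable B -> L2 f -> L2 g ->
  proj B (fun x => f x + g x) =ae (fun x => proj B f x + proj B g x).
Proof.
move=> mB Lf Lg; have Lp := pvm_L2 E mB Lf; have Lq := pvm_L2 E mB Lg.
have Ls := L2D Lf Lg.
apply: inner_ae_ext; [exact: pvm_L2|exact: L2D|] => h Lh; have Lph := pvm_L2 E mB Lh.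
by rewrite (pvm_sym E) // !innerDl // !(pvm_sym E).
Qed.

Lemma projZ B c f : measurable B -> L2 f ->
  proj B (fun x => c * f x) =ae (fun x => c * proj B f x).
Proof.
move=> mB Lf; have Lp := pvm_L2 E mB Lf; have Ls := L2Z c Lf.
apply: inner_ae_ext; [exact: pvm_L2|exact: L2Z|] => h Lh; have Lph := pvm_L2 E mB Lh.
by rewrite (pvm_sym E) // !innerZl // !(pvm_sym E).
Qed.

Lemma projB B f g : measurable B -> L2 f -> L2 g ->
  proj B (fun x => f x - g x) =ae (fun x => proj B f x - proj B g x).
Proof.
move=> mB Lf Lg.
have -> : (fun x => f x - g x) = (fun x => f x + (-1) * g x).
  by apply/funext => x; rewrite mulN1r.
have -> : (fun x => proj B f x - proj B g x) = (fun x => proj B f x + (-1) * proj B g x).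
  by apply/funext => x; rewrite mulN1r.
apply: ae_trans; first by apply: projD => //; exact: L2Z.
by apply: aeD; [exact: ae_refl|exact: projZ].
Qed.

Lemma nsq_proj_le B u : measurable B -> L2 u -> nsq (proj B u) <= nsq u.
Proof.
move=> mB Lu; rewrite -lee_fin -pvm_measE_nsq //.
have -> : nsq u = nsq (proj setT u).
  by apply: ae_nsq => //; [exact: pvm_L2|apply: ae_sym; exact: pvm_full].
by rewrite -pvm_measE_nsq //; apply: le_measure => //; rewrite inE.
Qed.

Lemma nrm_proj_le B u : measurable B -> L2 u -> nrm (proj B u) <= nrm u.
Proof. by move=> mB Lu; rewrite ler_sqrt ?nsq_ge0 //; exact: nsq_proj_le. Qed.

(** Additivity of the scalar measure gives $|u|^2 = |E(B)u|^2 + |E(B^c)u|^2$, and expanding the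
    left-hand side with $\langle u, E(B)u\rangle = |E(B)u|^2$ gives $|u|^2 - |E(B)u|^2$. *)
Lemma nsq_proj_compl B u : measurable B -> L2 u ->
  nsq (fun x => u x - proj B u x) = nsq (proj (~` B) u).
Proof.
move=> mB Lu; have Lp := pvm_L2 E mB Lu; have mC := measurableC mB.
have e1 : nsq u = nsq (proj B u) + nsq (proj (~` B) u).
  have -> : nsq u = nsq (proj setT u).
    by apply: ae_nsq => //; [exact: pvm_L2|apply: ae_sym; exact: pvm_full].
  apply/EFin_inj; rewrite EFinD -!pvm_measE_nsq // -measureU // ?setICr //.
  by rewrite setUCr.
have -> : (fun x => u x - proj B u x) = (fun x => u x + (Complex (-1) 0) * proj B u x).
  apply/funext => x; rewrite (_ : Complex (-1) 0 = -1) ?mulN1r //.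
  by apply: complex_ext; rewrite /= ?oppr0.
rewrite nsqD //; last exact: L2Z.
rewrite nsqZ // ipZr // proj_ip_self // e1 /normsq /=; ring.
Qed.

(** The criterion by which a vector is later shown to lie in the range of $E(B)$: its scalar measure
    has no mass off $B$. *)
Lemma proj_compl0 B u : measurable B -> L2 u -> m u (~` B) = 0%E -> u =ae proj B u.
Proof.
move=> mB Lu; rewrite pvm_measE_nsq //; last exact: measurableC.
move=> [h]; have := nsq_proj_compl mB Lu; rewrite h.
move=> /(nsq_eq0 (L2B Lu (pvm_L2 E mB Lu))).
by apply: filterS => x /eqP; rewrite subr_eq0 => /eqP.
Qed.

Lemma meas_proj B C u : measurable B -> measurable C -> L2 u ->
  m (proj C u) B = m u (B `&` C).
Proof.
move=> mB mC Lu; have Lp := pvm_L2 E mC Lu.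
have mI := measurableI _ _ mB mC.
rewrite !pvm_measE_nsq //; congr EFin; apply: ae_nsq; [exact: pvm_L2..|].
by apply: ae_sym; exact: pvm_mul.
Qed.

Definition cindic B : RR -> complex R := fun x => if `[< B x >] then 1 else 0.

Lemma cindicE B x : cindic B x = Complex (\1_B x) 0.
Proof.
rewrite /cindic; case: asboolP => h; first by rewrite indicE mem_set.
by rewrite indicE memNset.
Qed.

Lemma L2_cindic B u : measurable B -> L2 u -> Defs.L2 (m u) (cindic B).
Proof.
move=> mB Lu; split.
- rewrite (_ : _ \o _ = \1_B); last by apply/funext => x /=; rewrite cindicE.
  by apply: measurable_indic; exact: mB.
- rewrite (_ : _ \o _ = cst 0); last by apply/funext => x /=; rewrite cindicE.
  exact: measurable_cst.
- rewrite /l2normsq; under eq_integral => x _.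
    rewrite (_ : normsq _ = \1_B x :> R); last first.
      by rewrite cindicE /normsq /= expr0n addr0 indicE; case: (_ \in _); rewrite ?expr1n ?expr0n.
    over.
  by rewrite integral_indic // setIT; exact: pvm_meas_lty.
Qed.

(** The same Gram matrix as in [proj_inner]: the indicators in $L^2$ of the scalar measure are a
    model of the vectors $E(B)u$. *)
Lemma inner_cindic B C u : measurable B -> measurable C -> L2 u ->
  Defs.inner (m u) (cindic B) (cindic C) = Complex (nsq (proj (B `&` C) u)) 0.
Proof.
move=> mB mC Lu; have mI := measurableI _ _ mB mC.
have e x : cindic B x * conjc (cindic C x) = Complex (\1_(B `&` C) x) 0.
  by rewrite !cindicE indicI; apply: complex_ext; rewrite !ReImE /=; ring.
apply: complex_ext => /=.
  rewrite (_ : _ \o _ = \1_(B `&` C)); last first.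
    by apply/funext => x; rewrite /= e.
  rewrite /Rintegral integral_indic // setIT pvm_measE_nsq //.
rewrite (_ : _ \o _ = cst 0); last by apply/funext => x; rewrite /= e.
by rewrite Rintegral_cst // mul0r.
Qed.

Local Notation slist := (seq (complex R * set (measurableTypeR R))).
Implicit Types s : slist.

Lemma simple_funE s x : simple_fun s x = \sum_(p <- s) p.1 * cindic p.2 x.
Proof.
apply: eq_bigr => p _; rewrite /cindic.
by case: ifP; rewrite ?mulr1 ?mulr0.
Qed.

Definition simple_meas s := forall p, p \in s -> measurable p.2.

Lemma L2_simple_fun s u : simple_meas s -> L2 u -> Defs.L2 (m u) (simple_fun s).
Proof.
move=> ms Lu; rewrite (_ : simple_fun s = fun x => \sum_(p <- s) p.1 * cindic p.2 x).
  by apply: L2_sum => p ps; apply: L2Z; apply: L2_cindic => //; exact: ms.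
by apply/funext => x; rewrite simple_funE.
Qed.

Lemma L2_simple_calculus s u : simple_meas s -> L2 u -> L2 (simple_calculus E s u).
Proof. by move=> ms Lu; apply: L2_sum => p ps; apply: L2Z; apply: pvm_L2 => //; exact: ms. Qed.

(** Both squared norms expand into double sums with the same coefficients, and the two Gram matrices
    agree term by term. *)
Lemma simple_isometry s u : simple_meas s -> L2 u ->
  nrm (simple_calculus E s u) = l2nrm (m u) (simple_fun s).
Proof.
move=> ms Lu; congr Num.sqrt.
suff: Complex (nsq (simple_calculus E s u)) 0 = Complex (l2nsq (m u) (simple_fun s)) 0 by case.
rewrite -!inner_self.
rewrite (_ : simple_fun s = fun x => \sum_(p <- s) p.1 * cindic p.2 x); last first.
  by apply/funext => x; rewrite simple_funE.
rewrite [LHS](inner_suml (a := fun B => proj B u)) //; last 2 first.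
- by move=> p ps; apply: pvm_L2 => //; exact: ms.
- exact: L2_simple_calculus.
have L2s : Defs.L2 (m u) (fun x => \sum_(p <- s) p.1 * cindic p.2 x).
  by apply: L2_sum => p ps; apply: L2Z; apply: L2_cindic => //; exact: ms.
rewrite [RHS](inner_suml (mu := m u) (a := cindic)) //; last first.
  by move=> p ps; apply: L2_cindic => //; exact: ms.
rewrite big_seq [RHS]big_seq; apply: eq_bigr => p ps; congr (_ * _).
have mp := ms _ ps.
rewrite (inner_sumr (a := fun B => proj B u)) //; last 2 first.
- by move=> q qs; apply: pvm_L2 => //; exact: ms.
- exact: pvm_L2.
rewrite (inner_sumr (mu := m u) (a := cindic)) //; last 2 first.
- by move=> q qs; apply: L2_cindic => //; exact: ms.
- exact: L2_cindic.
rewrite big_seq [RHS]big_seq; apply: eq_bigr => q qs; congr (_ * _).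
have mq := ms _ qs.
by rewrite proj_inner // inner_cindic.
Qed.

End SpectralMeasure.

(** * The functional calculus as a limit of simple functions *)

Section CalculusIsometry.
Context (R : realType) (d : measure_display) (T : measurableType d).
Context (mu : {measure set T -> \bar R}).
Local Notation F := (T -> complex R).
Local Notation Re := (@complex.Re R).
Local Notation Im := (@complex.Im R).
Local Notation L2 := (L2 mu).
Local Notation inner := (inner mu).
Local Notation nrm := (l2nrm mu).
Local Notation "f =ae g" := (ae_equal mu f g) (at level 70).
Implicit Types (f g u v w : F) (c : complex R).
Variable E : pvm mu.
Local Notation proj := (pvm_proj E).
Local Notation m := (pvm_meas E).
Local Notation RR := (measurableTypeR R).
Implicit Types (B C : set RR) (h : RR -> complex R).

(** The isometry passes to the limit along the approximating simple functions, each inequality up to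
    [e], with [e / 2] spent on either side. A single approximant already makes [h] square
    integrable, as $h = (h - s) + s$. *)
Lemma pvm_calculus_isometry h u v : re_meas h -> im_meas h ->
  pvm_calculus E h u v -> Defs.L2 (m u) h /\ nrm v = l2nrm (m u) h.
Proof.
move=> mr mi [Lu Lv H].
have key e : 0 < e -> exists s, [/\ simple_meas s,
    Defs.L2 (m u) (fun x => h x - simple_fun s x),
    l2nrm (m u) (fun x => h x - simple_fun s x) < e &
    nrm (fun x => v x - simple_calculus E s u x) < e].
  move=> e0; have [s [ms h1 h2]] := H _ (exprn_gt0 2 e0); exists s.
  have Ls := L2_simple_fun E ms Lu; have LS := L2_simple_calculus E ms Lu.
  have Ld : Defs.L2 (m u) (fun x => h x - simple_fun s x).
    case: Ls => sr si _; split.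
    - rewrite (_ : _ \o _ = (fun x => Re (h x) - Re (simple_fun s x))).
        exact: measurable_funB.
      by apply/funext => x; rewrite /comp !ReImE.
    - rewrite (_ : _ \o _ = (fun x => Im (h x) - Im (simple_fun s x))).
        exact: measurable_funB.
      by apply/funext => x; rewrite /comp !ReImE.
    - exact: lt_trans h1 (ltry _).
  split => //; first exact/(l2normsq_lt Ld e0).
  exact/(l2normsq_lt (L2B Lv LS) e0).
have Lh : Defs.L2 (m u) h.
  have [s [ms Ld _ _]] := key _ ltr01.
  rewrite (_ : h = fun x => (h x - simple_fun s x) + simple_fun s x).
    by apply: L2D => //; exact: L2_simple_fun.
  by apply/funext => x; rewrite subrK.
split=> //; apply/eqP; rewrite eq_le; apply/andP; split; apply/ler_addgt0Pr => e e0.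
  have e2 : 0 < e / 2 by rewrite divr_gt0.
  have [s [ms Ld h1 h2]] := key _ e2.
  have Ls := L2_simple_fun E ms Lu; have LS := L2_simple_calculus E ms Lu.
  have := nrm_le_dist Lv LS; have := nrm_le_dist Ls Lh.
  rewrite simple_isometry // nrmB_sym => h3 h4; lra.
have e2 : 0 < e / 2 by rewrite divr_gt0.
have [s [ms Ld h1 h2]] := key _ e2.
have Ls := L2_simple_fun E ms Lu; have LS := L2_simple_calculus E ms Lu.
have := nrm_le_dist LS Lv; have := nrm_le_dist Lh Ls.
rewrite simple_isometry // [X in _ -> _ <= _ + X -> _]nrmB_sym => h3 h4; lra.
Qed.

Lemma ae_l2normsq f g : L2 f -> L2 g -> f =ae g -> l2normsq mu f = l2normsq mu g.
Proof. by move=> Lf Lg fg; rewrite !l2normsq_fin // (ae_nsq Lf Lg fg). Qed.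

(** The projections commute, because $E(C)E(B)$ and $E(B)E(C)$ are both $E(B \cap C)$. *)
Lemma simple_calculus_proj s B u : simple_meas s -> measurable B -> L2 u ->
  simple_calculus E s (proj B u) =ae proj B (simple_calculus E s u).
Proof.
move=> ms mB Lu; have Lp C v : measurable C -> L2 v -> L2 (proj C v) by move=> mC; exact: pvm_L2.
have LS := L2_simple_calculus E ms Lu.
apply: inner_ae_ext; [by apply: L2_simple_calculus => //; exact: Lp|exact: Lp|] => g Lg.
rewrite (pvm_sym E) // (inner_suml (a := fun C => proj C (proj B u))) //; last first.
  by move=> p ps; apply: (Lp _ _ _ (Lp _ _ mB Lu)); exact: ms.
rewrite (inner_suml (a := fun C => proj C u)) //; last 2 first.
- by move=> p ps; apply: (Lp _ _ _ Lu); exact: ms.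
- exact: Lp.
rewrite big_seq [RHS]big_seq; apply: eq_bigr => p /ms mp; congr (_ * _).
have Lpu := Lp _ _ mp Lu; have LBu := Lp _ _ mB Lu.
rewrite -(pvm_sym E) //; have mI := measurableI _ _ mp mB.
apply: ae_inner => //; [exact: Lp..| |exact: ae_refl].
apply: ae_trans; first by apply: ae_sym; exact: pvm_mul.
by rewrite setIC; exact: pvm_mul.
Qed.

(** The approximants of [(u, v)] serve again: the scalar measure of $E(B)u$ is $C \mapsto m_u(C \cap
    B)$, which is at most $m_u$, and the error vector becomes $E(B)(v - s(E)u)$, of smaller norm. *)
Lemma pvm_calculus_proj h B u v : re_meas h -> im_meas h -> measurable B ->
  pvm_calculus E h u v -> pvm_calculus E h (proj B u) (proj B v).
Proof.
move=> mr mi mB [Lu Lv H]; have LBu := pvm_L2 E mB Lu; have LBv := pvm_L2 E mB Lv.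
split=> // e e0; have [s [ms h1 h2]] := H _ e0; exists s; split=> //.
  apply: le_lt_trans h1; apply: ge0_le_measure_integral => //.
  - move=> C mC; rewrite meas_proj //; apply: le_measure; rewrite ?inE //.
    exact: measurableI.
  - by move=> x; rewrite lee_fin normsq_ge0.
  - have [sr si _] := L2_simple_fun E ms Lu.
    apply/measurable_EFinP; apply: measurable_normsq.
    + rewrite /re_meas (_ : _ \o _ = (fun x => Re (h x) - Re (simple_fun s x))).
        exact: measurable_funB.
      by apply/funext => x; rewrite /comp !ReImE.
    + rewrite /im_meas (_ : _ \o _ = (fun x => Im (h x) - Im (simple_fun s x))).
        exact: measurable_funB.
      by apply/funext => x; rewrite /comp !ReImE.
have LS := L2_simple_calculus E ms Lu; have LSB := L2_simple_calculus E ms LBu.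
have Ld := L2B Lv LS.
apply: le_lt_trans h2.
rewrite (ae_l2normsq (g := proj B (fun x => v x - simple_calculus E s u x))) //.
- rewrite l2normsq_fin; last exact: pvm_L2.
  by rewrite [leRHS]l2normsq_fin // lee_fin nsq_proj_le.
- exact: L2B.
- exact: pvm_L2.
apply: ae_sym; apply: ae_trans; first exact: projB.
by apply: aeB; [exact: ae_refl|apply: ae_sym; exact: simple_calculus_proj].
Qed.

(** The constant is itself a simple function: the pair [(- c, setT)] is added to each approximant,
    and $E(\mathbb R)$ is the identity a.e. *)
Lemma pvm_calculus_shift h c u v : pvm_calculus E h u v ->
  pvm_calculus E (fun x => h x - c) u (fun x => v x - c * u x).
Proof.
move=> [Lu Lv H]; have Lcu := L2Z c Lu; have Lw := L2B Lv Lcu.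
split; [exact: Lu|exact: Lw|] => e e0; have [s [ms h1 h2]] := H _ e0.
have ms' : simple_meas ((- c, setT) :: s).
  move=> p; rewrite inE => /orP[/eqP ->|/ms //]; exact: measurableT.
exists ((- c, setT) :: s); split=> //.
  apply: le_lt_trans h1; rewrite le_eqVlt; apply/orP; left; apply/eqP.
  apply: eq_integral => x _; congr (normsq _)%:E.
  rewrite /simple_fun big_cons asboolT //=; ring.
apply: le_lt_trans h2; rewrite le_eqVlt; apply/orP; left; apply/eqP.
apply: ae_l2normsq.
- by apply: L2B => //; exact: L2_simple_calculus.
- by apply: L2B => //; exact: L2_simple_calculus.
apply: filterS (pvm_full E Lu) => x /= hx.
rewrite /simple_calculus big_cons /= hx; ring.
Qed.

End CalculusIsometry.

(** * Bounds for the operator on spectral subspaces *)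

Section SpectralSubspaces.
Context (R : realType) (d : measure_display) (T : measurableType d).
Context (mu : {measure set T -> \bar R}).
Local Notation F := (T -> complex R).
Local Notation L2 := (L2 mu).
Local Notation inner := (inner mu).
Local Notation nsq := (l2nsq mu).
Local Notation nrm := (l2nrm mu).
Implicit Types (f g u v w : F) (c : complex R).
Variable E : pvm mu.
Local Notation proj := (pvm_proj E).
Local Notation m := (pvm_meas E).
Local Notation RR := (measurableTypeR R).
Implicit Types (B C I J : set RR) (h : RR -> complex R).
Local Notation idc := (fun x : RR => Complex (x : R) 0).

Lemma pvm_meas_proj_compl B u : measurable B -> L2 u -> m (proj B u) (~` B) = 0%E.
Proof.
move=> mB Lu; rewrite meas_proj //; last exact: measurableC.
by rewrite setICl measure0.
Qed.

Lemma pvm_meas_total u : L2 u -> m u setT = (nsq u)%:E.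
Proof.
move=> Lu; rewrite pvm_measE_nsq //; congr EFin.
by apply: ae_nsq => //; [exact: pvm_L2|exact: pvm_full].
Qed.

Let normsq_shift (x a : R) : normsq (Complex x 0 - Complex a 0) = `|x - a| ^+ 2.
Proof. by rewrite /normsq /= subr0 expr0n addr0 real_normK ?num_real. Qed.

Let re_id : re_meas idc. Proof. exact: measurable_id. Qed.
Let im_id : im_meas idc. Proof. exact: measurable_cst. Qed.

Lemma shift_isometry (a : R) u v : pvm_calculus E idc u v ->
  Defs.L2 (m u) (fun x => idc x - Complex a 0) /\
  nrm (fun x => v x - Complex a 0 * u x) =
  l2nrm (m u) (fun x => idc x - Complex a 0).
Proof.
move=> H; apply: pvm_calculus_isometry (pvm_calculus_shift _ H).
- rewrite /re_meas (_ : _ \o _ = (fun x : R => x - a)).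
    by apply: measurable_funB; [exact: measurable_id|exact: measurable_cst].
  by apply/funext => x.
- rewrite /im_meas (_ : _ \o _ = cst 0); first exact: measurable_cst.
  by apply/funext => x /=; rewrite subr0.
Qed.

Lemma ae_proj_support B u : measurable B -> L2 u -> {ae m (proj B u), forall x, B x}.
Proof.
move=> mB Lu; exists (~` B); split.
- exact: measurableC.
- exact: pvm_meas_proj_compl.
- by [].
Qed.

(** By the isometry the left-hand norm is that of $x - a$ in $L^2$ of the scalar measure of $E(B)u$.
    This measure is carried by $B$ and has total mass $|E(B)u|^2$, so the pointwise bound on $B$ can
    be integrated. The lower bound below has the same proof. *)
Lemma shift_le_on B (a r : R) u v : measurable B -> 0 <= r ->
  (forall x, B x -> `|(x : R) - a| <= r) -> pvm_calculus E idc u v ->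
  nrm (fun x => proj B v x - Complex a 0 * proj B u x) <= r * nrm (proj B u).
Proof.
move=> mB r0 Br H; have [Lu Lv _] := H; have LBu := pvm_L2 E mB Lu.
have [Ls ->] := shift_isometry a (pvm_calculus_proj re_id im_id mB H).
rewrite -(@ler_pXn2r _ 2%N) ?nnegrE ?mulr_ge0 ?nrm_ge0 // exprMn !nrmsq.
rewrite -lee_fin -l2normsq_fin // EFinM -pvm_meas_total //.
rewrite -integral_cst //.
apply: ae_ge0_le_integral => //.
- by move=> x _; rewrite lee_fin normsq_ge0.
- by have/integrableP[] := L2_integrable_normsq Ls.
- by move=> x _; rewrite lee_fin sqr_ge0.
apply: filterS (ae_proj_support mB Lu) => x Bx _ /=.
by rewrite lee_fin normsq_shift ler_pXn2r ?nnegrE //; exact: Br.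
Qed.

Lemma shift_ge_on B (a r : R) u v : measurable B -> 0 <= r ->
  (forall x, B x -> r <= `|(x : R) - a|) -> pvm_calculus E idc u v ->
  r * nrm (proj B u) <= nrm (fun x => proj B v x - Complex a 0 * proj B u x).
Proof.
move=> mB r0 Br H; have [Lu Lv _] := H; have LBu := pvm_L2 E mB Lu.
have [Ls ->] := shift_isometry a (pvm_calculus_proj re_id im_id mB H).
rewrite -(@ler_pXn2r _ 2%N) ?nnegrE ?mulr_ge0 ?nrm_ge0 // exprMn !nrmsq.
rewrite -lee_fin -l2normsq_fin // EFinM -pvm_meas_total //.
rewrite -integral_cst //.
apply: ae_ge0_le_integral => //.
- by move=> x _; rewrite lee_fin sqr_ge0.
- by move=> x _; rewrite lee_fin normsq_ge0.
- by have/integrableP[] := L2_integrable_normsq Ls.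
apply: filterS (ae_proj_support mB Lu) => x Bx _ /=.
by rewrite lee_fin normsq_shift ler_pXn2r ?nnegrE //; exact: Br.
Qed.

End SpectralSubspaces.

(** * Operators commuting with a reflection *)

Definition reflect_on (R : realType) (T : Type) (W : set T) (f : T -> complex R) : T -> complex R :=
  fun x => if `[< W x >] then - f x else f x.

(** This is $(1 + U)/2$, see [cut_onE]: the projection onto the vectors fixed by the reflection
    $U$. *)
Definition cut_on (R : realType) (T : Type) (W : set T) (f : T -> complex R) : T -> complex R :=
  fun x => if `[< W x >] then 0 else f x.

Section Reflection.
Context (R : realType) (d : measure_display) (T : measurableType d).
Context (mu : {measure set T -> \bar R}) (W : set T).
Local Notation F := (T -> complex R).
Local Notation Re := (@complex.Re R).
Local Notation Im := (@complex.Im R).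
Local Notation L2 := (L2 mu).
Local Notation nrm := (l2nrm mu).
Local Notation "f =ae g" := (ae_equal mu f g) (at level 70).
Implicit Types (f g u v w : F).

Local Notation reflect_on := (reflect_on W).
Local Notation cut_on := (cut_on W).

Lemma reflect_onK f : reflect_on (reflect_on f) = f.
Proof. by apply/funext => x; rewrite /reflect_on; case: asboolP; rewrite ?opprK. Qed.

Lemma cut_onE f : cut_on f = fun x => Complex 2^-1 0 * (f x + reflect_on f x).
Proof.
apply/funext => x; rewrite /cut_on /reflect_on; case: asboolP => _.
  by rewrite subrr mulr0.
by apply: complex_ext; rewrite !ReImE /=; field.
Qed.

Lemma reflect_on_cut f : reflect_on (cut_on f) = cut_on f.
Proof. by apply/funext => x; rewrite /reflect_on /cut_on; case: asboolP; rewrite ?oppr0. Qed.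

Lemma reflect_onB f g : reflect_on (fun x => f x - g x) = fun x => reflect_on f x - reflect_on g x.
Proof. by apply/funext => x; rewrite /reflect_on; case: ifP; rewrite ?opprB ?opprK // addrC. Qed.

Lemma reflect_onZ c f : reflect_on (fun x => c * f x) = fun x => c * reflect_on f x.
Proof. by apply/funext => x; rewrite /reflect_on; case: ifP; rewrite ?mulrN. Qed.

Lemma reflect_on_ae f g : f =ae g -> reflect_on f =ae reflect_on g.
Proof. by apply: filterS => x; rewrite /reflect_on => ->. Qed.

Lemma l2normsq_reflect f : l2normsq mu (reflect_on f) = l2normsq mu f.
Proof.
by apply: eq_integral => x _; rewrite /reflect_on; case: ifP; rewrite ?normsqN.
Qed.

Lemma nrm_reflect f : nrm (reflect_on f) = nrm f.
Proof. by rewrite /l2nrm /l2nsq l2normsq_reflect. Qed.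

Lemma inner_reflect f g : inner mu (reflect_on f) g = inner mu f (reflect_on g).
Proof.
rewrite /inner.
have -> : (fun x => reflect_on f x * conjc (g x)) =
  (fun x => f x * conjc (reflect_on g x)); last by [].
apply/funext => x; rewrite /reflect_on; case: ifP => _ //.
by apply: complex_ext; rewrite !ReImE; ring.
Qed.

Hypothesis mW : measurable W.

Lemma L2_reflect f : L2 f -> L2 (reflect_on f).
Proof.
move=> [fr fi fo]; split.
- rewrite (_ : _ \o _ = fun x => (1 - 2 * \1_W x) * Re (f x)).
    by apply: measurable_funM => //; apply: measurable_funB => //; apply: measurable_funM.
  apply/funext => x; rewrite /comp /reflect_on indicE -[_ \in _]/`[< _ >].
  by case: asboolP => _; rewrite ?ReImE /=; ring.
- rewrite (_ : _ \o _ = fun x => (1 - 2 * \1_W x) * Im (f x)).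
    by apply: measurable_funM => //; apply: measurable_funB => //; apply: measurable_funM.
  apply/funext => x; rewrite /comp /reflect_on indicE -[_ \in _]/`[< _ >].
  by case: asboolP => _; rewrite ?ReImE /=; ring.
- by rewrite l2normsq_reflect.
Qed.

Lemma L2_cut f : L2 f -> L2 (cut_on f).
Proof. by move=> Lf; rewrite cut_onE; apply: L2Z; apply: L2D => //; exact: L2_reflect. Qed.

Lemma nrm_cut_le f : L2 f -> nrm (cut_on f) <= nrm f.
Proof.
move=> Lf; have LU := L2_reflect Lf; have Lc := L2_cut Lf.
rewrite ler_sqrt ?nsq_ge0 // -lee_fin -!l2normsq_fin //.
apply: ge0_le_integral => //.
- by move=> x _; rewrite lee_fin normsq_ge0.
- by have/integrableP[] := L2_integrable_normsq Lc.
- by have/integrableP[] := L2_integrable_normsq Lf.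
- move=> x _; rewrite lee_fin /cut_on; case: ifP => // _.
  by rewrite {1}/normsq /= expr0n addr0 normsq_ge0.
Qed.

Lemma supported_reflect f : supported_in mu W f <-> reflect_on f =ae (fun x => - f x).
Proof.
split; apply: filterS => x; rewrite /reflect_on; case: asboolP => // nW.
  by move=> ->; rewrite ?oppr0.
move=> + _ => /eqP; rewrite -subr_eq0 opprK -mulr2n => /eqP h.
by apply: complex_ext; [move: (congr1 Re h)|move: (congr1 Im h)]; rewrite mulr2n !ReImE /=; lra.
Qed.

End Reflection.

(** The generating pi-system consists of half-open intervals, and $]a,b] = [a,b] \setminus [a,a]$;
    finiteness allows the subtraction. *)
Lemma finite_measure_itv_unique (R : realType)
    (m1 m2 : {measure set (measurableTypeR R) -> \bar R}) :
  (m1 setT < +oo)%E -> (m2 setT < +oo)%E ->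
  (forall a b : R, m1 `[a, b]%classic = m2 `[a, b]%classic) ->
  forall B : set (measurableTypeR R), measurable B -> m1 B = m2 B.
Proof.
move=> f1 f2 H B mB.
have fin (m' : {measure set (measurableTypeR R) -> \bar R}) : (m' setT < +oo)%E ->
    forall C : set (measurableTypeR R), measurable C -> (m' C < +oo)%E.
  move=> f C mC; apply: le_lt_trans f; apply: le_measure; rewrite ?inE //.
have mitv (i : interval R) : measurable ([set` i] : set (measurableTypeR R)) by exact: measurable_itv.
apply: (@measure_unique _ R (measurableTypeR R)
  (@ocitv R : set (set (measurableTypeR R))) (fun n => `](- n%:R), n%:R]%classic)) => //.
- exact: ocitvI.
- by move=> n; exact: is_ocitv.
- apply/seteqP; split=> // x _; exists (Num.truncn `|x|).+1 => //=.
  have h := truncnS_gt `|x|.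
  rewrite in_itv /=; move: (ler_norm x) (ler_norm (- x)); rewrite normrN => h1 h2.
  by apply/andP; split; lra.
- move=> _ [[a b] _ <-] /=.
  have [ab|ba] := leP a b; last by rewrite set_itv_ge ?measure0 // bnd_simp -leNgt ltW.
  have -> : `]a, b]%classic = `[a, b]%classic `\` `[a, a]%classic.
    apply/seteqP; split=> x /=; rewrite !in_itv /=.
      by move=> /andP[h k]; split; [apply/andP; split; lra|apply/negP; rewrite negb_and -!ltNge h orbT].
    move=> [/andP[h k] /negP]; rewrite negb_and -!ltNge => /orP[|] h'; first lra.
    by rewrite h' k.
  rewrite !measureD //=; [|exact: fin..].
  congr (_ - _)%E => //; rewrite setIidr // => x /=; rewrite !in_itv /= => /andP[h k].
  by apply/andP; split; lra.
- by move=> n; exact: fin.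
Qed.

(** * Commutation of a spectral measure with a reflection *)

Section Reduction.
Context (R : realType) (d : measure_display) (T : measurableType d).
Context (mu : {measure set T -> \bar R}) (W : set T) (mW : measurable W).
Local Notation F := (T -> complex R).
Local Notation Re := (@complex.Re R).
Local Notation L2 := (L2 mu).
Local Notation inner := (inner mu).
Local Notation nsq := (l2nsq mu).
Local Notation nrm := (l2nrm mu).
Local Notation ip := (l2ip mu).
Local Notation "f =ae g" := (ae_equal mu f g) (at level 70).
Implicit Types (f g h u v w : F).
Variables (D : set (F * F)) (E : pvm mu).
Hypothesis D_dense : densely_defined mu D.
Hypothesis D_spectral : spectral_measure D E.
Hypothesis D_reflect : forall f g, D (f, g) -> D (reflect_on W f, reflect_on W g).
Local Notation U := (reflect_on W).
Local Notation proj := (pvm_proj E).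
Local Notation m := (pvm_meas E).
Local Notation RR := (measurableTypeR R).
Implicit Types (B C I J : set RR).

Let LU f : L2 f -> L2 (U f). Proof. exact: L2_reflect. Qed.
Let LP B f : measurable B -> L2 f -> L2 (proj B f).
Proof. by move=> mB; exact: pvm_L2. Qed.

(* [X = proj J o U o proj I] commutes with [D], and [D - c] has norm at most [r]
   on the range of [proj I] and is bounded below by [r'] on that of [proj J]:
   hence [r' |X w| <= |X (D - c) w| <= r |X| |w|], and iterating kills [X]. *)
Lemma proj_reflect_proj_far I J (c r r' : R) w : measurable I -> measurable J ->
  0 <= r -> r < r' ->
  (forall x, I x -> `|(x : R) - c| <= r) -> (forall x, J x -> r' <= `|(x : R) - c|) ->
  L2 w -> nrm (proj J (U (proj I w))) = 0.
Proof.
move=> mI mJ r0 rr' HI HJ.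
have r'0 : 0 < r' by exact: le_lt_trans rr'.
pose X f := proj J (U (proj I f)).
have LX f : L2 f -> L2 (X f) by move=> Lf; apply/LP/LU/LP.
have XB f g : L2 f -> L2 g -> X (fun x => f x - g x) =ae (fun x => X f x - X g x).
  move=> Lf Lg; apply: ae_trans; last by apply: projB => //; apply/LU/LP.
  apply: proj_ae => //; [by apply/LU/LP/L2B|by apply: L2B; apply/LU/LP|].
  by rewrite -reflect_onB; apply: reflect_on_ae; exact: projB.
have X1 f : L2 f -> nrm (X f) <= nrm f.
  move=> Lf; apply: le_trans (nrm_proj_le E mJ (LU (LP mI Lf))) _.
  by rewrite nrm_reflect; exact: nrm_proj_le.
have contract (a : R) : 0 <= a -> (forall f, L2 f -> nrm (X f) <= a * nrm f) ->
    forall f, L2 f -> nrm (X f) <= a * (r / r') * nrm f.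
  move=> a0 Ha f Lf; apply/ler_addgt0Pr => e e0.
  (* With $q = r/r'$ and $\delta = |f - h|$, the bounds below give $|Xf| \le aq(|f| + \delta) +
     \delta = aq|f| + K\delta$. The vector [h] is taken in the domain of [D], where $D - c$ can be
     applied. *)
  pose K := a * (r / r') + 1.
  have K0 : 0 < K by rewrite ltr_wpDl // mulr_ge0 // divr_ge0 // ltW.
  have eK : 0 < e / K by rewrite divr_gt0.
  have [h [k [Dhk hf]]] := D_dense Lf (exprn_gt0 2 eK).
  have Hhk : pvm_calculus E (fun x : RR => Complex (x : R) 0) h k.
    by move: Dhk; rewrite D_spectral.
  have [Lh Lk _] := Hhk.
  have {}hf : nrm (fun x => f x - h x) < e / K.
    by apply/(l2normsq_lt _ eK) => //; exact: L2B.
  have Dp : D (proj I h, proj I k).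
    rewrite D_spectral; apply: pvm_calculus_proj => //.
    - exact: measurable_id.
    - exact: measurable_cst.
  have HU : pvm_calculus E (fun x : RR => Complex (x : R) 0) (U (proj I h)) (U (proj I k)).
    by have := D_reflect Dp; rewrite D_spectral.
  have e1 := shift_ge_on mJ (ltW r'0) HJ HU.
  have e2 := shift_le_on mI r0 HI Hhk.
  pose y := (fun x => k x - Complex c 0 * h x).
  pose z := (fun x => proj I k x - Complex c 0 * proj I h x).
  have Ly : L2 y by apply: L2B => //; exact: L2Z.
  have Lz : L2 z by apply: L2B; [exact: LP|apply: L2Z; exact: LP].
  have zE : proj I y =ae z.
    apply: ae_trans; first by apply: projB => //; exact: L2Z.
    by apply: aeB; [exact: ae_refl|exact: projZ].
  (* As $z = (D - c)E(I)h$ stays in the range of $E(I)$, the vector $E(J)Uz$ is $Xz$, and the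
     assumed bound [Ha] applies to it. *)
  have zz : z =ae proj I z.
    apply: ae_trans; first by apply: ae_sym; exact: zE.
    apply: (@ae_trans _ _ _ _ _ (proj I (proj I y))).
      by have := pvm_mul E mI mI Ly; rewrite setIid.
    by apply: proj_ae => //; exact: LP.
  have e3 : nrm (fun x => proj J (U (proj I k)) x - Complex c 0 * proj J (U (proj I h)) x)
      = nrm (X z).
    have LUz := LU Lz; have LUI g : L2 g -> L2 (U (proj I g)) by move=> Lg; apply/LU/LP.
    transitivity (nrm (proj J (U z))).
      apply: ae_nrm.
      - by apply: L2B; [|apply: L2Z]; apply: LP => //; exact: LUI.
      - exact: LP.
      rewrite /z reflect_onB reflect_onZ; apply: ae_sym.
      apply: ae_trans; first by apply: projB => //; [exact: LUI|apply: L2Z; exact: LUI].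
      by apply: aeB; [exact: ae_refl|apply: projZ => //; exact: LUI].
    apply: ae_nrm; [exact: LP|exact: LX|].
    apply: proj_ae => //; first by apply/LU/LP.
    exact: reflect_on_ae.
  rewrite e3 in e1.
  have e4 := Ha _ Lz.
  have e5 : nrm (X h) <= a * (r / r') * nrm h.
    rewrite (_ : _ * _ * _ = a * (r * nrm h) / r'); last by rewrite !mulrA mulrAC.
    rewrite ler_pdivlMr // mulrC (le_trans e1) // (le_trans e4) // ler_wpM2l //.
    by rewrite (le_trans e2) // ler_wpM2l // nrm_proj_le.
  have e6 : nrm (X f) <= nrm (X h) + nrm (fun x => f x - h x).
    apply: le_trans (nrm_le_dist (LX _ Lf) (LX _ Lh)) _.
    rewrite lerD2l (ae_nrm _ _ (ae_sym (XB _ _ Lf Lh))).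
    - by apply: X1; exact: L2B.
    - by apply: L2B; exact: LX.
    - by apply: LX; exact: L2B.
  have e7 : nrm h <= nrm f + nrm (fun x => f x - h x).
    by rewrite nrmB_sym; exact: nrm_le_dist.
  have e8 : K * nrm (fun x => f x - h x) <= e.
    by rewrite mulrC -ler_pdivlMr // ltW.
  have e9 : a * (r / r') * nrm h <= a * (r / r') * (nrm f + nrm (fun x => f x - h x)).
    by rewrite ler_wpM2l // mulr_ge0 // divr_ge0 // ltW.
  move: e8; rewrite /K mulrDl mul1r => e8; lra.
move=> Lw; pose q := r / r'.
have q0 : 0 <= q by rewrite divr_ge0 // ltW.
have q1 : q < 1 by rewrite /q ltr_pdivrMr // mul1r.
(* Each application of [contract] to the bound $q^n$ gains one factor $q < 1$; the start is $|X| \le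
   1$. *)
have iter n f : L2 f -> nrm (X f) <= q ^+ n * nrm f.
  elim: n f => [|n ih] f Lf; first by rewrite expr0 mul1r; exact: X1.
  by rewrite exprSr; apply: contract => //; exact: exprn_ge0.
apply/eqP; rewrite eq_le nrm_ge0 andbT leNgt; apply/negP => X0.
have qn : `|q| < 1 by rewrite ger0_norm.
have /cvgr_lt/(_ _ X0)[N _ HN] := cvg_geometric (nrm w) qn.
have := HN N (leqnn N); rewrite /geometric /= mulrC ltNge => /negP; apply.
exact: iter.
Qed.

(** It suffices that the scalar measure of $U E(I) w$ has no mass off $I$. The complement of $I$
    touches $I$, so the strict gap $r < r'$ is only available on the pieces [J n] at distance at
    least $r + 1/(n+1)$ from the centre; countably many null pieces exhaust it. *)
Lemma reflect_proj_itv (a b : R) w : L2 w ->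
  U (proj `[a, b]%classic w) =ae proj `[a, b]%classic (U (proj `[a, b]%classic w)).
Proof.
move=> Lw; have mI : measurable (`[a, b]%classic : set RR) by exact: measurable_itv.
(* An empty interval has no radius $r \ge 0$; its projection vanishes and both sides are zero. *)
have [ba|ab] := ltP b a.
  have i0 : `[a, b]%classic = set0 :> set RR.
    by apply/seteqP; split=> // x; rewrite /= in_itv /=; lra.
  have z f : L2 f -> proj `[a, b]%classic f =ae (fun=> 0).
    move=> Lf; apply: nsq_eq0; first exact: LP.
    by apply/EFin_inj; rewrite -pvm_measE_nsq // i0 measure0.
  apply: (@ae_trans _ _ _ _ _ (fun=> 0)); last by apply/ae_sym/z/LU/LP.
  by apply: filterS (z _ Lw) => x; rewrite /reflect_on => ->; case: ifP; rewrite ?oppr0.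
pose c := (a + b) / 2; pose r := (b - a) / 2.
have r0 : 0 <= r by rewrite divr_ge0 // subr_ge0.
have IE (x : R) : (x \in `[a, b]) = (`|x - c| <= r).
  by rewrite in_itv /= ler_norml /c /r; apply/idP/idP => /andP[h k]; apply/andP; split; lra.
apply: proj_compl0 => //; first by apply/LU/LP.
pose J (n : nat) : set RR := [set x : R | r + n.+1%:R^-1 <= `|x - c|].
have mJ n : measurable (J n).
  have mf : measurable_fun setT (fun x : R => `|x - c|).
    apply: measurableT_comp => //; apply: measurable_funB; [exact: measurable_id|exact: measurable_cst].
  have := mf measurableT `[(r + n.+1%:R^-1), +oo[%classic (measurable_itv _).
  rewrite setTI; congr measurable; apply/seteqP; split=> x /=; by rewrite in_itv /= andbT.
apply/negligibleP; first exact: measurableC.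
apply: (@negligibleS _ _ _ _ (\bigcup_n J n)).
  move=> x /= /negP; rewrite IE -ltNge => xr.
  have xr0 : 0 < `|x - c| - r by rewrite subr_gt0.
  exists (Num.truncn (`|x - c| - r)^-1) => //.
  rewrite /J /= -lerBrDl -[leRHS]invrK lef_pV2 ?posrE ?invr_gt0 //.
  by rewrite ltW // truncnS_gt.
apply: negligible_bigcup => n; apply/negligibleP; first exact: mJ.
suff : m (U (proj `[a, b]%classic w)) (J n) = 0%E by [].
rewrite pvm_measE_nsq //; last by apply/LU/LP.
rewrite -nrmsq (@proj_reflect_proj_far _ _ c r (r + n.+1%:R^-1)) ?expr0n //.
- by rewrite ltrDl invr_gt0.
- by move=> x; rewrite /= IE.
Qed.

(** From $UE = EUE$, taking adjoints gives $EU = EUE$, since $E$ and $U$ are symmetric; hence $EU =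
    UE$. *)
Lemma proj_itv_reflect (a b : R) w : L2 w ->
  proj `[a, b]%classic (U w) =ae U (proj `[a, b]%classic w).
Proof.
move=> Lw; have mI : measurable (`[a, b]%classic : set RR) by exact: measurable_itv.
set I := `[a, b]%classic in mI *.
apply: (@ae_trans _ _ _ _ _ (proj I (U (proj I w)))); last first.
  by apply: ae_sym; exact: reflect_proj_itv.
apply: inner_ae_ext; [by apply/LP/LU|by apply/LP/LU/LP|] => h Lh.
have LIh := LP mI Lh.
rewrite (pvm_sym E) //; last exact: LU.
rewrite inner_reflect [RHS](pvm_sym E) //; last by apply/LU/LP.
rewrite inner_reflect (pvm_sym E) //; last exact: LU.
by apply: ae_inner => //; [exact: LU|by apply/LP/LU|exact: ae_refl|exact: reflect_proj_itv].
Qed.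

Lemma supported_proj B u : measurable B -> L2 u -> supported_in mu W u ->
  supported_in mu W (proj B u).
Proof.
move=> mB Lu /supported_reflect su; have LBu := LP mB Lu.
(* The part of $E(B)u$ that has to vanish. Being a restriction of $E(B)u$, it satisfies $\langle
   E(B)u, w\rangle = |w|^2$, so orthogonality to $E(B)u$ is enough. *)
pose w := cut_on W (proj B u).
have Lw : L2 w by exact: L2_cut.
have Uw : U w = w by exact: reflect_on_cut.
(* The vector $E(I)u$ is odd under $U$ and [w] is even. *)
have orth a b : ip (proj `[a, b]%classic u) w = 0.
  have mI : measurable (`[a, b]%classic : set RR) by exact: measurable_itv.
  set I := `[a, b]%classic in mI *.
  have LIu := LP mI Lu.
  have e1 : inner (proj I u) w = inner (proj I (U u)) w.
    rewrite -{1}Uw -inner_reflect; apply: ae_inner => //; [exact: LU|by apply/LP/LU| |exact: ae_refl].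
    by apply: ae_sym; exact: proj_itv_reflect.
  have e2 : inner (proj I (U u)) w = inner (proj I (fun x => (-1) * u x)) w.
    apply: ae_inner => //; [by apply/LP/LU|by apply/LP/L2Z| |exact: ae_refl].
    apply: proj_ae => //; [exact: LU|exact: L2Z|].
    by apply: filterS su => x ->; rewrite mulN1r.
  have e3 : inner (proj I (fun x => (-1) * u x)) w = (-1) * inner (proj I u) w.
    rewrite -innerZl //; apply: ae_inner => //; [by apply/LP/L2Z|exact: L2Z| |exact: ae_refl].
    exact: projZ.
  have : ip (proj I u) w = - ip (proj I u) w.
    by rewrite /l2ip {1}e1 e2 e3 mulN1r ReN.
  lra.
have Luw := L2D Lu Lw.
(* The defect of additivity $|E(C)(u + w)|^2 - |E(C)u|^2 - |E(C)w|^2$ is $2\,\mathrm{Re}\langle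
   E(C)u, w\rangle$. *)
have key C : measurable C -> m (fun x => u x + w x) C = measure_add (m u) (m w) C <->
    ip (proj C u) w = 0.
  move=> mC; have LCu := LP mC Lu; have LCw := LP mC Lw.
  rewrite measure_addE !pvm_measE_nsq // -EFinD.
  rewrite (ae_nsq _ _ (projD E mC Lu Lw)); [|exact: LP|exact: L2D].
  rewrite nsqD //.
  have -> : ip (proj C u) (proj C w) = ip (proj C u) w.
    rewrite /l2ip -(pvm_sym E) //; congr Re; apply: ae_inner => //; [exact: LP| |exact: ae_refl].
    by apply: ae_sym; have := pvm_mul E mC mC Lu; rewrite setIid.
  split=> [[]|->]; [lra|by rewrite mulr0 addr0].
have /key : m (fun x => u x + w x) B = measure_add (m u) (m w) B.
  apply: finite_measure_itv_unique => //.
  - exact: pvm_meas_lty.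
  - have : (m u setT + m w setT < +oo)%E by rewrite lte_add_pinfty //; exact: pvm_meas_lty.
    by rewrite -measure_addE.
  - by move=> a b; apply/key => //; exact: measurable_itv.
move=> /(_ mB) ip0.
have {ip0} w0 : nsq w = 0.
  have : ip (proj B u) w = nsq w.
    rewrite -ip_self /l2ip; congr Re.
    rewrite /inner; have -> // : (fun x => proj B u x * conjc (w x)) = (fun x => w x * conjc (w x)).
    apply/funext => x; rewrite /w /cut_on; case: ifP => // _.
    by apply: complex_ext; rewrite !ReImE /=; ring.
  by rewrite ip0.
have := nsq_eq0 Lw w0; apply: filterS => x; rewrite /w /cut_on.
by case: asboolP.
Qed.

Lemma supported_pvm_calculus (h : RR -> complex R) u v : pvm_calculus E h u v ->
  supported_in mu W u -> supported_in mu W v.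
Proof.
move=> [Lu Lv H] su.
have Lcv := L2_cut mW Lv.
suff : nrm (cut_on W v) = 0.
  move=> n0; have : nsq (cut_on W v) = 0 by rewrite -nrmsq n0 expr0n.
  move=> /(nsq_eq0 Lcv); apply: filterS => x; rewrite /cut_on.
  by case: asboolP.
apply/eqP; rewrite eq_le nrm_ge0 andbT; apply/ler_addgt0Pr => e e0; rewrite add0r.
have [s [ms _ h2]] := H _ (exprn_gt0 2 e0).
have LS := L2_simple_calculus E ms Lu.
have {}h2 : nrm (fun x => v x - simple_calculus E s u x) < e.
  by apply/(l2normsq_lt _ e0) => //; exact: L2B.
have sS : supported_in mu W (simple_calculus E s u).
  rewrite /simple_calculus; elim: s ms {h2 LS} => [|p s ih] ms.
    by apply: aeW => x _; rewrite big_nil.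
  have mp : measurable p.2 by apply: ms; rewrite mem_head.
  have {}ih : supported_in mu W (fun x => \sum_(p <- s) p.1 * proj p.2 u x).
    by apply: ih => q qs; apply: ms; rewrite inE qs orbT.
  apply: filterS2 (supported_proj mp Lu su) ih => x h1 h2 nW.
  by rewrite big_cons h1 // h2 // mulr0 addr0.
(* Off [W] the vector $s(E)u$ vanishes a.e., so cutting [v] is the same as cutting the error $v -
   s(E)u$. *)
apply: le_trans (ltW h2); rewrite -(ae_nrm _ _ (f := cut_on W (fun x => v x - simple_calculus E s u x))).
- by apply: nrm_cut_le => //; exact: L2B.
- by apply: L2_cut => //; exact: L2B.
- by [].
apply: filterS sS => x; rewrite /cut_on; case: asboolP => // nW /(_ nW) ->.
by rewrite subr0.
Qed.

End Reduction.

(** * Symmetry inherited by the unique self-adjoint extension *)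

Section UniqueExtension.
Context (R : realType) (d : measure_display) (T : measurableType d).
Context (mu : {measure set T -> \bar R}) (W : set T) (mW : measurable W).
Local Notation F := (T -> complex R).
Local Notation L2 := (L2 mu).
Local Notation U := (reflect_on W).
Variables (A D : set (F * F)).
Hypothesis A_reflect : forall f g : F, A (f, g) -> A (U f, U g).
Hypothesis D_unique : unique (self_adjoint_extension mu A) D.

(* The conjugate of [D] by the unitary involution [U] is another self-adjoint
   extension of [A]. *)
Lemma unique_extension_reflect (f g : F) : D (f, g) -> D (U f, U g).
Proof.
have [[AD [dD sD]] uD] := D_unique.
suff DE : D = [set p | D (U p.1, U p.2)] by rewrite {1}DE.
apply: uD; split=> [[h k] /A_reflect /AD //|]; split.
  move=> h e Lh e0; have [h' [k' [Dh' lt]]] := dD _ _ (L2_reflect mW Lh) e0.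
  exists (U h'), (U k'); split; first by rewrite /= !reflect_onK.
  rewrite -(l2normsq_reflect _ W) (_ : reflect_on W _ = (U h \- h')%R) //.
  by rewrite [LHS](reflect_onB W) reflect_onK.
apply/seteqP; split=> -[p1 p2] /=.
  move=> [/= Lp1 Lp2 H]; rewrite -sD; split=> /=; [exact: L2_reflect..|] => h k Dhk.
  by rewrite -!inner_reflect; apply: H; rewrite /= !reflect_onK.
rewrite -{1}sD => -[/= Lp1 Lp2 H]; split=> /=.
- by rewrite -(reflect_onK W p1); exact: L2_reflect.
- by rewrite -(reflect_onK W p2); exact: L2_reflect.
- move=> h k /= /H; by rewrite -!inner_reflect !reflect_onK.
Qed.

Lemma supported_functional_calculus (h : R -> complex R) (u v : F) :
  functional_calculus mu D h u v -> supported_in mu W u -> supported_in mu W v.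
Proof.
have [[_ [dD _]] _] := D_unique.
move=> [E sE]; apply: (supported_pvm_calculus mW dD sE).
exact: unique_extension_reflect.
Qed.

End UniqueExtension.

(** * Partial derivatives and the chain rule *)

Section DirectionalDerivatives.
Context (R : realType) (V : normedModType R).
Implicit Types (f g : V -> R) (v z : V).

Lemma is_derive_line f v z (t : R) : derivable f (t *: v + z) v ->
  is_derive t 1 (fun h : R => f (h *: v + z)) ('D_v f (t *: v + z)).
Proof.
move=> df.
have e : (fun h : R => h^-1 *: (((fun h : R => f (h *: v + z)) \o shift t) (h *: 1) - f (t *: v + z))) =
    (fun h : R => h^-1 *: ((f \o shift (t *: v + z)) (h *: v) - f (t *: v + z))).
  by apply/funext => h /=; rewrite scalerDl addrA [h *: 1]mulr1.
by apply: DeriveDef; [rewrite /derivable e|rewrite /derive e].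
Qed.

Lemma derivable_line_cvg f v z : derivable f z v ->
  f (h *: v + z) @[h --> 0] --> f z.
Proof.
move=> /derivable1P /derivable1_diffP /differentiable_continuous.
by move=> c; rewrite -{2}(add0r z) -(scale0r v); exact: c.
Qed.

(** The mean value theorem for $h \mapsto f(hv + z)$; the condition $|t| \le |s|$ covers both signs
    of $s$. *)
Lemma directional_MVT f v z (s : R) :
  (forall t : R, `|t| <= `|s| -> derivable f (t *: v + z) v) ->
  exists2 t : R, `|t| <= `|s| & f (s *: v + z) - f z = s * 'D_v f (t *: v + z).
Proof.
move=> H.
have D (t : R) : `|t| <= `|s| -> is_derive t 1 (fun h : R => f (h *: v + z)) ('D_v f (t *: v + z)).
  by move=> ts; apply: is_derive_line; exact: H.
have C (t : R) : `|t| <= `|s| -> {for t, continuous (fun h : R => f (h *: v + z))}.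
  by move=> /D [dt _]; apply: differentiable_continuous; exact/derivable1_diffP.
have [s0|s0] := leP 0 s.
  have inS (t : R) : t \in `[0, s] -> `|t| <= `|s|.
    by rewrite in_itv /= => /andP[t0 ts]; rewrite !ger0_norm.
  have [||t ts e] := @MVT_segment R (fun h : R => f (h *: v + z)) (fun t => 'D_v f (t *: v + z)) 0 s s0.
  - by move=> t ts; apply/D/inS; exact: subset_itv_oo_cc ts.
  - apply: continuous_in_subspaceT => t; rewrite inE => ts; apply/C/inS; exact: ts.
  exists t; first exact: inS.
  by move: e; rewrite scale0r add0r subr0 mulrC.
have inS (t : R) : t \in `[s, 0] -> `|t| <= `|s|.
  rewrite in_itv /= => /andP[t0 ts]; rewrite !ler0_norm //; last exact: ltW.
  by rewrite lerN2.
have [||t ts e] := @MVT_segment R (fun h : R => f (h *: v + z))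
  (fun t => 'D_v f (t *: v + z)) s 0 (ltW s0).
- by move=> t ts; apply/D/inS; exact: subset_itv_oo_cc ts.
- apply: continuous_in_subspaceT => t; rewrite inE => ts; apply/C/inS; exact: ts.
exists t; first exact: inS.
move: e; rewrite scale0r add0r sub0r mulrN => e.
by rewrite -opprB e opprK mulrC.
Qed.

End DirectionalDerivatives.

Section ChainRule.
Context (R : realType).
Implicit Types (f g : R * R -> R) (w z : R * R).
Local Notation plane := (R * R)%type.

Lemma axis_falseE (h : R) z : h *: axis R false + z = (h + z.1, z.2).
Proof.
by case: z => a b; congr pair; rewrite /= ?[h *: 1]mulr1 // [h *: 0]mulr0 add0r.
Qed.

Lemma axis_trueE (h : R) z : h *: axis R true + z = (z.1, h + z.2).
Proof.
by case: z => a b; congr pair; rewrite /= ?[h *: 1]mulr1 // [h *: 0]mulr0 add0r.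
Qed.

Lemma ball_plane w z (e : R) : ball w e z <-> `|w.1 - z.1| < e /\ `|w.2 - z.2| < e.
Proof. by []. Qed.

(* Caratheodory's form of differentiability at a point where the partial
   derivatives are continuous: the slopes [s1], [s2] come from the mean value
   theorem. *)
Lemma slopes g w : {near w, forall z b, derivable g z (axis R b)} ->
  (forall b, {for w, continuous (partial b g)}) ->
  exists s1 s2 : plane -> R,
    [/\ s1 @ w --> partial false g w, s2 @ w --> partial true g w &
        \forall z \near w, g z - g w = s1 z * (z.1 - w.1) + s2 z * (z.2 - w.2)].
Proof.
move=> /nbhs_ballP[r /= r0 Hr] Hc.
have Dg z b : ball w r z -> derivable g z (axis R b) by move=> /Hr.
(* The path from [w] to [z] goes vertically to [(w.1, z.2)], with slope [s2], then horizontally,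
   with slope [s1]. Where a quotient degenerates it is replaced by the corresponding partial
   derivative, so that the slopes still converge. *)
pose s1 z := if z.1 == w.1 then partial false g (w.1, z.2)
             else (g z - g (w.1, z.2)) / (z.1 - w.1).
pose s2 z := if z.2 == w.2 then partial true g w
             else (g (w.1, z.2) - g w) / (z.2 - w.2).
have s1E z : ball w r z -> exists2 x : R, `|x - w.1| <= `|z.1 - w.1| &
    s1 z = partial false g (x, z.2).
  move=> /ball_plane[z1 z2]; rewrite /s1; case: eqP => [->|/eqP ne].
    by exists w.1; rewrite ?lexx.
  have [t ht|t tle] := @directional_MVT R _ g (axis R false) (w.1, z.2) (z.1 - w.1).
    apply: Dg; rewrite axis_falseE; apply/ball_plane => /=; split=> //.
    by rewrite opprD addrCA subrr addr0 normrN (le_lt_trans ht) // distrC.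
  rewrite !axis_falseE /= subrK -surjective_pairing => ->.
  exists (t + w.1); first by rewrite addrK.
  by rewrite mulrAC divff ?mul1r // subr_eq0.
have s2E z : ball w r z -> exists2 x : R, `|x - w.2| <= `|z.2 - w.2| &
    s2 z = partial true g (w.1, x).
  move=> /ball_plane[z1 z2]; rewrite /s2; case: eqP => [_|/eqP ne].
    by exists w.2; rewrite ?subrr ?normr0 // -surjective_pairing.
  have [t ht|t tle] := @directional_MVT R _ g (axis R true) w (z.2 - w.2).
    apply: Dg; rewrite axis_trueE; apply/ball_plane => /=; split.
      by rewrite subrr normr0.
    by rewrite opprD addrCA subrr addr0 normrN (le_lt_trans ht) // distrC.
  rewrite !axis_trueE /= subrK => ->.
  exists (t + w.2); first by rewrite addrK.
  by rewrite mulrAC divff ?mul1r // subr_eq0.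
exists s1, s2; split.
- apply/cvgrPdist_lt => e e0.
  have /cvgrPdist_lt /(_ _ e0) /nbhs_ballP[k /= k0 Hk] := Hc false.
  have rk : 0 < Num.min r k by rewrite lt_min r0.
  apply: filterS (nbhsx_ballx w _ rk) => z.
  move=> /ball_plane; rewrite !lt_min => -[/andP[z1 z1'] /andP[z2 z2']].
  have [//|x xle ->] := s1E z; apply: Hk; apply/ball_plane; split=> //=.
  by rewrite distrC (le_lt_trans xle) // distrC.
- apply/cvgrPdist_lt => e e0.
  have /cvgrPdist_lt /(_ _ e0) /nbhs_ballP[k /= k0 Hk] := Hc true.
  have rk : 0 < Num.min r k by rewrite lt_min r0.
  apply: filterS (nbhsx_ballx w _ rk) => z.
  move=> /ball_plane; rewrite !lt_min => -[/andP[z1 z1'] /andP[z2 z2']].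
  have [//|x xle ->] := s2E z; apply: Hk; apply/ball_plane; split=> /=.
    by rewrite subrr normr0.
  by rewrite distrC (le_lt_trans xle) // distrC.
apply: (@filterE _ (nbhs w)) => z; rewrite /s1 /s2.
have e1 : g z - g w = (g z - g (w.1, z.2)) + (g (w.1, z.2) - g w) by rewrite addrA subrK.
rewrite e1; congr (_ + _); case: eqP => [e|/eqP ne].
- by rewrite e subrr mulr0 -e -surjective_pairing subrr.
- by rewrite divfK // subr_eq0.
- by rewrite e subrr mulr0 -surjective_pairing subrr.
- by rewrite divfK // subr_eq0.
Qed.

(** The difference quotient of the composite is $s_1 \cdot q_1 + s_2 \cdot q_2$, with the slopes of
    [g] and the quotients of [t1], [t2]. The source [V] is general because the rule is applied on
    the plane, for changes of variables, and on the line, along rays. *)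
Lemma is_derive_comp_plane (V : normedModType R) (t1 t2 : V -> R) (y v : V) (d1 d2 : R) g :
  is_derive y v t1 d1 -> is_derive y v t2 d2 ->
  {near (t1 y, t2 y), forall z b, derivable g z (axis R b)} ->
  (forall b, {for (t1 y, t2 y), continuous (partial b g)}) ->
  is_derive y v (fun x : V => g (t1 x, t2 x))
    (partial false g (t1 y, t2 y) * d1 + partial true g (t1 y, t2 y) * d2).
Proof.
move=> D1 D2 Dg Cg; set w := (t1 y, t2 y).
have [s1 [s2 [c1 c2 sE]]] := slopes Dg Cg.
have cT : (t1 (h *: v + y), t2 (h *: v + y)) @[h --> 0] --> w.
  by case: D1 D2 => [D1 _] [D2 _]; exact: (cvg_pair (derivable_line_cvg D1) (derivable_line_cvg D2)).
have cT' : (t1 (h *: v + y), t2 (h *: v + y)) @[h --> 0^'] --> w.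
  exact: cvg_within_filter.
have cD (t : V -> R) dt : is_derive y v t dt -> 
    (h^-1 *: (t (h *: v + y) - t y)) @[h --> 0^'] --> dt.
  by move=> [dt1 <-]; exact: dt1.
have lim : (h^-1 *: (g (t1 (h *: v + y), t2 (h *: v + y)) - g w)) @[h --> 0^'] -->
    partial false g w * d1 + partial true g w * d2.
  have : (s1 (t1 (h *: v + y), t2 (h *: v + y)) * (h^-1 *: (t1 (h *: v + y) - t1 y)) +
     s2 (t1 (h *: v + y), t2 (h *: v + y)) * (h^-1 *: (t2 (h *: v + y) - t2 y))) @[h --> 0^'] -->
     partial false g w * d1 + partial true g w * d2.
    apply: cvgD; apply: cvgM; [|exact: cD| |exact: cD].
      exact: (cvg_comp _ _ cT' c1).
    exact: (cvg_comp _ _ cT' c2).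
  move=> lim0; apply: cvg_trans lim0; apply: near_eq_cvg.
  have near_s : \forall h \near (0 : R)^', g (t1 (h *: v + y), t2 (h *: v + y)) - g w =
      s1 (t1 (h *: v + y), t2 (h *: v + y)) * (t1 (h *: v + y) - t1 y) +
      s2 (t1 (h *: v + y), t2 (h *: v + y)) * (t2 (h *: v + y) - t2 y).
    exact: (cT' _ sE).
  apply: filterS near_s => h ->.
  by rewrite [RHS]scalerDr; congr (_ + _); exact: mulrCA.
by apply: DeriveDef; [apply/cvg_ex; eexists; exact: lim|exact: cvg_lim lim].
Qed.

End ChainRule.

(** * Smooth functions of two variables *)

Section SmoothPlane.
Context (R : realType).
Implicit Types (f g : R * R -> R) (y z : R * R) (U V : set (R * R)).
Local Notation plane := (R * R)%type.

Lemma iter_partial_rcons s b f :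
  iter_partial (rcons s b) f = iter_partial s (partial b f).
Proof. by rewrite /iter_partial foldr_rcons. Qed.

Lemma smooth_plane_partial U b f : smooth_plane U f -> smooth_plane U (partial b f).
Proof. by move=> sf s y Uy; rewrite -iter_partial_rcons; exact: sf. Qed.

Lemma smooth_plane_continuous U f y : smooth_plane U f -> U y -> {for y, continuous f}.
Proof. by move=> sf Uy; have [] := sf [::] y Uy. Qed.

Lemma smooth_plane_derivable U f y b : smooth_plane U f -> U y -> derivable f y (axis R b).
Proof. by move=> sf Uy; have [_] := sf [::] y Uy. Qed.

Lemma partial_is_derive U b f y : smooth_plane U f -> U y ->
  is_derive y (axis R b) f (partial b f y).
Proof. by move=> sf Uy; apply: DeriveDef => //; exact: smooth_plane_derivable sf Uy. Qed.

Lemma partial_near b f g y : {near y, f =1 g} -> partial b f y = partial b g y.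
Proof. exact: near_eq_derive. Qed.

(* The coinduction principle for smoothness: a class of C^1 functions stable
   under partial derivatives, up to equality on [U], consists of smooth ones. *)
Lemma smooth_plane_coind U (C : set (plane -> R)) : open U ->
  (forall f, C f -> forall y, U y ->
     {for y, continuous f} /\ forall b, derivable f y (axis R b)) ->
  (forall f b, C f -> exists2 g, C g & forall y, U y -> partial b f y = g y) ->
  forall f, C f -> smooth_plane U f.
Proof.
move=> oU C1 C2 f Cf s.
have nearU y (h k : plane -> R) : U y -> (forall z, U z -> h z = k z) -> {near y, h =1 k}.
  by move=> Uy e; apply: filterS (open_nbhs_nbhs (conj oU Uy)) => z; exact: e.
have [g Cg e] : exists2 g, C g & forall y, U y -> iter_partial s f y = g y.
  elim: s => [|b s [g Cg e]]; first by exists f.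
  have [h Ch e'] := C2 _ b Cg; exists h => // y Uy.
  by rewrite -e' //=; apply: partial_near; exact: nearU.
move=> y Uy; have [cg dg] := C1 _ Cg _ Uy; have ne := nearU _ _ _ Uy e; split.
  apply: (cvg_trans (near_eq_cvg (filterS (fun z => esym) ne))).
  by rewrite (e _ Uy); exact: cg.
move=> b; apply: near_eq_derivable (dg b).
by apply: filterS ne => z.
Qed.

Lemma smooth_plane_eq U f g : open U -> (forall y, U y -> f y = g y) ->
  smooth_plane U f -> smooth_plane U g.
Proof.
move=> oU e sf.
apply: (smooth_plane_coind
  (C := [set g | exists2 f, smooth_plane U f & forall y, U y -> f y = g y])) => //;
  last by exists f.
  move=> h [k sk ek] y Uy.
  have ne : {near y, k =1 h}.
    by apply: filterS (open_nbhs_nbhs (conj oU Uy)) => z; exact: ek.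
  split.
    apply: (cvg_trans (near_eq_cvg (filterS (fun z => id) ne))).
    by rewrite -ek //; exact: smooth_plane_continuous sk Uy.
  by move=> b; apply: near_eq_derivable ne _; exact: smooth_plane_derivable sk Uy.
move=> h b [k sk ek]; exists (partial b k).
  by exists (partial b k) => //; exact: smooth_plane_partial.
move=> y Uy; apply: partial_near.
by apply: filterS (open_nbhs_nbhs (conj oU Uy)) => z /ek.
Qed.

Lemma smooth_plane_sub U V f : V `<=` U -> smooth_plane U f -> smooth_plane V f.
Proof. by move=> VU sf s y /VU; exact: sf. Qed.

Lemma smooth_plane_local U f :
  (forall y, U y -> exists2 V, V y & smooth_plane V f) -> smooth_plane U f.
Proof. by move=> H s y /H [V Vy sf]; exact: sf. Qed.

Lemma is_derive_cst_axis (c : R) y v : is_derive y v (fun _ : plane => c) 0.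
Proof. exact: is_derive_cst. Qed.

Lemma smooth_plane_cst U (c : R) : open U -> smooth_plane U (fun=> c).
Proof.
move=> oU; apply: (smooth_plane_coind (C := [set f | exists c, f = fun=> c])) => //.
- move=> _ [a ->] y Uy; split; first exact: cvg_cst.
  by move=> b; have [] := is_derive_cst_axis a y (axis R b).
- move=> _ b [a ->]; exists (fun=> 0); first by exists 0.
  by move=> y _; have [] := is_derive_cst_axis a y (axis R b).
- by exists c.
Qed.

Section Closure.
Variables (U V : set plane) (t1 t2 : plane -> R).
Hypotheses (oU : open U) (oV : open V).
Hypotheses (st1 : smooth_plane U t1) (st2 : smooth_plane U t2).
Hypothesis tUV : forall y, U y -> V (t1 y, t2 y).

(** A partial derivative of $g \circ t$ is a sum of products of such composites with derivatives of
    $t$. Composition, sum and product are therefore treated as one class, stable under partial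
    derivatives, to which the coinduction principle applies. *)
Inductive smooth_closure : (plane -> R) -> Prop :=
| closure_base f : smooth_plane U f -> smooth_closure f
| closure_comp g : smooth_plane V g -> smooth_closure (fun y => g (t1 y, t2 y))
| closure_add f g : smooth_closure f -> smooth_closure g -> smooth_closure (fun y => f y + g y)
| closure_mul f g : smooth_closure f -> smooth_closure g -> smooth_closure (fun y => f y * g y).

Let comp_derive g y b : smooth_plane V g -> U y ->
  is_derive y (axis R b) (fun y => g (t1 y, t2 y))
    (partial false g (t1 y, t2 y) * partial b t1 y + partial true g (t1 y, t2 y) * partial b t2 y).
Proof.
move=> sg Uy; have Vy := tUV Uy.
apply: is_derive_comp_plane.
- exact: partial_is_derive st1 Uy.
- exact: partial_is_derive st2 Uy.
- apply: filterS (open_nbhs_nbhs (conj oV Vy)) => z Vz b'.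
  exact: smooth_plane_derivable sg Vz.
- by move=> b'; exact: smooth_plane_continuous (smooth_plane_partial b' sg) Vy.
Qed.

Let closure_derive f : smooth_closure f -> forall b, exists2 g, smooth_closure g &
  forall y, U y -> is_derive y (axis R b) f (g y).
Proof.
elim=> {f} [f sf|g sg|f g cf If cg Ig|f g cf If cg Ig] b.
- exists (partial b f); first by apply: closure_base; exact: smooth_plane_partial.
  by move=> y Uy; exact: partial_is_derive sf Uy.
- exists (fun y => partial false g (t1 y, t2 y) * partial b t1 y +
    partial true g (t1 y, t2 y) * partial b t2 y).
    apply: closure_add; apply: closure_mul.
    + by apply: (closure_comp (g := partial false g)); exact: smooth_plane_partial.
    + by apply: closure_base; exact: smooth_plane_partial.
    + by apply: (closure_comp (g := partial true g)); exact: smooth_plane_partial.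
    + by apply: closure_base; exact: smooth_plane_partial.
  by move=> y Uy; exact: comp_derive.
- have [f' cf' df] := If b; have [g' cg' dg] := Ig b.
  exists (fun y => f' y + g' y); first exact: closure_add.
  by move=> y Uy; have := df _ Uy; have := dg _ Uy => d1 d2; exact: is_deriveD.
- have [f' cf' df] := If b; have [g' cg' dg] := Ig b.
  exists (fun y => f y * g' y + g y * f' y).
    by apply: closure_add; exact: closure_mul.
  by move=> y Uy; have := df _ Uy; have := dg _ Uy => d1 d2; exact: is_deriveM.
Qed.

Let closure_continuous f : smooth_closure f -> forall y, U y -> {for y, continuous f}.
Proof.
elim=> {f} [f sf|g sg|f g cf If cg Ig|f g cf If cg Ig] y Uy.
- exact: smooth_plane_continuous sf Uy.
- have := smooth_plane_continuous sg (tUV Uy).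
  apply: (@continuous_comp _ _ _ (fun y => (t1 y, t2 y)) g).
  exact: (cvg_pair (smooth_plane_continuous st1 Uy) (smooth_plane_continuous st2 Uy)).
- by apply: continuousD; [exact: If|exact: Ig].
- by apply: continuousM; [exact: If|exact: Ig].
Qed.

Lemma smooth_closure_smooth f : smooth_closure f -> smooth_plane U f.
Proof.
apply: (smooth_plane_coind (C := smooth_closure)) => //.
  move=> h ch y Uy; split; first exact: closure_continuous.
  by move=> b; have [g _ /(_ _ Uy) []] := closure_derive ch b.
move=> h b /closure_derive /(_ b) [g cg dg]; exists g => // y Uy.
by have [] := dg _ Uy.
Qed.

End Closure.

Lemma smooth_plane_comp U V (t1 t2 g : plane -> R) : open U -> open V ->
  smooth_plane U t1 -> smooth_plane U t2 -> (forall y, U y -> V (t1 y, t2 y)) ->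
  smooth_plane V g -> smooth_plane U (fun y => g (t1 y, t2 y)).
Proof.
move=> oU oV s1 s2 UV sg; apply: (smooth_closure_smooth oU oV s1 s2 UV).
exact: closure_comp.
Qed.

(** Constant inner maps make composition trivial and leave sums and products. *)
Let closure0 U f : open U -> smooth_closure U setT (fun=> 0) (fun=> 0) f -> smooth_plane U f.
Proof.
by move=> oU; apply: smooth_closure_smooth => //; [exact: openT|exact: smooth_plane_cst..].
Qed.

Lemma smooth_planeD U f g : open U -> smooth_plane U f -> smooth_plane U g ->
  smooth_plane U (fun y => f y + g y).
Proof. by move=> oU sf sg; apply: closure0 => //; apply: closure_add; exact: closure_base. Qed.

Lemma smooth_planeM U f g : open U -> smooth_plane U f -> smooth_plane U g ->
  smooth_plane U (fun y => f y * g y).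
Proof. by move=> oU sf sg; apply: closure0 => //; apply: closure_mul; exact: closure_base. Qed.

Lemma smooth_planeZ U c f : open U -> smooth_plane U f -> smooth_plane U (fun y => c * f y).
Proof. by move=> oU sf; apply: smooth_planeM => //; exact: smooth_plane_cst. Qed.

Lemma smooth_planeB U f g : open U -> smooth_plane U f -> smooth_plane U g ->
  smooth_plane U (fun y => f y - g y).
Proof.
move=> oU sf sg; have := smooth_planeD oU sf (smooth_planeZ (-1) oU sg).
by apply: smooth_plane_eq => // y _; rewrite mulN1r.
Qed.

Lemma is_derive_fst_comp (phi : R -> R) y d : is_derive y.1 1 phi d ->
  forall b, is_derive y (axis R b) (fun z => phi z.1) (if b then 0 else d).
Proof.
move=> [dphi <-] [].
  have e : (fun h : R => h^-1 *: (((fun z => phi z.1) \o shift y) (h *: axis R true) - phi y.1)) = (fun=> 0).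
    by apply/funext => h /=; rewrite [h *: 0]mulr0 add0r subrr scaler0.
  split; rewrite ?/derivable ?/derive e; first exact: is_cvg_cst.
  exact: lim_cst.
have e : (fun h : R => h^-1 *: (((fun z => phi z.1) \o shift y) (h *: axis R false) - phi y.1)) =
    (fun h : R => h^-1 *: ((phi \o shift y.1) (h *: 1) - phi y.1)) by [].
by split; [rewrite /derivable e|rewrite /derive e].
Qed.

Lemma is_derive_snd_comp (phi : R -> R) y d : is_derive y.2 1 phi d ->
  forall b, is_derive y (axis R b) (fun z => phi z.2) (if b then d else 0).
Proof.
move=> [dphi <-] []; last first.
  have e : (fun h : R => h^-1 *: (((fun z => phi z.2) \o shift y) (h *: axis R false) - phi y.2)) = (fun=> 0).
    by apply/funext => h /=; rewrite [h *: 0]mulr0 add0r subrr scaler0.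
  split; rewrite ?/derivable ?/derive e; first exact: is_cvg_cst.
  exact: lim_cst.
have e : (fun h : R => h^-1 *: (((fun z => phi z.2) \o shift y) (h *: axis R true) - phi y.2)) =
    (fun h : R => h^-1 *: ((phi \o shift y.2) (h *: 1) - phi y.2)) by [].
by split; [rewrite /derivable e|rewrite /derive e].
Qed.

Lemma is_derive_coordinate b b' y :
  is_derive y (axis R b) (coordinate b') (if b == b' then 1 else 0).
Proof.
have i1 (x : R) : is_derive x (1 : R) (@id R) 1 by exact: is_derive_id.
by case: b' b => [] []; [exact: (is_derive_snd_comp (i1 _) true)|exact: (is_derive_snd_comp (i1 _) false)
  |exact: (is_derive_fst_comp (i1 _) true)|exact: (is_derive_fst_comp (i1 _) false)].
Qed.

Lemma smooth_plane_coordinate U b : open U -> smooth_plane U (@coordinate R b).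
Proof.
move=> oU; apply: (smooth_plane_coind
  (C := [set f | f = @coordinate R b \/ exists c, f = fun=> c])) => //.
- move=> f [->|[c ->]] y Uy; split.
  + by case: b; [exact: cvg_snd|exact: cvg_fst].
  + by move=> b'; have [] := is_derive_coordinate b' b y.
  + exact: cvg_cst.
  + by move=> b'; have [] := is_derive_cst_axis c y (axis R b').
- move=> f b' [->|[c ->]].
    exists (fun=> if b' == b then 1 else 0); first by right; eexists.
    by move=> y _; have [] := is_derive_coordinate b' b y.
  exists (fun=> 0); first by right; exists 0.
  by move=> y _; have [] := is_derive_cst_axis c y (axis R b').
- by left.
Qed.

End SmoothPlane.

(** * Flat functions and bumps *)

Section FlatFunction.
Context (R : realType).
Implicit Types (P : {poly R}) (x s : R).

(* This family is closed under differentiation, see [flat_derive]. *)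
Definition flat P x : R := if 0 < x then P.[x^-1] * expR (- x^-1) else 0.

(** A single term of the exponential series: $s^{k+2}/(k+2)! \le e^s$. *)
Lemma pow_expR_le (k : nat) : exists2 K : R, 0 <= K &
  forall s, 0 < s -> s ^+ k * expR (- s) <= K * s ^- 2.
Proof.
exists (k.+2)`!%:R => [//|s s0].
have := expR_ge1Dxn k.+1 (ltW s0) => h.
have {}h : s ^+ k.+2 <= (k.+2)`!%:R * expR s.
  by rewrite mulrC -ler_pdivrMr ?ltr0n ?fact_gt0 //; lra.
rewrite expRN ler_pdivrMr ?expR_gt0 // mulrAC ler_pdivlMr ?exprn_gt0 //.
by rewrite -exprD addn2.
Qed.

(** Applied to each monomial with $s = 1/x$. The order $x^2$ is what makes the difference quotient
    at 0 tend to 0 in [flat_derive]. *)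
Lemma flat_le_sq P : exists2 K : R, 0 <= K & forall x, `|flat P x| <= K * x ^+ 2.
Proof.
pose K (k : nat) := projT1 (cid2 (pow_expR_le k)).
have K0 k : 0 <= K k by rewrite /K; case: cid2.
have HK k s : 0 < s -> s ^+ k * expR (- s) <= K k * s ^- 2.
  by rewrite /K; case: cid2 => a /= _; apply.
exists (\sum_(i < size P) `|P`_i| * K i).
  by apply: sumr_ge0 => i _; rewrite mulr_ge0.
move=> x; rewrite /flat; case: ifPn => x0; last first.
  by rewrite normr0 mulr_ge0 ?sqr_ge0 // sumr_ge0 // => i _; rewrite mulr_ge0.
rewrite horner_coef mulr_suml (le_trans (ler_norm_sum _ _ _)) // mulr_suml.
apply: ler_sum => i _; rewrite -mulrA normrM -mulrA ler_wpM2l //.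
rewrite ger0_norm ?mulr_ge0 ?exprn_ge0 ?invr_ge0 ?expR_ge0 ?(ltW x0) //.
have := HK i x^-1; rewrite invr_gt0 => /(_ x0) h. rewrite (le_trans h) //.
by rewrite exprVn invrK.
Qed.

Lemma flat_derive P x : is_derive x 1 (flat P) (flat ((P - P^`()) * 'X^2) x).
Proof.
have [x0|x0|x0] := ltgtP 0 x.
- have ne : {near x, (fun y => P.[y^-1] * expR (- y^-1)) =1 flat P}.
    by apply: filterS (lt_nbhsr x0) => y y0; rewrite /flat y0.
  apply: near_eq_is_derive ne _.
  have xn0 : x != 0 by rewrite gt_eqF.
  have dP : is_derive (x^-1) (1 : R) (horner P) (P^`()).[x^-1].
    apply: DeriveDef; first exact: derivable_horner.
    by rewrite -derive1E -derivE.
  have dI : is_derive x (1 : R) (fun y : R => y^-1) (- x ^- 2).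
    apply: (is_derive_eq (is_deriveV (f := id) xn0 (is_derive_id x (1 : R)))).
    exact: mulr1.
  have dE (y : R) : is_derive y (1 : R) (@expR R) (expR y) by exact: is_derive_expR.
  have dPI := is_derive1_comp dP dI.
  have dN : is_derive x (1 : R) (fun y : R => - y^-1) (- - x ^- 2) := is_deriveN dI.
  have dEI := is_derive1_comp (g := fun y : R => - y^-1) (dE _) dN.
  apply: (is_derive_eq (is_deriveM dPI dEI)).
  rewrite /flat x0 hornerM hornerD hornerN hornerXn /= !/GRing.scale /= exprVn. ring.
- have ne : {near x, cst 0 =1 flat P}.
    by apply: filterS (lt_nbhsl x0) => y y0; rewrite /flat ltNge ltW.
  apply: near_eq_is_derive ne _.
  by rewrite /flat ltNge (ltW x0) /=; exact: is_derive_cst.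
- rewrite -x0 {2}/flat ltxx.
  have [K K0 HK] := flat_le_sq P.
  have e : flat P 0 = 0 by rewrite /flat ltxx.
  suff H : (h^-1 *: ((flat P \o shift 0) (h *: 1) - flat P 0)) @[h --> (0 : R)^'] --> (0 : R).
    by apply: DeriveDef; [apply/cvg_ex; eexists; exact: H|exact: cvg_lim H].
  apply/cvgrPdist_le => eps eps0; rewrite e.
  have eK : 0 < eps / (K + 1) by rewrite divr_gt0 // ltr_wpDl.
  apply: filterS (dnbhs0_lt eK) => h hlt /=.
  rewrite sub0r normrN subr0 addr0 [h *: 1]mulr1 normrZ normfV.
  have [->|h0] := eqVneq h 0; first by rewrite normr0 invr0 mul0r ltW.
  rewrite mulrC ler_pdivrMr ?normr_gt0 // (le_trans (HK h)) //.
  rewrite -real_normK ?num_real // expr2 mulrA ler_wpM2r //.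
  move: hlt; rewrite ltr_pdivlMr; last by rewrite ltr_wpDl.
  by rewrite mulrDr mulr1 mulrC => hlt; rewrite ltW // (le_lt_trans _ hlt) // lerDl.
Qed.

Lemma smooth_plane_flat U P : open U -> smooth_plane U (fun y : R * R => flat P y.1).
Proof.
move=> oU; apply: (smooth_plane_coind (C := [set f | exists Q, f = fun y : R * R => flat Q y.1])) => //.
- move=> _ [Q ->] y _; split.
    apply: (@continuous_comp _ _ _ fst (flat Q)); first exact: cvg_fst.
    have [d _] := flat_derive Q y.1.
    by apply: differentiable_continuous; exact/derivable1_diffP.
  by move=> b; have [] := is_derive_fst_comp (flat_derive Q y.1) b.
- move=> _ b [Q ->].
  exists (fun y => flat (if b then 0 else (Q - Q^`()) * 'X^2) y.1); first by eexists.
  move=> y _; have [_] := is_derive_fst_comp (flat_derive Q y.1) b.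
  rewrite /partial => ->; case: b => //.
  by rewrite /flat horner0 mul0r; case: ifP.
- by exists P.
Qed.

(** [flat 1] is $e^{-1/t}$ for $t > 0$ and 0 otherwise; the denominator normalises the value at the
    centre to 1. Balls of the plane are squares, so the product of two such factors is supported as
    required. *)
Definition bump_factor (r a x : R) : R := flat 1 (r ^+ 2 - (x - a) ^+ 2) / flat 1 (r ^+ 2).

Definition bump (r : R) (w z : R * R) : R :=
  bump_factor r w.1 z.1 * bump_factor r w.2 z.2.

Lemma flat1_gt0 x : 0 < x -> 0 < flat 1 x.
Proof. by move=> x0; rewrite /flat x0 hornerC mul1r expR_gt0. Qed.

Lemma bump_center r w : 0 < r -> bump r w w = 1.
Proof.
move=> r0; rewrite /bump /bump_factor !subrr expr0n subr0 divff ?mul1r //.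
by rewrite gt_eqF // flat1_gt0 // exprn_gt0.
Qed.

Lemma bump_eq0 r w z : 0 < r -> ~ ball w r z -> bump r w z = 0.
Proof.
move=> r0 nb; rewrite /bump.
have f0 (a x : R) : ~~ (`|a - x| < r) -> bump_factor r a x = 0.
  rewrite -leNgt => le; rewrite /bump_factor /flat.
  rewrite subr_gt0 ltNge -(real_normK (num_real (x - a))) distrC.
  by rewrite ler_pXn2r ?nnegrE ?(ltW r0) // le mul0r.
have [h1|/f0 ->] := boolP (`|w.1 - z.1| < r); last by rewrite mul0r.
have [h2|/f0 ->] := boolP (`|w.2 - z.2| < r); last by rewrite mulr0.
by case: nb; apply/ball_plane.
Qed.

Lemma smooth_plane_bump U r w : open U -> smooth_plane U (bump r w).
Proof.
move=> oU.
have sc b a : smooth_plane U (fun z => bump_factor r a (coordinate b z)).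
  rewrite (_ : (fun z => _) = fun z => (flat 1 (r ^+ 2))^-1 *
      flat 1 (r ^+ 2 - (coordinate b z - a) * (coordinate b z - a))); last first.
    by apply/funext => z; rewrite -expr2 mulrC.
  apply: smooth_planeZ => //.
  have s1 : smooth_plane U (fun z => coordinate b z - a).
    by apply: smooth_planeB => //; [exact: smooth_plane_coordinate|exact: smooth_plane_cst].
  have s2 : smooth_plane U (fun z => r ^+ 2 - (coordinate b z - a) * (coordinate b z - a)).
    by apply: smooth_planeB => //; [exact: smooth_plane_cst|exact: smooth_planeM].
  exact: (smooth_plane_comp oU openT s2 (smooth_plane_cst 0 oU) (fun _ _ => I)
    (smooth_plane_flat 1 openT)).
by apply: smooth_planeM => //; [exact: (sc false)|exact: (sc true)].
Qed.

End FlatFunction.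

(** * Integrals over the unit segment *)

Section UnitSegment.
Context (R : realType).
Local Notation mu := (@lebesgue_measure R).
Implicit Types (k : R -> R) (e : R).

Lemma continuous_pair_cst (T P : topologicalType) (t : T) (p0 : P) :
  {for t, continuous (fun t' : T => (t', p0))}.
Proof. by apply: cvg_pair => /=; [exact: cvg_id|exact: cvg_cst]. Qed.

(** A tube lemma: compactness of the segment makes continuity in the parameter uniform in $t$, which
    justifies limits and derivatives under the integral. *)
Lemma uniform_near_segment (P : topologicalType) (F : R * P -> R) (p0 : P) :
  (forall t, t \in `[0, 1]%R -> {for (t, p0), continuous F}) ->
  forall e, 0 < e ->
  \forall p \near p0, forall t, t \in `[0, 1]%R -> `|F (t, p) - F (t, p0)| < e.
Proof.
move=> H e e0.
have /compact_near_coveringP cov := @segment_compact R 0 1.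
have e2 : 0 < e / 2 by rewrite divr_gt0.
apply: (cov P (nbhs p0) (fun p t => `|F (t, p) - F (t, p0)| < e)) => t t01.
have /cvgrPdist_lt /(_ _ e2) c1 := H t t01.
have ct : (fun t' => F (t', p0)) @ t --> F (t, p0).
  exact: (cvg_comp (fun t' => (t', p0)) F (@continuous_pair_cst _ _ t p0) (H t t01)).
have /cvgrPdist_lt /(_ _ e2) c2 := ct.
(* Both $F(x, p)$ and $F(x, p_0)$ are compared with $F(t, p_0)$, as the covering criterion lets $x$
   vary near $t$. *)
have c2' : \forall x \near t & p \near p0, `|F (t, p0) - F (x, p0)| < e / 2.
  exists ([set x | `|F (t, p0) - F (x, p0)| < e / 2], setT); last by move=> [x p] [] /=.
  by split=> //; exact: filterT.
apply: filterS2 c1 c2' => -[x p] /= h1 h2.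
rewrite -(subrKA (F (t, p0))) (le_lt_trans (ler_normD _ _)) //.
by rewrite distrC in h1; lra.
Qed.

Definition unit_integral k : R := \int[mu]_(t in `[0, 1]%classic) k t.

Definition segment_continuous k := forall t, t \in `[0, 1]%R -> {for t, continuous k}.

Lemma segment_integrable k : segment_continuous k ->
  mu.-integrable `[0, 1]%classic (EFin \o k).
Proof.
move=> ck; apply: continuous_compact_integrable; first exact: segment_compact.
by apply: continuous_in_subspaceT => t; rewrite inE => h; exact: ck.
Qed.

Lemma unit_integral_cst e : unit_integral (fun=> e) = e.
Proof.
have l1 : @lebesgue_measure R `[0, 1]%classic = 1%E.
  by rewrite lebesgue_measure_itv /= lte_fin ltr01 -EFinB subr0.
rewrite /unit_integral Rintegral_cst // -[RHS]mulr1 -[1 in RHS]/(fine 1%E).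
by congr (_ * fine _); exact: l1.
Qed.

Lemma eq_unit_integral k k' : (forall t, t \in `[0, 1]%R -> k t = k' t) ->
  unit_integral k = unit_integral k'.
Proof. by move=> e; apply: eq_Rintegral => t; rewrite inE; exact: e. Qed.

Lemma unit_integralB k k' : segment_continuous k -> segment_continuous k' ->
  unit_integral (fun t => k t - k' t) = unit_integral k - unit_integral k'.
Proof. by move=> ck ck'; apply: RintegralB => //; exact: segment_integrable. Qed.

Lemma unit_integralD k k' : segment_continuous k -> segment_continuous k' ->
  unit_integral (fun t => k t + k' t) = unit_integral k + unit_integral k'.
Proof. by move=> ck ck'; apply: RintegralD => //; exact: segment_integrable. Qed.

Lemma unit_integralZ a k : segment_continuous k ->
  unit_integral (fun t => a * k t) = a * unit_integral k.
Proof. by move=> ck; apply: RintegralZl => //; exact: segment_integrable. Qed.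

Lemma unit_integral_le k e : segment_continuous k ->
  (forall t, t \in `[0, 1]%R -> `|k t| <= e) -> `|unit_integral k| <= e.
Proof.
move=> ck H; have ik := segment_integrable ck.
apply: le_trans (le_normr_Rintegral _ ik) _ => //.
rewrite -[leRHS]unit_integral_cst; apply: le_Rintegral => //.
- exact: integrable_norm ik.
- by apply: segment_integrable => t _; exact: cvg_cst.
Qed.

Lemma unit_FTC (phi dphi : R -> R) :
  (forall t : R, t \in `[0, 1]%R -> is_derive t 1 phi (dphi t)) ->
  segment_continuous dphi ->
  unit_integral dphi = phi 1 - phi 0.
Proof.
move=> D c.
have cphi (t : R) : t \in `[0, 1]%R -> {for t, continuous phi}.
  by move=> /D [d _]; apply: differentiable_continuous; exact/derivable1_diffP.
rewrite /unit_integral /Rintegral (continuous_FTC2 (F := phi)) //.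
- by apply: continuous_in_subspaceT => t; rewrite inE => h; exact: c.
- split.
  + by move=> t /subset_itv_oo_cc /D [].
  + by apply: cvg_within_filter; apply: cphi; rewrite in_itv /= lexx ler01.
  + by apply: cvg_within_filter; apply: cphi; rewrite in_itv /= lexx ler01.
- by move=> t /subset_itv_oo_cc /D [_]; rewrite derive1E.
Qed.

End UnitSegment.

(** * Hadamard's lemma by means over rays *)

Section Hadamard.
Context (R : realType) (z0 : R * R) (r : R).
Implicit Types (f g : R * R -> R) (y z : R * R).
Local Notation plane := (R * R)%type.
Local Notation B := (ball z0 r).

Definition ray (t : R) z : plane :=
  (z0.1 + t * (z.1 - z0.1), z0.2 + t * (z.2 - z0.2)).

Lemma ray1 z : ray 1 z = z.
Proof. by case: z => a b; rewrite /ray /=; congr pair; ring. Qed.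

Lemma ray0 z : ray 0 z = z0.
Proof. by rewrite /ray !mul0r !addr0 -surjective_pairing. Qed.

(* The weights [t ^+ m] make the family of means closed under partial
   derivatives, see [ray_mean_derive]; [m = 0] gives Hadamard's quotients. *)
Definition ray_mean (m : nat) f z : R := unit_integral (fun t => t ^+ m * f (ray t z)).

(** The ball is a square, so the room left in direction [b] is $r$ minus the distance in that
    coordinate, and contracting towards the centre only increases it. The margin is thus uniform in
    $t$. *)
Lemma ray_ball t z (a : R) b : t \in `[0, 1]%R -> B z ->
  `|a| < r - `|coordinate b z0 - coordinate b z| -> B (a *: axis R b + ray t z).
Proof.
rewrite in_itv /= => /andP[t0 t1] /ball_plane[z1 z2] ha.
have le (x y : R) : `|x - (x + t * (y - x))| <= `|x - y|.
  rewrite opprD addrA subrr add0r normrN normrM ger0_norm // distrC.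
  by rewrite -[leRHS]mul1r ler_wpM2r.
have ab (x y : R) : `|x - (a + y)| <= `|x - y| + `|a|.
  by rewrite opprD addrCA addrC; exact: ler_normB.
have h1 := le z0.1 z.1; have h2 := le z0.2 z.2.
case: b ha => /= ha; rewrite ?axis_trueE ?axis_falseE; apply/ball_plane => /=; split.
- exact: le_lt_trans h1 z1.
- rewrite (le_lt_trans (ab _ _)) //; lra.
- rewrite (le_lt_trans (ab _ _)) //; lra.
- exact: le_lt_trans h2 z2.
Qed.

Lemma ray_ball0 t z : t \in `[0, 1]%R -> B z -> B (ray t z).
Proof.
move=> t01 Bz; have := @ray_ball t z 0 false t01 Bz.
by rewrite scale0r add0r; apply; rewrite normr0 subr_gt0; have /ball_plane[] := Bz.
Qed.

Lemma ray_axis t z (h : R) b : ray t (h *: axis R b + z) = (t * h) *: axis R b + ray t z.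
Proof.
by case: b; rewrite ?axis_trueE ?axis_falseE /ray /=; congr pair; ring.
Qed.

Lemma continuous_ray t z : {for (t, z), continuous (fun p : R * plane => ray p.1 p.2)}.
Proof.
have c1 : {for (t, z), continuous (fun p : R * plane => p.1)} by exact: cvg_fst.
have c2 : {for (t, z), continuous (fun p : R * plane => p.2)} by exact: cvg_snd.
have c (a : R) (q : plane -> R) : {for z, continuous q} ->
    {for (t, z), continuous (fun p : R * plane => a + p.1 * (q p.2 - a))}.
  move=> cq; apply: continuousD; first exact: cvg_cst.
  apply: continuousM => //; apply: continuousB; last exact: cvg_cst.
  exact: (cvg_comp _ _ c2 cq).
have f1 : {for z, continuous (fun y : plane => y.1)} by exact: cvg_fst.
have f2 : {for z, continuous (fun y : plane => y.2)} by exact: cvg_snd.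
have d1 := c z0.1 _ f1.
have d2 := c z0.2 _ f2.
exact: (cvg_pair d1 d2).
Qed.

Lemma continuous_ray_integrand m f t z : {for ray t z, continuous f} ->
  {for (t, z), continuous (fun p : R * plane => p.1 ^+ m * f (ray p.1 p.2))}.
Proof.
move=> cf; apply: cvgM.
  have c1 : {for (t, z), continuous (fun p : R * plane => p.1)} by exact: cvg_fst.
  exact: (cvg_comp _ _ c1 (@exprn_continuous _ m t)).
exact: (cvg_comp _ _ (@continuous_ray t z) cf).
Qed.

Lemma segment_continuous_ray m f z : smooth_plane B f -> B z ->
  segment_continuous (fun t => t ^+ m * f (ray t z)).
Proof.
move=> sf Bz t t01.
have cf := smooth_plane_continuous sf (ray_ball0 t01 Bz).
exact: (cvg_comp _ _ (@continuous_pair_cst _ _ t z) (@continuous_ray_integrand m f t z cf)).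
Qed.

Lemma ray_mean_continuous m f z : smooth_plane B f -> B z ->
  {for z, continuous (ray_mean m f)}.
Proof.
move=> sf Bz; apply/cvgrPdist_le => e e0.
have := @uniform_near_segment R _ (fun p : R * plane => p.1 ^+ m * f (ray p.1 p.2)) z _ _ e0.
have Bnear : \forall y \near z, B y by exact: (open_nbhs_nbhs (conj (@ball_open _ _ _ _) Bz)).
move=> /(_ (fun t t01 => continuous_ray_integrand (smooth_plane_continuous sf (ray_ball0 t01 Bz)))).
apply: filterS2 Bnear => y By H.
have cy := segment_continuous_ray (m := m) sf By; have cz := segment_continuous_ray (m := m) sf Bz.
rewrite -unit_integralB //; apply: unit_integral_le.
  by move=> t t01; apply: cvgB; [exact: cz|exact: cy].
by move=> t t01; rewrite distrC ltW //; exact: H.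
Qed.

(** Differentiation under the integral: moving [z] by $h$ moves [ray t z] by $th$, whence one more
    factor $t$. The mean value theorem replaces the quotient by a partial derivative at an
    intermediate point, close to the one on the ray uniformly in $t$. *)
Lemma ray_mean_derive m f z b : smooth_plane B f -> B z ->
  is_derive z (axis R b) (ray_mean m f) (ray_mean m.+1 (partial b f) z).
Proof.
move=> sf Bz; have sdf := smooth_plane_partial b sf.
suff H : (h^-1 *: ((ray_mean m f \o shift z) (h *: axis R b) - ray_mean m f z)) @[h --> (0 : R)^']
    --> ray_mean m.+1 (partial b f) z.
  by apply: DeriveDef; [apply/cvg_ex; eexists; exact: H|exact: cvg_lim H].
apply/cvgrPdist_le => e e0.
have eta0 : 0 < r - `|coordinate b z0 - coordinate b z|.
  by rewrite subr_gt0; have /ball_plane[] := Bz; case: b {sdf}.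
pose F (p : R * R) := partial b f (p.2 *: axis R b + ray p.1 z).
have cF t : t \in `[0, 1]%R -> {for (t, 0), continuous F}.
  have c1 : {for (t, 0), continuous (fun p : R * R => p.1)} by exact: cvg_fst.
  have c2 : {for (t, 0), continuous (fun p : R * R => p.2)} by exact: cvg_snd.
  move=> t01; apply: (@continuous_comp _ _ _
    (fun p : R * R => p.2 *: axis R b + ray p.1 z) (partial b f)).
    apply: cvgD.
      exact: (cvgZr_tmp c2).
    exact: (cvg_comp _ _ (cvg_pair c1 (cvg_cst z)) (@continuous_ray t z)).
  by rewrite /= scale0r add0r; exact: smooth_plane_continuous sdf (ray_ball0 t01 Bz).
have /nbhs_ballP[d /= d0 Hd] := uniform_near_segment cF e0.
(* The first bound is for uniformity in $t$, the second keeps the displaced rays inside the ball. *)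
have md : 0 < Num.min d (r - `|coordinate b z0 - coordinate b z|) by rewrite lt_min d0.
apply: filterS2 (dnbhs0_lt md) (nbhs_dnbhs_neq (0 : R)) => h; rewrite lt_min => /andP[hd heta] h0.
have Bh : B (h *: axis R b + z).
  have := @ray_ball 1 z h b; rewrite in_itv /= ler01 lexx => /(_ isT Bz heta).
  by rewrite ray1.
have cz := segment_continuous_ray (m := m) sf Bz; have ch := segment_continuous_ray (m := m) sf Bh.
have cd := segment_continuous_ray (m := m.+1) sdf Bz.
have cBz : segment_continuous (fun t => t ^+ m * f (ray t (h *: axis R b + z)) - t ^+ m * f (ray t z)).
  by move=> t t01; apply: cvgB; [exact: ch|exact: cz].
have cZ : segment_continuous (fun t => h^-1 *
    (t ^+ m * f (ray t (h *: axis R b + z)) - t ^+ m * f (ray t z))).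
  by move=> t t01; apply: cvgM; [exact: cvg_cst|exact: cBz].
rewrite distrC [_ *: _](_ : _ = unit_integral (fun t => h^-1 *
    (t ^+ m * f (ray t (h *: axis R b + z)) - t ^+ m * f (ray t z)))); last first.
  by rewrite unit_integralZ // unit_integralB.
rewrite -unit_integralB //; apply: unit_integral_le.
  by move=> t t01; apply: cvgB; [exact: cZ|exact: cd].
move=> t t01; have /andP[t0 t1] : 0 <= t <= 1 by move: t01; rewrite in_itv.
have thh : `|t * h| <= `|h|.
  by rewrite normrM ger0_norm // -[leRHS]mul1r ler_wpM2r.
have [s hs|s hs] := @directional_MVT R _ f (axis R b) (ray t z) (t * h).
  apply: smooth_plane_derivable sf _; apply: ray_ball => //.
  by rewrite (le_lt_trans hs) // (le_lt_trans thh).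
rewrite -ray_axis => E.
rewrite -mulrBr E exprS.
rewrite (_ : _ - _ = t * t ^+ m *
    (partial b f (s *: axis R b + ray t z) - partial b f (ray t z))); last first.
  by rewrite /partial; field.
have sd : ball 0 d s by rewrite /ball /= sub0r normrN (le_lt_trans hs) // (le_lt_trans thh).
have := Hd _ sd _ t01; rewrite /F /= scale0r add0r => lt.
have tm0 : 0 <= t * t ^+ m by rewrite mulr_ge0 ?exprn_ge0.
have tm1 : t * t ^+ m <= 1 by rewrite mulr_ile1 ?exprn_ge0 ?exprn_ile1.
by rewrite normrM ger0_norm // -[leRHS]mul1r ler_pM // ltW.
Qed.

Lemma smooth_ray_mean m f : smooth_plane B f -> smooth_plane B (ray_mean m f).
Proof.
move=> sf.
apply: (smooth_plane_coind (C := [set g | exists m f, smooth_plane B f /\ g = ray_mean m f])).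
- exact: ball_open.
- move=> _ [k [h [sh ->]]] y By; split; first exact: ray_mean_continuous.
  by move=> b; have [] := ray_mean_derive k b sh By.
- move=> _ b [k [h [sh ->]]]; exists (ray_mean k.+1 (partial b h)).
    by exists k.+1, (partial b h); split=> //; exact: smooth_plane_partial.
  by move=> y By; have [] := ray_mean_derive k b sh By.
- by exists m, f.
Qed.

(** The derivative of $t \mapsto f(z_0 + t(z - z_0))$ is integrated over the segment. The resulting
    quotients are means of the partial derivatives, hence smooth up to and including $z_0$. *)
Lemma hadamard f : 0 < r -> smooth_plane B f -> exists g : bool -> plane -> R,
  [/\ forall b, smooth_plane B (g b), forall b, g b z0 = partial b f z0 &
      forall z, B z -> f z - f z0 =
        (z.1 - z0.1) * g false z + (z.2 - z0.2) * g true z].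
Proof.
move=> r0 sf; exists (fun b => ray_mean 0 (partial b f)); split.
- by move=> b; apply: smooth_ray_mean; exact: smooth_plane_partial.
- move=> b; rewrite /ray_mean -[RHS]unit_integral_cst; apply: eq_unit_integral => t _.
  by rewrite mul1r /ray !subrr !mulr0 !addr0 -surjective_pairing.
move=> z Bz.
have cb b := segment_continuous_ray (m := 0) (smooth_plane_partial b sf) Bz.
have cbZ (a : R) b : segment_continuous (fun t => a * (t ^+ 0 * partial b f (ray t z))).
  by move=> t t01; apply: cvgM; [exact: cvg_cst|exact: cb].
rewrite /ray_mean -!unit_integralZ // -unit_integralD //.
rewrite (_ : f z - f z0 = f (ray 1 z) - f (ray 0 z)); last first.
  by rewrite ray1 ray0.
symmetry; apply: (unit_FTC (phi := fun t => f (ray t z))).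
  move=> t t01; have Bt := ray_ball0 t01 Bz.
  have dt (a c : R) : is_derive t (1 : R) (fun t => a + t * c) c.
    have d1 := is_deriveM (is_derive_id t (1 : R)) (is_derive_cst c t (1 : R)).
    apply: (is_derive_eq (is_deriveD (is_derive_cst a t (1 : R)) d1)).
    by rewrite add0r scaler0 add0r; exact: mulr1.
  have Bnear : \forall y \near ray t z, B y by exact: (open_nbhs_nbhs (conj (@ball_open _ _ _ _) Bt)).
  apply: (is_derive_eq (is_derive_comp_plane (g := f)
    (dt z0.1 (z.1 - z0.1)) (dt z0.2 (z.2 - z0.2)) _ _)).
  - by apply: filterS Bnear => y By b; exact: smooth_plane_derivable sf By.
  - by move=> b; exact: smooth_plane_continuous (smooth_plane_partial b sf) Bt.
  - by rewrite expr0 !mul1r !(mulrC (partial _ _ _)).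
by move=> t t01; apply: cvgD; exact: cbZ.
Qed.

End Hadamard.

(** * Smooth functions and tangent vectors on a surface *)

Section SmoothFunctions.
Context (R : realType) (M : topologicalType) (S : smooth_surface R M).
Implicit Types (c d : chart R M) (phi psi : M -> R) (q p : M) (W : set M).
Local Notation plane := (R * R)%type.

Lemma cof_preimage_open c W : open W -> open (cimg c `&` cof c @^-1` W).
Proof.
move=> oW; rewrite openE => y [cy Wy].
have n1 : nbhs y (cimg c) := open_nbhs_nbhs (conj (@cimg_open _ _ c) cy).
exact: (filterI n1 (cof_cts cy (open_nbhs_nbhs (conj oW Wy)))).
Qed.

Lemma cto_preimage_open c (V : set plane) : open V -> open (cdom c `&` cto c @^-1` V).
Proof.
move=> oV; rewrite openE => q [cq Vq].
have n1 : nbhs q (cdom c) := open_nbhs_nbhs (conj (@cdom_open _ _ c) cq).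
exact: (filterI n1 (cto_cts cq (open_nbhs_nbhs (conj oV Vq)))).
Qed.

Arguments cof_preimage_open c {W}.
Arguments cto_preimage_open c {V}.

Lemma smooth_on_continuous W phi q : smooth_on S W phi -> W q -> {for q, continuous phi}.
Proof.
move=> sphi Wq; have [c [Ac cq]] := atlas_cover S q.
have Uy : (cimg c `&` cof c @^-1` W) (cto c q).
  by split; [exact: cto_img|rewrite /= cto_K].
have cphi := smooth_plane_continuous (sphi c Ac) Uy.
have e : {near q, (phi \o cof c) \o cto c =1 phi}.
  by apply: filterS (open_nbhs_nbhs (conj (@cdom_open _ _ c) cq)) => p cp /=; rewrite cto_K.
apply: (cvg_trans (near_eq_cvg e)).
have -> : phi q = ((phi \o cof c) \o cto c) q by rewrite /= cto_K.
exact: (continuous_comp (cto_cts cq) cphi).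
Qed.

Lemma smooth_on_local W phi :
  (forall q, W q -> exists2 V : set M, V q & smooth_on S V phi) -> smooth_on S W phi.
Proof.
move=> H c Ac; apply: smooth_plane_local => y [cy Wy].
have [V Vy sV] := H _ Wy; exists (cimg c `&` cof c @^-1` V) => //.
exact: sV.
Qed.

Lemma smooth_on_eq W phi psi : open W -> (forall q, W q -> phi q = psi q) ->
  smooth_on S W phi -> smooth_on S W psi.
Proof.
move=> oW e sphi c Ac; apply: smooth_plane_eq (sphi c Ac); first exact: cof_preimage_open.
by move=> y [_ Wy]; exact: e.
Qed.

Lemma smooth_on_sub W V phi : V `<=` W -> smooth_on S W phi -> smooth_on S V phi.
Proof.
by move=> VW sphi c Ac; apply: smooth_plane_sub (sphi c Ac) => y [cy Vy]; split=> //; exact: VW.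
Qed.

Lemma smooth_on_cst W (a : R) : open W -> smooth_on S W (fun=> a).
Proof. by move=> oW c Ac; apply: smooth_plane_cst; exact: cof_preimage_open. Qed.

Lemma smooth_onD W phi psi : open W -> smooth_on S W phi -> smooth_on S W psi ->
  smooth_on S W (fun q => phi q + psi q).
Proof.
move=> oW s1 s2 c Ac.
exact: (smooth_planeD (cof_preimage_open c oW) (s1 c Ac) (s2 c Ac)).
Qed.

Lemma smooth_onM W phi psi : open W -> smooth_on S W phi -> smooth_on S W psi ->
  smooth_on S W (fun q => phi q * psi q).
Proof.
move=> oW s1 s2 c Ac.
exact: (smooth_planeM (cof_preimage_open c oW) (s1 c Ac) (s2 c Ac)).
Qed.

Lemma smooth_cst (a : R) : smooth S (fun=> a).
Proof. exact: smooth_on_cst openT. Qed.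

Lemma smoothD phi psi : smooth S phi -> smooth S psi -> smooth S (fun q => phi q + psi q).
Proof. exact: smooth_onD openT. Qed.

Lemma smoothM phi psi : smooth S phi -> smooth S psi -> smooth S (fun q => phi q * psi q).
Proof. exact: smooth_onM openT. Qed.

Definition chart_extension c (g : plane -> R) : M -> R :=
  fun p => if `[< cdom c p >] then g (cto c p) else 0.

Lemma chart_extension_cof c g y : cimg c y -> chart_extension c g (cof c y) = g y.
Proof. by move=> cy; rewrite /chart_extension asboolT ?cof_K //; exact: cof_dom. Qed.

Lemma chart_extension_cto c g q : cdom c q -> chart_extension c g q = g (cto c q).
Proof. by move=> cq; rewrite /chart_extension asboolT. Qed.

Lemma compact_box (w : plane) (r : R) :
  compact [set z : plane | `|w.1 - z.1| <= r /\ `|w.2 - z.2| <= r].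
Proof.
rewrite (_ : [set _ | _] = `[w.1 - r, w.1 + r]%classic `*` `[w.2 - r, w.2 + r]%classic).
  by apply: compact_setX; exact: segment_compact.
apply/seteqP; split=> -[x y] /=; rewrite !in_itv /= !ler_norml.
  by move=> [/andP[h1 h2] /andP[h3 h4]]; split; apply/andP; split; lra.
by move=> [/andP[h1 h2] /andP[h3 h4]]; split; apply/andP; split; lra.
Qed.

(* The support of [chart_extension c g] lies in the image of a closed box,
   which is closed in [M] because [M] is separated. *)
Lemma smooth_chart_extension c (w : plane) (r : R) g : atlas S c -> 0 < r ->
  ball w (2 * r) `<=` cimg c -> smooth_plane (ball w (2 * r)) g ->
  (forall z, ~ ball w r z -> g z = 0) -> smooth S (chart_extension c g).
Proof.
move=> Ac r0 Bc sg g0.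
pose K := cof c @` [set z : plane | `|w.1 - z.1| <= r /\ `|w.2 - z.2| <= r].
have KB : [set z : plane | `|w.1 - z.1| <= r /\ `|w.2 - z.2| <= r] `<=` ball w (2 * r).
  by move=> z /= [h1 h2]; apply/ball_plane; split; lra.
have oV1 := cto_preimage_open c (@ball_open _ _ w (2 * r)).
have cK : closed K.
  apply: compact_closed; first exact: surface_hausdorff S.
  apply: continuous_compact; last exact: compact_box.
  by apply: continuous_in_subspaceT => z; rewrite inE => /KB /Bc; exact: cof_cts.
apply: smooth_on_local => q _.
(* Two open sets cover the surface: the chart domain over the doubled ball, where [g] is smooth, and
   the complement of [K], where the extension vanishes. *)
have [V1q|V1q] := pselect ((cdom c `&` cto c @^-1` ball w (2 * r)) q).
  exists (cdom c `&` cto c @^-1` ball w (2 * r)) => // d Ad.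
  have oU := cof_preimage_open d oV1.
  have sub : cimg d `&` cof d @^-1` (cdom c `&` cto c @^-1` ball w (2 * r)) `<=` overlap d c.
    by move=> y [dy [cy _]].
  have st b : smooth_plane (cimg d `&` cof d @^-1` (cdom c `&` cto c @^-1` ball w (2 * r)))
      (coordinate b \o transition d c).
    by apply: smooth_plane_sub sub _; exact: atlas_smooth Ad Ac b.
  have := smooth_plane_comp oU (@ball_open _ _ w (2 * r)) (st false) (st true) _ sg.
  move=> /(_ (fun y Hy => Hy.2.2)); apply: smooth_plane_eq => // y [dy [cy _]].
  by rewrite /= chart_extension_cto // -surjective_pairing.
exists (~` K); last first.
  apply: (smooth_on_eq (phi := fun=> 0)); [exact: closed_openC| |].
    move=> p Kp; rewrite /chart_extension; case: asboolP => // cp.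
    rewrite g0 // => /ball_plane[h1 h2]; apply: Kp; exists (cto c p); last exact: cto_K.
    by split=> /=; exact: ltW.
  by apply: smooth_on_cst; exact: closed_openC.
move=> [z /KB Bz zq]; apply: V1q; rewrite -zq; have cz := Bc _ Bz.
by split; [exact: cof_dom|rewrite /= cof_K].
Qed.

(** The factor 2 separates the support of a bump of radius [r] from the edge of the region where
    functions are controlled. *)
Lemma small_box c W q : cdom c q -> open W -> W q ->
  exists2 r : R, 0 < r & ball (cto c q) (2 * r) `<=` cimg c `&` cof c @^-1` W.
Proof.
move=> cq oW Wq.
have Uq : (cimg c `&` cof c @^-1` W) (cto c q).
  by split; [exact: cto_img|rewrite /= cto_K].
have := open_nbhs_nbhs (conj (cof_preimage_open c oW) Uq).
move=> /nbhs_ballP[e /= e0 He]; exists (e / 2); first by rewrite divr_gt0.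
by rewrite mulrC divfK.
Qed.

Lemma smooth_bump q W : open W -> W q -> exists chi : M -> R,
  [/\ smooth S chi, chi q = 1 & forall p, ~ W p -> chi p = 0].
Proof.
move=> oW Wq; have [c [Ac cq]] := atlas_cover S q.
have [r r0 Hr] := small_box cq oW Wq.
have r2 : r < 2 * r by lra.
exists (chart_extension c (bump r (cto c q))); split.
- apply: (@smooth_chart_extension c (cto c q) r) => //.
  + by move=> z /Hr [].
  + by apply: smooth_plane_bump; exact: ball_open.
  + by move=> z; exact: bump_eq0.
- by rewrite chart_extension_cto // bump_center.
- move=> p Wp; rewrite /chart_extension; case: asboolP => // cp.
  rewrite bump_eq0 // => Bp; apply: Wp.
  have /Hr [_] : ball (cto c q) (2 * r) (cto c p) by exact: le_ball (ltW r2) _ Bp.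
  by rewrite /= cto_K.
Qed.

Lemma smooth_in_chart phi c : smooth S phi -> atlas S c -> smooth_plane (cimg c) (phi \o cof c).
Proof.
by move=> sphi Ac; apply: smooth_plane_sub (sphi c Ac) => y cy; split.
Qed.

End SmoothFunctions.

(** * Derivations at a point and the coordinate vectors *)

Section TangentVectors.
(* Keeps the closing tactics from unfolding smoothness goals. *)
Local Opaque smooth smooth_plane.
Context (R : realType) (M : topologicalType) (S : smooth_surface R M).
Implicit Types (c : chart R M) (phi psi : M -> R) (q p : M) (v : functional R M).
Local Notation plane := (R * R)%type.

Lemma tangent_add q v phi psi : tangent S q v -> smooth S phi -> smooth S psi ->
  v (fun p => phi p + psi p) = v phi + v psi.
Proof.
move=> [L _ _] s1 s2; have := L 1 phi psi s1 s2; rewrite mul1r => <-.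
by congr v; apply/funext => p; rewrite mul1r.
Qed.

Lemma tangent0 q v : tangent S q v -> v (fun=> 0) = 0.
Proof.
move=> tv; have s0 := @smooth_cst _ _ S 0.
have := tangent_add tv s0 s0.
rewrite (_ : (fun _ : M => 0 + 0) = fun=> 0); last by apply/funext => p; rewrite addr0.
lra.
Qed.

Lemma tangent_scale q v a phi : tangent S q v -> smooth S phi ->
  v (fun p => a * phi p) = a * v phi.
Proof.
move=> tv sphi; have [L _ _] := tv.
rewrite -[RHS]addr0 -(tangent0 tv) -(L a phi (fun=> 0) sphi (smooth_cst 0)).
by congr v; apply/funext => p; rewrite addr0.
Qed.

Lemma tangent_cst q v a : tangent S q v -> v (fun=> a) = 0.
Proof.
move=> tv; have [_ L _] := tv; have s1 := @smooth_cst _ _ S 1.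
have h : v (fun=> 1) = 0.
  have := L _ _ s1 s1.
  rewrite (_ : (fun _ : M => 1 * 1) = fun=> 1); last by apply/funext => p; rewrite mul1r.
  lra.
rewrite (_ : (fun _ : M => a) = fun p => a * (fun=> 1) p).
  by rewrite (tangent_scale _ tv s1) h mulr0.
by apply/funext => p; rewrite mulr1.
Qed.

Lemma tangent_opp q v phi : tangent S q v -> smooth S phi ->
  v (fun p => - phi p) = - v phi.
Proof.
move=> tv sphi; rewrite -mulN1r -(tangent_scale _ tv) //.
by congr v; apply/funext => p; rewrite mulN1r.
Qed.

Lemma smoothN phi : smooth S phi -> smooth S (fun p => - phi p).
Proof.
move=> sphi; rewrite (_ : (fun p => _) = fun p => (fun=> (-1)) p * phi p).
  exact: (smoothM (smooth_cst (- 1)) sphi).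
by apply/funext => p; rewrite mulN1r.
Qed.

(** For a bump $\chi$ supported in [W] with $\chi(q) = 1$, the product $\chi(\varphi - \psi)$ is
    identically 0, and Leibniz at [q] reduces its derivative to $v(\varphi - \psi)$. *)
Lemma tangent_local q v phi psi (W : set M) : tangent S q v ->
  smooth S phi -> smooth S psi -> open W -> W q ->
  (forall p, W p -> phi p = psi p) -> v phi = v psi.
Proof.
move=> tv s1 s2 oW Wq e.
have [chi [schi chi1 chi0]] := @smooth_bump _ _ S _ _ oW Wq.
have sN := smoothN s2; have sd := smoothD s1 sN.
have : v (fun p => chi p * (phi p - psi p)) = 0.
  rewrite -(tangent0 tv); congr v; apply/funext => p.
  by have [/e ->|/chi0 ->] := pselect (W p); rewrite ?subrr ?mulr0 ?mul0r.
have [_ L _] := tv; rewrite L // chi1 mul1r (e q Wq) subrr mul0r addr0.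
by rewrite (tangent_add tv) // (tangent_opp tv) // => /eqP; rewrite subr_eq0 => /eqP.
Qed.

(** Centred and cut off, the coordinates extend to smooth functions on the whole surface, dual to
    the coordinate vectors. *)
Definition local_coordinate (w : plane) (r : R) (b : bool) : plane -> R :=
  fun z => (coordinate b z - coordinate b w) * bump r w z.

Lemma smooth_local_coordinate w r b U : open U -> smooth_plane U (local_coordinate w r b).
Proof.
move=> oU; apply: smooth_planeM => //; last exact: smooth_plane_bump.
by apply: smooth_planeB => //; [exact: smooth_plane_coordinate|exact: smooth_plane_cst].
Qed.

Lemma coord_vector_extension c w r b b' q : atlas S c -> cdom c q -> w = cto c q -> 0 < r ->
  ball w (2 * r) `<=` cimg c ->
  smooth S (chart_extension c (local_coordinate w r b)) /\
  coord_vector S c b' q (chart_extension c (local_coordinate w r b)) =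
    if b' == b then 1 else 0.
Proof.
move=> Ac cq wE r0 Hr.
have sx : smooth S (chart_extension c (local_coordinate w r b)).
  apply: (smooth_chart_extension Ac r0 Hr (smooth_local_coordinate w r b (@ball_open _ _ _ _))).
  by move=> z nz; rewrite /local_coordinate bump_eq0 // mulr0.
split=> //; rewrite /coord_vector asboolT // -wE.
have cw : cimg c w by rewrite wE; exact: cto_img.
rewrite (@partial_near _ _ _ (local_coordinate w r b)); last first.
  by apply: filterS (open_nbhs_nbhs (conj (@cimg_open _ _ c) cw)) => y; exact: chart_extension_cof.
have sb := smooth_plane_bump r w (@openT plane).
have d1 := partial_is_derive b' sb (I : setT w).
have d2 := is_deriveB (is_derive_coordinate b' b w) (is_derive_cst_axis (coordinate b w) w (axis R b')).
have [_] := is_deriveM d2 d1.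
rewrite /partial => ->.
rewrite bump_center // subr0 scale1r.
have -> : (coordinate b - (fun=> coordinate b w)) w = 0 by exact: subrr.
by rewrite scale0r add0r.
Qed.

(** Hadamard's lemma writes $\varphi - \varphi(q)$ near [q] as $\sum_b x_b g_b$ with $x_b(q) = 0$,
    so Leibniz leaves $\sum_b g_b(q)\, v(x_b)$, and $g_b(q)$ is the partial derivative of
    $\varphi$. *)
Lemma tangent_coord_vectors q v c : tangent S q v -> atlas S c -> cdom c q ->
  exists a : plane, v = a.1 *: coord_vector S c false q + a.2 *: coord_vector S c true q.
Proof.
move=> tv Ac cq; have [r r0 Hr] := small_box cq openT (I : setT q).
set w := cto c q in Hr.
have {}Hr : ball w (2 * r) `<=` cimg c by move=> z /Hr [].
pose xi b := chart_extension c (local_coordinate w r b).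
have sxi b : smooth S (xi b).
  by have [] := coord_vector_extension b false Ac cq erefl r0 Hr.
have [_ L V0] := tv.
have ev (u u' : functional R M) k k' x : (k *: u + k' *: u') x = k * u x + k' * u' x by [].
exists (v (xi false), v (xi true)); apply/funext => phi.
have [sphi|nphi] := pselect (smooth S phi); last first.
  by rewrite V0 // ev /coord_vector asboolF // !mulr0 addr0.
have bw : ball w (2 * r) w by apply: ballxx; lra.
have sf : smooth_plane (ball w (2 * r)) (phi \o cof c).
  exact: (smooth_plane_sub Hr (smooth_in_chart sphi Ac)).
have r20 : 0 < 2 * r by lra.
have [g [sg gw Hg]] := hadamard r20 sf.
pose gam b := chart_extension c (fun z => g b z * bump r w z).
have sB : smooth_plane (ball w (2 * r)) (bump r w).
  by apply: smooth_plane_bump; exact: ball_open.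
have sgam b : smooth S (gam b).
  apply: (smooth_chart_extension Ac r0 Hr (smooth_planeM (@ball_open _ _ _ _) (sg b) sB)).
  by move=> z nz; rewrite bump_eq0 // mulr0.
pose chi := chart_extension c (bump r w).
have schi : smooth S chi.
  by apply: (smooth_chart_extension Ac r0 Hr sB) => z; exact: bump_eq0.
have chiq : chi q = 1 by rewrite /chi chart_extension_cto // bump_center.
pose A := fun p => phi p + (fun=> - phi q) p.
have sA : smooth S A := smoothD sphi (smooth_cst (- phi q)).
have Aq : A q = 0 by rewrite /A subrr.
have vA : v A = v phi.
  by rewrite /A (tangent_add tv sphi (smooth_cst _)) (tangent_cst _ tv) addr0.
have sAc := smoothM sA schi.
(* The cut-off enters squared because both factors [xi b] and [gam b] in [e2] carry a bump. *)
have e1 : v (fun p => (A p * chi p) * chi p) = v phi.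
  rewrite (L _ _ sAc schi) Aq chiq !mul0r add0r mul1r.
  by rewrite (L _ _ sA schi) Aq chiq mul0r add0r mul1r.
have e2 : (fun p => (A p * chi p) * chi p) =
    (fun p => xi false p * gam false p + xi true p * gam true p).
  apply/funext => p; rewrite /chi /xi /gam /chart_extension.
  case: asboolP => cp; last by rewrite !mulr0 addr0.
  have [Bp|nB] := pselect (ball w r (cto c p)); last first.
    by rewrite /local_coordinate bump_eq0 // !mulr0 addr0.
  have rr : r <= 2 * r by lra.
  have := Hg (cto c p) (le_ball rr Bp).
  rewrite /= cto_K // {1}/w cto_K // /A /local_coordinate /= => ->; ring.
rewrite -e1 e2 (tangent_add tv (smoothM (sxi false) (sgam false)) (smoothM (sxi true) (sgam true))).
rewrite (L _ _ (sxi false) (sgam false)) (L _ _ (sxi true) (sgam true)).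
have xiq b : xi b q = 0.
  by rewrite /xi chart_extension_cto // /local_coordinate /w subrr mul0r.
have gamq b : gam b q = partial b (phi \o cof c) w.
  by rewrite /gam chart_extension_cto // bump_center // mulr1 gw.
rewrite !xiq !gamq !mul0r !add0r ev /coord_vector asboolT //.
by congr (_ + _); exact: mulrC.
Qed.

Lemma coord_vectors_free q c (a a' : plane) : atlas S c -> cdom c q ->
  a.1 *: coord_vector S c false q + a.2 *: coord_vector S c true q =
  a'.1 *: coord_vector S c false q + a'.2 *: coord_vector S c true q -> a = a'.
Proof.
move=> Ac cq e; have [r r0 Hr] := small_box cq openT (I : setT q).
have {}Hr : ball (cto c q) (2 * r) `<=` cimg c by move=> z /Hr [].
have X b b' := (coord_vector_extension b b' Ac cq erefl r0 Hr).2.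
have ev (u u' : functional R M) k k' x : (k *: u + k' *: u') x = k * u x + k' * u' x by [].
have e1 := congr1 (fun u => u (chart_extension c (local_coordinate (cto c q) r false))) e.
have e2 := congr1 (fun u => u (chart_extension c (local_coordinate (cto c q) r true))) e.
move: e1 e2; rewrite !ev !X /= !mulr1 !mulr0 !addr0 !add0r.
by case: a a' {e} => [a b] [a' b'] /= -> ->.
Qed.

End TangentVectors.

(** * The Laplacian off the singular set *)

Section TwoVectors.
Context (R : realType) (V : lmodType R).
Implicit Types (v b x : V).

Definition free2 v0 v1 := forall a b : R, a *: v0 + b *: v1 = 0 -> a = 0 /\ b = 0.

Lemma combine2 (k l p0 q0 p1 q1 : R) b0 b1 :
  k *: (p0 *: b0 + q0 *: b1) + l *: (p1 *: b0 + q1 *: b1) =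
  (k * p0 + l * p1) *: b0 + (k * q0 + l * q1) *: b1.
Proof. by rewrite !scalerDr !scalerA addrACA -!scalerDl. Qed.

(** Cramer's rule. If the determinant vanished, the relations with coefficients $(q_1, -q_0)$ and
    $(-p_1, p_0)$ would force all four entries to be 0, and then $(1, 0)$ would be a nontrivial
    relation. *)
Lemma free2_span (p0 q0 p1 q1 s t : R) b0 b1 :
  free2 (p0 *: b0 + q0 *: b1) (p1 *: b0 + q1 *: b1) ->
  exists k l : R, s *: b0 + t *: b1 =
    k *: (p0 *: b0 + q0 *: b1) + l *: (p1 *: b0 + q1 *: b1).
Proof.
move=> fr; pose D := p0 * q1 - p1 * q0.
have [D0|D0] := eqVneq D 0.
  have [] := fr q1 (- q0).
    rewrite combine2 (_ : q1 * p0 + - q0 * p1 = D); last by rewrite /D; ring.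
    rewrite (_ : q1 * q0 + - q0 * q1 = 0); last by ring.
    by rewrite D0 !scale0r addr0.
  move=> q10 /eqP; rewrite oppr_eq0 => /eqP q00.
  have [] := fr (- p1) p0.
    rewrite combine2 (_ : - p1 * p0 + p0 * p1 = 0); last by ring.
    rewrite (_ : - p1 * q0 + p0 * q1 = D); last by rewrite /D; ring.
    by rewrite D0 !scale0r addr0.
  move=> /eqP; rewrite oppr_eq0 => /eqP p10 p00.
  have [] := fr 1 0; first by rewrite p00 q00 p10 q10 combine2 !mulr0 addr0 !scale0r addr0.
  by move/eqP; rewrite oner_eq0.
exists ((s * q1 - t * p1) / D), ((t * p0 - s * q0) / D).
by rewrite combine2; congr (_ *: _ + _ *: _); move: D0; rewrite /D => D0; field.
Qed.

Lemma free2_pair v0 v1 : ~ (exists a : 'I_2 -> R, (exists i, a i != 0) /\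
    \sum_(i < 2) a i *: (if i == ord0 then v0 else v1) = 0) -> free2 v0 v1.
Proof.
move=> H a b ab; apply: contrapT => nab; apply: H.
exists (fun i => if i == ord0 then a else b); split.
  have [a0|a0] := eqVneq a 0; last by exists ord0; rewrite eqxx.
  exists (lift ord0 ord0) => /=; apply/negP => /eqP b0; exact: nab.
by rewrite !big_ord_recl big_ord0 addr0 /=.
Qed.

End TwoVectors.

Section AnchorOffSingularSet.
Context (R : realType) (M : topologicalType) (S : smooth_surface R M) (A : ars S).
Implicit Types (q : M) (v w : functional R M) (phi psi : M -> R).
Local Notation fibre q := (fib (abundle A) q).

Lemma trivV_basis (i : tindex (abundle A)) q (e : fibre q) : tdom i q ->
  e = (triv i q e).1 *: trivV i q (1, 0) + (triv i q e).2 *: trivV i q (0, 1).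
Proof.
move=> iq; apply: (can_inj (trivK iq)).
rewrite linearD !linearZ !(trivVK iq).
case: (triv i q e) => a b; congr pair => /=.
  by rewrite -[_ *: (0 : R)]/(_ * 0) mulr0 addr0; exact/esym/mulr1.
by rewrite -[_ *: (0 : R)]/(_ * 0) mulr0 add0r; exact/esym/mulr1.
Qed.

Lemma regular_sections q : ~ singular_set A q ->
  exists s0 s1 : forall p, fibre p, [/\ smooth_section s0, smooth_section s1 &
    free2 (anchor A q (s0 q)) (anchor A q (s1 q))].
Proof.
rewrite /singular_set /= /dim_lt => /existsNP[w /not_implyP[Hw nw]].
have Hs i : exists2 s : forall p, fibre p, smooth_section s & w i = anchor A q (s q).
  by have [X [s ss ->] <-] := Hw i; exists s.
have [s0 ss0 e0] := Hs ord0; have [s1 ss1 e1] := Hs (lift ord0 ord0).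
exists s0, s1; split=> //; apply: free2_pair => -[a [ai sa]]; apply: nw.
exists a; split=> //; apply: etrans sa.
by rewrite !big_ord_recl !big_ord0 /= e0 e1.
Qed.

Section Regular.
Variables (q : M) (rq : ~ singular_set A q).

(* Two independent horizontal vectors span the tangent space, because the latter
   is spanned by the two coordinate vectors. *)
Lemma anchor_onto v : tangent S q v -> exists e : fibre q, anchor A q e = v.
Proof.
move=> tv; have [c [Ac cq]] := atlas_cover S q.
have [s0 [s1 [_ _ fr]]] := regular_sections rq.
have [a e0] := tangent_coord_vectors (anchor_tangent (s0 q)) Ac cq.
have [b e1] := tangent_coord_vectors (anchor_tangent (s1 q)) Ac cq.
have [k ek] := tangent_coord_vectors tv Ac cq.
move: fr; rewrite e0 e1 => /(free2_span k.1 k.2) [x [y]].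
rewrite -ek -e0 -e1 => ->; exists (x *: s0 q + y *: s1 q).
by rewrite linearD !linearZ.
Qed.

(** Two sections with independent images are independent in the fibre, hence span it, as it has rank
    2; the coefficients of $e - e'$ are read off on the images. *)
Lemma anchor_injective (e e' : fibre q) : anchor A q e = anchor A q e' -> e = e'.
Proof.
move=> ee; have [s0 [s1 [_ _ fr]]] := regular_sections rq.
have [i iq] := tdom_cover (abundle A) q.
have frs : free2 (s0 q) (s1 q).
  move=> a b ab; apply: fr.
  by rewrite -!linearZ -linearD ab linear0.
have [x [y]] : exists x y : R, e - e' = x *: s0 q + y *: s1 q.
  have b0 := trivV_basis (s0 q) iq; have b1 := trivV_basis (s1 q) iq.
  have b := trivV_basis (e - e') iq.
  move: frs; rewrite {1}b0 {1}b1.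
  move=> /(free2_span (triv i q (e - e')).1 (triv i q (e - e')).2) [x [y exy]].
  by exists x, y; rewrite {1}b exy -b0 -b1.
move=> exy; have [x0 y0] : x = 0 /\ y = 0.
  apply: fr; rewrite -!linearZ -linearD -exy linearB /= ee subrr //.
by apply/eqP; rewrite -subr_eq0 exy x0 y0 !scale0r addr0.
Qed.

Lemma metric_anchor (e e' : fibre q) : metric A q (anchor A q e) (anchor A q e') = scal e e'.
Proof.
have lift f : xget 0 [set e : fibre q | anchor A q e = anchor A q f] = f.
  by apply: xget_subset1 => // a b /= ha hb; apply: anchor_injective; rewrite ha hb.
by rewrite /metric !lift.
Qed.

Lemma scal_oppl (e e' : fibre q) : scal (- e) e' = - scal e e'.
Proof.
have s0 : scal (0 : fibre q) e' = 0.
  have := scal_lin 1 0 0 e'; rewrite scale1r addr0; lra.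
by have := scal_lin (-1) e 0 e'; rewrite scaleN1r addr0 s0 addr0 mulN1r.
Qed.

Lemma scal_subl (e1 e2 e : fibre q) : scal (e1 - e2) e = scal e1 e - scal e2 e.
Proof. by have := scal_lin 1 e1 (- e2) e; rewrite scale1r mul1r scal_oppl. Qed.

Let is_gradient phi := [set v | tangent S q v /\ forall w, tangent S q w -> metric A q v w = w phi].

Lemma is_gradient_subset1 phi : is_subset1 (is_gradient phi).
Proof.
move=> v v' [tv gv] [tv' gv'].
have [e ev] := anchor_onto tv; have [e' ev'] := anchor_onto tv'.
rewrite -ev -ev'; congr (anchor A q _); apply/eqP; rewrite -subr_eq0; apply/eqP.
apply: contrapT => /eqP /scal_pos; rewrite scal_subl.
have ta := anchor_tangent (e - e').
have := gv _ ta; have := gv' _ ta; rewrite -ev -ev' !metric_anchor => -> ->.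
by rewrite subrr ltxx.
Qed.

(** Negation exchanges the gradients of [phi] and [psi] at [q], and there is at most one of each. If
    one of them does not exist, neither does the other, and both sides are the default 0 of
    [xget]. *)
Lemma gradient_opp phi psi (W : set M) : smooth S phi -> smooth S psi ->
  open W -> W q -> (forall p, W p -> psi p = - phi p) ->
  gradient A psi q = - gradient A phi q.
Proof.
move=> sphi spsi oW Wq e.
have ws w : tangent S q w -> w psi = - w phi.
  by move=> tw; rewrite (tangent_local tw spsi (smoothN sphi) oW Wq e) (tangent_opp tw sphi).
have opp f g v : (forall w, tangent S q w -> w g = - w f) ->
    is_gradient f v -> is_gradient g (- v).
  move=> fg [tv gv]; have [a av] := anchor_onto tv.
  split; first by rewrite -av -linearN; exact: anchor_tangent.
  move=> w tw; have [b bw] := anchor_onto tw.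
  by rewrite fg // -gv // -av -bw -linearN !metric_anchor scal_oppl.
rewrite /gradient -/(is_gradient psi) -/(is_gradient phi).
have [[v gv]|ng] := pselect (exists v, is_gradient phi v).
  rewrite (xget_subset1 _ gv (@is_gradient_subset1 phi)).
  exact: xget_subset1 (opp _ _ _ ws gv) (@is_gradient_subset1 psi).
rewrite !xgetPN ?oppr0 //.
  by move=> v gv; apply: ng; exists v.
move=> v gv; apply: ng; exists (- v); apply: opp gv => w tw.
by rewrite ws // opprK.
Qed.

Lemma gradient_local phi psi (W : set M) : smooth S phi -> smooth S psi ->
  open W -> W q -> (forall p, W p -> psi p = phi p) ->
  gradient A psi q = gradient A phi q.
Proof.
move=> sphi spsi oW Wq e; rewrite /gradient; congr (xget 0 _).
apply/seteqP; split=> v [tv gv]; split=> // w tw.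
  by rewrite gv // (tangent_local tw spsi sphi oW Wq e).
by rewrite gv // (tangent_local tw spsi sphi oW Wq e).
Qed.

End Regular.

Lemma components_opp c q v : atlas S c -> cdom c q ->
  components S c q (- v) = - components S c q v.
Proof.
move=> Ac cq.
pose P u := [set a : R * R | u = a.1 *: coord_vector S c false q + a.2 *: coord_vector S c true q].
have P1 u : is_subset1 (P u).
  by move=> a b /= ea eb; apply: (coord_vectors_free Ac cq); rewrite -ea -eb.
have PN u a : P u a -> P (- u) (- a).
  by rewrite /P /= => ->; rewrite opprD !scaleNr.
rewrite /components -/(P (- v)) -/(P v).
have [[a Pa]|nP] := pselect (exists a, P v a).
  by rewrite (xget_subset1 _ Pa (@P1 v)) (xget_subset1 _ (PN _ _ Pa) (@P1 _)).
rewrite !xgetPN ?oppr0 //; first by move=> a Pa; apply: nP; exists a.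
by move=> a /PN; rewrite opprK => Pa; apply: nP; exists (- a).
Qed.

(* No derivability is needed: the limit defining ['D_v f] is [0] when it does
   not exist. *)
Lemma partial_opp b (f : R * R -> R) y : partial b (fun z => - f z) y = - partial b f y.
Proof.
rewrite /partial; have [df|ndf] := pselect (derivable f y (axis R b)).
  exact: deriveN.
have ndN : ~ derivable (fun z => - f z) y (axis R b).
  move=> dN; apply: ndf; have := derivableN dN.
  by rewrite (_ : (- _)%R = f) //; apply/funext => z; exact: opprK.
by rewrite /derive (dvgP ndf) (dvgP ndN); exact/esym/oppr0.
Qed.

(** The divergence differentiates at [q], so the gradients have to be opposite on a whole
    neighbourhood; this is why [W] lies in the regular set. *)
Lemma real_laplacian_opp phi psi q (W : set M) : smooth S phi -> smooth S psi ->
  open W -> W `<=` ~` singular_set A -> W q -> (forall p, W p -> psi p = - phi p) ->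
  real_laplacian A psi q = - real_laplacian A phi q.
Proof.
move=> sphi spsi oW WZ Wq e; rewrite /real_laplacian /divergence.
set c := chart_at S q.
have [Ac cq] : atlas S c /\ cdom c q by rewrite /c /chart_at; case: cid.
rewrite -mulrN; congr (_ * _); rewrite -sumrN; apply: eq_bigr => b _.
rewrite -partial_opp; apply: partial_near.
have oU := @cof_preimage_open _ _ c _ oW.
have Uq : (cimg c `&` cof c @^-1` W) (cto c q).
  by split; [exact: cto_img|rewrite /= cto_K].
apply: filterS (open_nbhs_nbhs (conj oU Uq)) => y [cy Wy].
rewrite (gradient_opp (WZ _ Wy) sphi spsi oW Wy e) components_opp //; last exact: cof_dom.
by rewrite -mulrN; congr (_ * _); case: b.
Qed.

Lemma real_laplacian_local phi psi q (W : set M) : smooth S phi -> smooth S psi ->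
  open W -> W q -> (forall p, W p -> psi p = phi p) ->
  real_laplacian A psi q = real_laplacian A phi q.
Proof.
move=> sphi spsi oW Wq e; rewrite /real_laplacian /divergence.
set c := chart_at S q.
have [Ac cq] : atlas S c /\ cdom c q by rewrite /c /chart_at; case: cid.
congr (_ * _); apply: eq_bigr => b _; apply: partial_near.
have oU := @cof_preimage_open _ _ c _ oW.
have Uq : (cimg c `&` cof c @^-1` W) (cto c q).
  by split; [exact: cto_img|rewrite /= cto_K].
apply: filterS (open_nbhs_nbhs (conj oU Uq)) => y [cy Wy].
by rewrite (gradient_local sphi spsi oW Wy e).
Qed.

End AnchorOffSingularSet.

(** * Openness of the regular set *)

Section SingularSetClosed.
Context (R : realType) (M : topologicalType) (S : smooth_surface R M) (A : ars S).
Implicit Types (q : M) (phi psi : M -> R).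

Lemma smooth_anchor_section (s : forall p, fib (abundle A) p) phi (i : tindex (abundle A)) :
  smooth_section s -> smooth S phi ->
  smooth_on S (tdom i) (fun p => anchor A p (s p) phi).
Proof.
move=> ss sphi; have oi := tdom_open i.
apply: (smooth_on_eq oi _ (smooth_onD oi
  (smooth_onM oi (ss i false) (anchor_smooth (1, 0) sphi))
  (smooth_onM oi (ss i true) (anchor_smooth (0, 1) sphi)))).
move=> p ip /=; rewrite [in RHS](trivV_basis (s p) ip).
by rewrite linearD !linearZ.
Qed.

(** If all these determinants vanished, then for a [phi] with $v\varphi \ne 0$ the combination
    $-(w\varphi)v + (v\varphi)w$ would be a nontrivial relation. *)
Lemma free2_det (v w : functional R M) : free2 v w ->
  exists phi psi, v phi * w psi - v psi * w phi != 0.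
Proof.
move=> fr; apply: contrapT => nex.
have det0 phi psi : v phi * w psi - v psi * w phi = 0.
  by apply: contrapT => /eqP h; apply: nex; exists phi, psi.
have [phi vphi] : exists phi, v phi != 0.
  apply: contrapT => nphi; have [] := fr 1 0.
    rewrite scale1r scale0r addr0; apply/funext => phi.
    by apply: contrapT => /eqP h; apply: nphi; exists phi.
  by move/eqP; rewrite oner_eq0.
have [] := fr (- w phi) (v phi).
  apply/funext => psi; rewrite -[RHS](det0 phi psi).
  rewrite -[LHS]/(- w phi * v psi + v phi * w psi); ring.
by move=> _ v0; rewrite v0 eqxx in vphi.
Qed.

(* Independence of two horizontal fields at a point is detected by a 2 x 2
   determinant of smooth functions, hence persists nearby. *)
Lemma open_regular : open (~` singular_set A).
Proof.
rewrite openE => q rq.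
have [s0 [s1 [ss0 ss1 fr]]] := regular_sections rq.
have [phi [psi det]] := free2_det fr.
have [_ _ z0] := anchor_tangent (s0 q); have [_ _ z1] := anchor_tangent (s1 q).
(* Tangent vectors vanish on non-smooth functions, so a nonzero determinant forces both test
   functions to be smooth. *)
have sphi : smooth S phi.
  by apply: contrapT => n; move: det; rewrite (z0 _ n) (z1 _ n) mul0r mulr0 subrr eqxx.
have spsi : smooth S psi.
  by apply: contrapT => n; move: det; rewrite (z0 _ n) (z1 _ n) mulr0 mul0r subrr eqxx.
have [i iq] := tdom_cover (abundle A) q.
have c s f : smooth_section s -> smooth S f -> {for q, continuous (fun p => anchor A p (s p) f)}.
  by move=> ss sf; exact: (smooth_on_continuous (smooth_anchor_section ss sf) iq).
have cdet : {for q, continuous (fun p => anchor A p (s0 p) phi * anchor A p (s1 p) psi -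
    anchor A p (s0 p) psi * anchor A p (s1 p) phi)}.
  by apply: continuousB; apply: continuousM; apply: c.
have nz : \forall p \near q, anchor A p (s0 p) phi * anchor A p (s1 p) psi -
    anchor A p (s0 p) psi * anchor A p (s1 p) phi != 0.
  by move: cdet => /cvgr_neq0; apply.
apply: filterS nz => p nz sp.
pose w (j : 'I_2) := if j == ord0 then anchor A p (s0 p) else anchor A p (s1 p).
have hw j : eval_at (horizontal_fields A) p (w j).
  rewrite /w; case: ifP => _.
    by exists (fun p => anchor A p (s0 p)) => //; exists s0.
  by exists (fun p => anchor A p (s1 p)) => //; exists s1.
have [a [[j aj]]] := sp w hw.
rewrite !big_ord_recl big_ord0 addr0 /w /= => sum0.
set a0 := a ord0 in sum0; set a1 := a (lift ord0 ord0) in sum0.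
have ev f : a0 * anchor A p (s0 p) f + a1 * anchor A p (s1 p) f = 0.
  by have := congr1 (fun u : functional R M => u f) sum0.
have e1 := ev phi; have e2 := ev psi.
move: nz e1 e2; move: (anchor A p (s0 p) phi) (anchor A p (s1 p) phi) => x y.
move: (anchor A p (s0 p) psi) (anchor A p (s1 p) psi) => x' y' nz e1 e2.
have a00 : a0 = 0.
  have : a0 * (x * y' - x' * y) = 0.
    transitivity (y' * (a0 * x + a1 * y) - y * (a0 * x' + a1 * y')); first by ring.
    by rewrite e1 e2 !mulr0 subrr.
  by move/eqP; rewrite mulf_eq0 (negbTE nz) orbF => /eqP.
have a10 : a1 = 0.
  have : a1 * (x * y' - x' * y) = 0.
    transitivity (x * (a0 * x' + a1 * y') - x' * (a0 * x + a1 * y)); first by ring.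
    by rewrite e1 e2 !mulr0 subrr.
  by move/eqP; rewrite mulf_eq0 (negbTE nz) orbF => /eqP.
move: aj; have [j0 j1|j1] := unliftP ord0 j.
  by rewrite j1 (ord1 j0) -/a1 a10 eqxx.
by rewrite j1 -/a0 a00 eqxx.
Qed.

End SingularSetClosed.

(** * Connected components of open sets *)

Section Components.
Context (R : realType) (M : topologicalType) (S : smooth_surface R M).
Implicit Types (p q : M) (X : set M).

(** In a small square of a chart, [p] is joined to every point by the image of a straight
    segment. *)
Lemma surface_locally_connected X p : open X -> X p ->
  \forall x \near p, connected_component X p x.
Proof.
move=> oX Xp; have [c [Ac cp]] := atlas_cover S p.
have [r r0 Hr] := small_box cp oX Xp.
have oV := @cto_preimage_open _ _ c _ (@ball_open _ _ (cto c p) (2 * r)).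
have Vp : (cdom c `&` cto c @^-1` ball (cto c p) (2 * r)) p.
  by split=> //; apply: ballxx; lra.
apply: filterS (open_nbhs_nbhs (conj oV Vp)) => x [cx Bx].
exists ((fun t => cof c (ray (cto c p) t (cto c x))) @` `[0, 1]%classic); last first.
  by exists 1; rewrite /= ?in_itv /= ?ler01 ?lexx // ray1 cto_K.
have Bt (t : R) : t \in `[0, 1]%R -> ball (cto c p) (2 * r) (ray (cto c p) t (cto c x)).
  by move=> t01; exact: ray_ball0.
split.
- by exists 0; rewrite /= ?in_itv /= ?ler01 ?lexx // ray0 cto_K.
- by move=> _ [t t01 <-]; have [] := Hr _ (Bt t t01).
apply: connected_continuous_connected; first exact: segment_connected.
apply: continuous_in_subspaceT => t; rewrite inE => /Bt /Hr [ct _].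
have cr := cvg_comp _ _ (@continuous_pair_cst _ _ t (cto c x)) (@continuous_ray _ (cto c p) t (cto c x)).
exact: (cvg_comp _ _ cr (cof_cts ct)).
Qed.

Lemma open_component X q : open X -> open (connected_component X q).
Proof.
move=> oX; rewrite openE => p Cp.
have Xp := connected_component_sub Cp.
apply: filterS (surface_locally_connected oX Xp) => x; exact: connected_component_trans Cp.
Qed.

Lemma open_component_compl X q : open X -> open (X `\` connected_component X q).
Proof.
move=> oX; rewrite openE => p [Xp nCp].
apply: filterS (surface_locally_connected oX Xp) => x Cx.
split; first exact: connected_component_sub Cx.
move=> Cqx; apply: nCp; apply: connected_component_trans Cqx _.
exact: connected_component_sym.
Qed.

End Components.

(** * The Laplace-Beltrami operator under the reflection *)

Section ReflectedLaplacian.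
Context (R : realType) (M : ptopologicalType) (S : smooth_surface R M) (A : ars S).
Local Notation Z := (singular_set A).
Local Notation Re := (@complex.Re R).
Local Notation Im := (@complex.Im R).
Variables (W : set M).
Hypotheses (oW : open W) (oW' : open (~` Z `\` W)) (WZ : W `<=` ~` Z).

Let sgn (phi : M -> R) : M -> R := fun p => if `[< W p >] then - phi p else phi p.

Let smooth_sgn phi (K : set M) : smooth S phi -> closed K -> K `<=` ~` Z ->
  (forall p, ~ K p -> phi p = 0) -> smooth S (sgn phi).
Proof.
move=> sphi cK KZ phi0; apply: smooth_on_local => q _.
have son V : smooth_on S V phi by exact: smooth_on_sub sphi.
have [Wq|nWq] := pselect (W q).
  exists W => //; apply: (smooth_on_eq oW _ (smooth_onM oW (smooth_on_cst (-1) oW) (son W))).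
  by move=> p Wp; rewrite /sgn asboolT // mulN1r.
(* The sign may jump at the singular set, but the complement of the support is a neighbourhood of it
   on which [phi] is 0. *)
have [Zq|Zq] := pselect (Z q).
  have oK := closed_openC cK.
  exists (~` K); first by move=> /KZ.
  apply: (smooth_on_eq oK _ (son _)) => p /phi0.
  by rewrite /sgn => ->; case: ifP; rewrite ?oppr0.
exists (~` Z `\` W) => //; apply: (smooth_on_eq oW' _ (son _)) => p [_ Wp].
by rewrite /sgn asboolF.
Qed.

Let Re_reflect phi : Re \o reflect_on W phi = sgn (Re \o phi).
Proof. by apply/funext => p; rewrite /= /reflect_on /sgn; case: ifP; rewrite ?ReN. Qed.

Let Im_reflect phi : Im \o reflect_on W phi = sgn (Im \o phi).
Proof. by apply/funext => p; rewrite /= /reflect_on /sgn; case: ifP; rewrite ?ImN. Qed.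

Let supp_reflect (phi : M -> complex R) :
  [set q | reflect_on W phi q != 0] = [set q | phi q != 0].
Proof.
by apply/seteqP; split=> q /=; rewrite /reflect_on; case: ifP; rewrite ?oppr_eq0.
Qed.

Let off_support (phi : M -> complex R) p : ~ closure [set q | phi q != 0] p -> phi p = 0.
Proof. by move=> n; apply: contrapT => /eqP h; apply: n; exact: subset_closure. Qed.

Lemma test_function_reflect phi : test_function A phi -> test_function A (reflect_on W phi).
Proof.
move=> [sr si cs sZ]; split; rewrite ?supp_reflect //.
- rewrite Re_reflect; apply: (smooth_sgn sr (@closed_closure _ _) sZ) => p /off_support /= ->.
  by [].
- rewrite Im_reflect; apply: (smooth_sgn si (@closed_closure _ _) sZ) => p /off_support /= ->.
  by [].
Qed.

Let real_laplacian_sgn phi q : smooth S phi -> smooth S (sgn phi) -> ~ Z q ->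
  real_laplacian A (sgn phi) q = sgn (real_laplacian A phi) q.
Proof.
move=> s1 s2 Zq; rewrite [in RHS]/sgn; case: asboolP => Wq.
  by apply: (real_laplacian_opp s1 s2 oW WZ Wq) => p Wp; rewrite /sgn asboolT.
have W'q : (~` Z `\` W) q by [].
by apply: (real_laplacian_local _ s1 s2 oW' W'q) => p [_ Wp]; rewrite /sgn asboolF.
Qed.

Lemma laplacian_reflect phi : test_function A phi ->
  laplacian A (reflect_on W phi) = reflect_on W (laplacian A phi).
Proof.
move=> tphi; have [sr si _ _] := tphi; have [sr' si' _ _] := test_function_reflect tphi.
rewrite Re_reflect in sr'; rewrite Im_reflect in si'.
apply/funext => q; rewrite [in RHS]/reflect_on /laplacian.
(* On the singular set the Laplacian is 0 by convention, which a change of sign preserves. *)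
case: asboolP => Zq; first by case: ifP; rewrite ?oppr0.
rewrite Re_reflect Im_reflect !real_laplacian_sgn // /sgn.
by case: ifP.
Qed.

Lemma laplace_beltrami_reflect (f g : M -> complex R) :
  laplace_beltrami A (f, g) -> laplace_beltrami A (reflect_on W f, reflect_on W g).
Proof.
move=> [/= tf ->]; split; first exact: test_function_reflect.
by rewrite /= laplacian_reflect.
Qed.

End ReflectedLaplacian.

(** * Confinement of the three evolutions to a component *)

Theorem corollary1 (R : realType) (M : ptopologicalType) (S : smooth_surface R M)
    (A : ars S)
    (Mcompact : compact [set: M])
    (Morientable : orientable S)
    (HA : embedded_curve S (singular_set A))
    (HB : step_two A)
    (omega : {measure set (borel M) -> \bar R})
    (omega_area : riemannian_area A omega)
    (Delta : set ((borel M -> complex R) * (borel M -> complex R)))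
    (Delta_unique : unique (self_adjoint_extension omega (laplace_beltrami A)) Delta)
    (q0 : M) (q0_regular : ~ singular_set A q0)
    (Omega : set M)
    (Omega_component : Omega = connected_component (~` singular_set A) q0) :
  [/\ forall (u0 : borel M -> complex R) (u : R -> borel M -> complex R),
        L2 omega u0 -> supported_in omega Omega u0 ->
        schrodinger_solution omega Delta u0 u ->
        forall t, 0 <= t -> supported_in omega Omega (u t),
      forall (u0 : borel M -> complex R) (u : R -> borel M -> complex R),
        L2 omega u0 -> supported_in omega Omega u0 ->
        heat_solution omega Delta u0 u ->
        forall t, 0 <= t -> supported_in omega Omega (u t) &
      forall (u0 u1 : borel M -> complex R) (u : R -> borel M -> complex R),
        L2 omega u0 -> L2 omega u1 ->
        supported_in omega Omega u0 -> supported_in omega Omega u1 ->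
        wave_solution omega Delta u0 u1 u ->
        forall t, 0 <= t -> supported_in omega Omega (u t)].
Proof.
have oX := open_regular A.
have oO : open Omega by rewrite Omega_component; exact: (open_component S).
have oO' : open (~` singular_set A `\` Omega).
  by rewrite Omega_component; exact: (open_component_compl S).
have OZ : Omega `<=` ~` singular_set A.
  by rewrite Omega_component; exact: connected_component_sub.
have mO : measurable (Omega : set (borel M)) by exact: sub_sigma_algebra.
(* One statement for every function [h] of the operator: the three evolutions differ only in the
   choice of [h], the wave being a sum of two such terms. *)
have key h (v w : borel M -> complex R) : functional_calculus omega Delta h v w ->
    supported_in omega Omega v -> supported_in omega Omega w.
  apply: (supported_functional_calculus mO _ Delta_unique).
  exact: (laplace_beltrami_reflect oO oO' OZ).
split.
- by move=> u0 u _ su sol t t0; exact: key (sol t t0) su.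
- by move=> u0 u _ su sol t t0; exact: key (sol t t0) su.
move=> u0 u1 u _ _ su0 su1 sol t t0; have [v [w [cv cw _ uvw]]] := sol t t0.
have sv := key _ _ _ cv su0; have sw := key _ _ _ cw su1.
apply: filterS3 uvw sv sw => x -> hv hw nO.
by rewrite hv // hw // addr0.
Qed.
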